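(* Suppose $N>G(9+\beta(G,N))(c_A+c_L)$. Let $v$ be a solution, defined for all $t\in\mathbb R$, of the determining form $$\frac{d}{dt}v(t)+\nu Av(t)+P_NB(\varphi v(t)+W(v(t)))=P_Nf\quad\text{in }X$$ with $\|v(t,s)\|\le2\nu\kappa_0G$ for all $t,s\in\mathbb R$, let $w(t,s)=W(v(t))(s)$, let $t_n\to\infty$, and put $$v_n(t,s)=v(t+t_n,s-(t+t_n)),\qquad w_n(t,s)=w(t+t_n,s-(t+t_n)).$$ Let $\bar v,\bar R\in C(\mathbb R,L^\infty(\mathbb R,H)_{\mathrm{weak}^*})$ and $\bar w\in C(\mathbb R^2,V)$ be such that along some subsequence $n_j$, for all $T,S>0$ and all $\xi\in L^1(\mathbb R,H)$: $$\lim_j\sup_{t\in[-T,T]}|(v_{n_j}(t,\cdot)-\bar v(t,\cdot),\xi)|=0,$$ $$\lim_j\sup_{t\in[-T,T]}|(B(v_{n_j}(t,\cdot)-\bar v(t,\cdot))+\bar R(t,\cdot),\xi)|=0,$$ and $w_{n_j}\to\bar w$ in $C([-T,T]\times[-S,S];V)$. If $\bar v(t,s)$ and $\bar w(t,s)$ are both independent of $t$, then $\bar R$ is also independent of $t$, and $\bar u(s)=\bar v(s)+\bar w(s)$ satisfies the Navier–Stokes equation $$\frac{d}{ds}\bar u(s)+\nu A\bar u(s)+B(\bar u(s),\bar u(s))=f+\bar R(s),\qquad s\in\mathbb R .$$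
   Context: Navier–Stokes setting: $\nu,L>0$, $\Omega=[0,L]^2$, $\kappa_0=2\pi/L$. $H$ is the closure in $L^2(\Omega)^2$ of the $\mathbb R^2$-valued $\Omega$-periodic trigonometric polynomials $\phi$ with $\nabla\cdot\phi=0$, $\int_\Omega\phi\,dx=0$; $(\cdot,\cdot)$ and $|\cdot|$ are the $L^2$ scalar product and norm. $A=-\Delta$ on $H$, $V=D(A^{1/2})$, $\|u\|=|A^{1/2}u|$. $B(u,v)=\mathcal P((u\cdot\nabla)v)$ with $\mathcal P$ the Helmholtz–Leray orthogonal projector of $L^2(\Omega)^2$ onto $H$ ($B$ extended by continuity where possible), and $B(u)=B(u,u)$. $f\in H$ is time-independent, $|f|>0$, $G=|f|/(\nu^2\kappa_0^2)$. $N$ is a positive integer, $P_N$ is the orthogonal projector of $H$ onto the span of the eigenvectors of $A$ with eigenvalue $\le(\kappa_0N)^2$, $Q_N=I-P_N$, $h=Q_Nf$. It is assumed that $h\in D(A^{1/2})$. Constants: $c_A,c_B,c_L,c_T$ are fixed absolute constants such that, whenever the norms make sense, $|(B(w,u),v)|\le c_T\|w\|\|u\|(\ln\frac{e\|v\|}{\kappa_0|v|})^{1/2}|v|$; $|(B(w,u),v)|\le c_B\|w\|\|u\|(\ln\frac{e|Aw|}{\kappa_0\|w\|})^{1/2}|v|$; $|(B(w,u),v)|\le c_T\|w\|\|u\|(\ln\frac{e|Au|}{\kappa_0\|u\|})^{1/2}|v|$; $|(B(u,v),w)|\le c_L|u|^{1/2}\|u\|^{1/2}\|v\||w|^{1/2}\|w\|^{1/2}$;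 $|(B(u,v),w)|\le c_L|u|^{1/2}\|u\|^{1/2}\|v\|^{1/2}|Av|^{1/2}|w|$; $|(B(u,v),w)|\le c_A|u|^{1/2}|Au|^{1/2}\|v\||w|$; $|(B(u,v),w)|\le c_A|u|\|v\||w|^{1/2}|Aw|^{1/2}$; $\|u\|_\infty\le c_A|u|^{1/2}|Au|^{1/2}$; $|(B(u,v),w)|\le c_A|u|\|v\|^{1/2}|A^{3/2}v|^{1/2}|w|$. It is assumed that $N>3c_LG$, and $\beta(G,N)=\dfrac{9c_TG(\ln eN)^{1/2}+|h|/|f|}{N-3c_LG}$. $X=C_b(\mathbb R,P_NH)$ is the space of bounded continuous functions of $s\in\mathbb R$ with norm $\|v\|_X=\sup_s\|v(s)\|$; $Y=C_b(\mathbb R,Q_NH)$ has norm $|w|_Y=\sup_s|w(s)|$. $\varphi:\mathbb R\to[0,1]$ is the continuous piecewise linear function equal to $1$ for $|\xi|\le2G$, $0$ for $|\xi|\ge3G$, and affine in between on each side; in equations $\varphi v$ means $s\mapsto\varphi(\|v(s)\|/(\nu\kappa_0))v(s)$. For $v\in X$, $W(v)\in Y$ denotes the unique weak solution $w$ on $\mathbb R$, bounded in the norm $\|\cdot\|$, of $\frac{dw}{ds}+\nu Aw+Q_NB(\varphi v+w)=h$. The determining form is an ODE in $X$ with globally Lipschitz right-hand side; $v(t,s)$ is the value of $v(t)\in X$ at $s$. For $p\in L^\infty(\mathbb R,H)$, $\xi\in L^1(\mathbb R,H)$, $(p,\xi)=\int_{\mathbb R}(p(s),\xi(s))\,ds$;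 $L^\infty(\mathbb R,H)_{\mathrm{weak}^*}$ is $L^\infty(\mathbb R,H)$ with its weak-$*$ topology. Since $\bar R$ is in $L^\infty$ in $s$, the final equation is understood in the usual weak sense. *)

(* Defs.v *)
From HB Require Import structures.
From mathcomp Require Import all_boot all_order all_algebra.
From mathcomp Require Import all_classical all_reals all_analysis.

Set Implicit Arguments.
Unset Strict Implicit.
Unset Printing Implicit Defensive.

Import Order.TTheory GRing.Theory Num.Theory.
Import numFieldNormedType.Exports.

Local Open Scope classical_set_scope.
Local Open Scope ring_scope.

(* Elements of L^2(Omega)^2 are represented by functions R^2 -> R^2, of which
   only the values on Omega = [0, L]^2 matter.  Two representatives are equal in
   L^2(Omega)^2 iff the L^2 seminorm [nrm] of their difference vanishes; the
   notions below are invariant under this equality, except that classical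
   derivatives are only taken of trigonometric polynomials.  Equalities between
   elements of H are stated as [nrm L (u - v) = 0]. *)
Notation sfield R := (R * R -> R)%type (only parsing).
Notation vfield R := (R * R -> R * R)%type (only parsing).

Notation leb R := (@lebesgue_measure R) (only parsing).
Notation leb2 R := (@lebesgue_measure R \x @lebesgue_measure R)%E
  (only parsing).

Section Fields.
Context {R : realType}.
Variable L : R.
Implicit Types (q h : sfield R) (u v w g p z phi : vfield R).

Definition Omega : set (R * R) := `[0, L]%classic `*` `[0, L]%classic.

Definition kappa0 : R := 2 * pi / L.

Definition L2 u :=
  [/\ measurable_fun (Omega : set (measurableTypeR R * measurableTypeR R))
        (fun x => (u x).1 : R),
      measurable_fun (Omega : set (measurableTypeR R * measurableTypeR R))
        (fun x => (u x).2 : R) &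
      (leb2 R).-integrable Omega
        (fun x => ((u x).1 ^+ 2 + (u x).2 ^+ 2)%:E)].

Definition dot u v : R :=
  \int[leb2 R]_(x in Omega) ((u x).1 * (v x).1 + (u x).2 * (v x).2).

Definition nrm u : R := Num.sqrt (dot u u).

Definition d1 q : sfield R := fun x => derive1 (fun y : R => q (y, x.2)) x.1.
Definition d2 q : sfield R := fun x => derive1 (fun y : R => q (x.1, y)) x.2.

Definition cmp1 u : sfield R := fun x => (u x).1.
Definition cmp2 u : sfield R := fun x => (u x).2.

Definition divg u : sfield R := fun x => d1 (cmp1 u) x + d2 (cmp2 u) x.

Definition lapl u : vfield R := fun x =>
  (d1 (d1 (cmp1 u)) x + d2 (d2 (cmp1 u)) x,
   d1 (d1 (cmp2 u)) x + d2 (d2 (cmp2 u)) x).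

(* real Omega-periodic trigonometric polynomials: finite sums of
   a cos(kappa0 k.x) + b sin(kappa0 k.x), with frequencies k in Z^2 *)
Definition strig q := exists s : seq ((int * int) * (R * R)),
  forall x, q x = \sum_(c <- s)
    (c.2.1 * cos (kappa0 * (c.1.1%:~R * x.1 + c.1.2%:~R * x.2)) +
     c.2.2 * sin (kappa0 * (c.1.1%:~R * x.1 + c.1.2%:~R * x.2))).

Definition VV : set (vfield R) := [set phi |
  [/\ strig (cmp1 phi), strig (cmp2 phi),
      forall x, divg phi x = 0,
      \int[leb2 R]_(x in Omega) (phi x).1 = 0 &
      \int[leb2 R]_(x in Omega) (phi x).2 = 0]].

Definition H : set (vfield R) := [set u | L2 u /\
  forall e : R, 0 < e -> exists2 phi, VV phi & nrm (u - phi) < e].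

(* [isA u g]: u belongs to D(A) and A u = g, the operator -Delta on H being
   taken in the sense of periodic distributions. *)
Definition isA u g :=
  [/\ H u, H g & forall phi, VV phi -> dot u (- lapl phi) = dot g phi].

Definition eigen (l : R) (om : vfield R) :=
  [/\ H om, nrm om != 0 & isA om (l *: om)].

(* [isApow a u g]: u belongs to D(A^a) and A^a u = g; the powers of A are given
   by its spectral decomposition, whose eigenvectors are complete in H. *)
Definition isApow (a : R) u g :=
  [/\ H u, H g & forall l om, eigen l om -> dot g om = l `^ a * dot u om].

Definition domA (a : R) : set (vfield R) := [set u | exists g, isApow a u g].
Definition Apow (a : R) u : vfield R := xget 0 [set g | isApow a u g].

Definition V : set (vfield R) := domA (1 / 2).
Definition nrmV u : R := nrm (Apow (1 / 2) u).
Definition nrmA u : R := nrm (Apow 1 u).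
Definition nrmA32 u : R := nrm (Apow (3 / 2) u).

Definition PH (N : nat) : set (vfield R) := [set u | H u /\
  exists (n : nat) (c l : 'I_n -> R) (om : 'I_n -> vfield R),
    (forall i, eigen (l i) (om i) /\ l i <= (kappa0 * N%:R) ^+ 2) /\
    nrm (u - \sum_(i < n) c i *: om i) = 0].

Definition PN (N : nat) u : vfield R :=
  xget 0 [set p | PH N p /\ forall z, PH N z -> dot (u - p) z = 0].
Definition QN (N : nat) u : vfield R := u - PN N u.

Definition QH (N : nat) : set (vfield R) :=
  [set u | H u /\ forall z, PH N z -> dot u z = 0].

(* For u in H and phi in VV the value at phi of B(u, v) = P((u.nabla)v) is
   int (u.nabla)v . phi, the Leray projector being orthogonal.  As div u = 0
   this equals - int (u.nabla)phi . v, which makes sense for all u, v in H and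
   is the extension of B by continuity to H x H, with values in the dual of
   VV. *)
Definition Bform u v phi : R :=
  - \int[leb2 R]_(x in Omega)
     (((u x).1 * d1 (cmp1 phi) x + (u x).2 * d2 (cmp1 phi) x) * (v x).1 +
      ((u x).1 * d1 (cmp2 phi) x + (u x).2 * d2 (cmp2 phi) x) * (v x).2).

(* B(u, v) as an element of H, whenever it is one (for instance when u and v
   belong to P_N H) *)
Definition B u v : vfield R :=
  xget 0 [set g | H g /\ forall phi, VV phi -> dot g phi = Bform u v phi].

(* [isPNB N u v p]: p = P_N B(u, v); here u and v need only be in H. *)
Definition isPNB (N : nat) u v p :=
  PH N p /\ forall phi, VV phi -> PH N phi -> dot p phi = Bform u v phi.

(* L^2 weak periodic partial derivatives of a scalar field *)
Definition isweakd (d : sfield R -> sfield R) q h :=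
  [/\ measurable_fun (Omega : set (measurableTypeR R * measurableTypeR R)) h,
      (leb2 R).-integrable Omega (fun x => (h x ^+ 2)%:E) &
      forall psi, strig psi ->
        \int[leb2 R]_(x in Omega) (h x * psi x) =
        - \int[leb2 R]_(x in Omega) (q x * d psi x)].
Definition w1 q : sfield R := xget 0 [set h | isweakd d1 q h].
Definition w2 q : sfield R := xget 0 [set h | isweakd d2 q h].

(* (B(u, v), w) = int (u.nabla)v . w for v in V; for w in VV it coincides with
   [Bform u v w]. *)
Definition trilin u v w : R :=
  \int[leb2 R]_(x in Omega)
     (((u x).1 * w1 (cmp1 v) x + (u x).2 * w2 (cmp1 v) x) * (w x).1 +
      ((u x).1 * w1 (cmp2 v) x + (u x).2 * w2 (cmp2 v) x) * (w x).2).

Definition constants (cA cB cL cT : R) : Prop :=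
  (forall w u v, V w -> V u -> V v -> nrm v != 0 ->
     `|trilin w u v| <= cT * nrmV w * nrmV u *
       Num.sqrt (ln (expR 1 * nrmV v / (kappa0 * nrm v))) * nrm v) /\
  (forall w u v, domA 1 w -> V u -> H v -> nrmV w != 0 ->
     `|trilin w u v| <= cB * nrmV w * nrmV u *
       Num.sqrt (ln (expR 1 * nrmA w / (kappa0 * nrmV w))) * nrm v) /\
  (forall w u v, V w -> domA 1 u -> H v -> nrmV u != 0 ->
     `|trilin w u v| <= cT * nrmV w * nrmV u *
       Num.sqrt (ln (expR 1 * nrmA u / (kappa0 * nrmV u))) * nrm v) /\
  (forall u v w, V u -> V v -> V w ->
     `|trilin u v w| <= cL * Num.sqrt (nrm u) * Num.sqrt (nrmV u) * nrmV v *
       Num.sqrt (nrm w) * Num.sqrt (nrmV w)) /\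
  (forall u v w, V u -> domA 1 v -> H w ->
     `|trilin u v w| <= cL * Num.sqrt (nrm u) * Num.sqrt (nrmV u) *
       Num.sqrt (nrmV v) * Num.sqrt (nrmA v) * nrm w) /\
  (forall u v w, domA 1 u -> V v -> H w ->
     `|trilin u v w| <= cA * Num.sqrt (nrm u) * Num.sqrt (nrmA u) * nrmV v *
       nrm w) /\
  (forall u v w, H u -> V v -> domA 1 w ->
     `|trilin u v w| <= cA * nrm u * nrmV v * Num.sqrt (nrm w) *
       Num.sqrt (nrmA w)) /\
  (forall u, domA 1 u ->
     {ae leb2 R, forall x, Omega x ->
       Num.sqrt ((u x).1 ^+ 2 + (u x).2 ^+ 2) <=
         cA * Num.sqrt (nrm u) * Num.sqrt (nrmA u)}) /\
  (forall u v w, H u -> domA (3 / 2) v -> H w ->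
     `|trilin u v w| <= cA * nrm u * Num.sqrt (nrmV v) *
       Num.sqrt (nrmA32 v) * nrm w).

End Fields.

Section Determining.
Context {R : realType}.
Variables (nu L : R) (f : vfield R) (N : nat).

Definition G : R := nrm L f / (nu ^+ 2 * kappa0 L ^+ 2).

Definition beta (cL cT : R) : R :=
  (9 * cT * G * Num.sqrt (ln (expR 1 * N%:R)) + nrm L (QN L N f) / nrm L f) /
  (N%:R - 3 * cL * G).

Definition cutoff (xi : R) : R :=
  if `|xi| <= 2 * G then 1
  else if `|xi| <= 3 * G then (3 * G - `|xi|) / G else 0.

Definition cutv (v : R -> vfield R) : R -> vfield R :=
  fun s => cutoff (nrmV L (v s) / (nu * kappa0 L)) *: v s.

Definition X : set (R -> vfield R) := [set v : R -> vfield R |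
  [/\ forall s : R, PH L N (v s),
      exists M, forall s, nrmV L (v s) <= M &
      forall s : R, nrmV L (v s' - v s) @[s' --> s] --> (0 : R)]].

Definition nrmX (v : R -> vfield R) : \bar R :=
  ereal_sup [set (nrmV L (v s))%:E | s in setT].

Definition Y : set (R -> vfield R) := [set w : R -> vfield R |
  [/\ forall s : R, QH L N (w s),
      exists M, forall s, nrm L (w s) <= M &
      forall s : R, nrm L (w s' - w s) @[s' --> s] --> (0 : R)]].

(* test functions of s for weak equations on R: compactly supported C^1 *)
Definition Cc1 : set (R -> R) := [set psi : R -> R |
  [/\ forall s : R, derivable psi s 1, continuous (derive1 psi) &
      exists M : R, forall s : R, M < `|s| -> psi s = 0]].

(* d/ds u + nu A u + B(z, z) = g in the sense of distributions on R with values
   in the dual of VV, tested only against the elements of Phi: with Phi = setT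
   this is the full equation, with Phi = QH it is its image by Q_N. *)
Definition weak_eq (Phi : set (vfield R)) (u z g : R -> vfield R) :=
  forall phi psi, VV L phi -> Phi phi -> Cc1 psi ->
    \int[leb R]_(s in setT)
       (- (derive1 psi s * dot L (u s) phi) +
        psi s * (nu * dot L (u s) (- lapl phi) + Bform L (z s) (z s) phi)) =
    \int[leb R]_(s in setT) (psi s * dot L (g s) phi).

Definition bounded_weak_sol (v w : R -> vfield R) :=
  [/\ Y w, forall s, V L (w s), exists M, forall s, nrmV L (w s) <= M &
      weak_eq (QH L N) w (cutv v + w) (cst (QN L N f))].

Definition solution_map (W : (R -> vfield R) -> (R -> vfield R)) :=
  forall v, X v -> bounded_weak_sol v (W v) /\
    forall w, bounded_weak_sol v w -> forall s, nrm L (w s - W v s) = 0.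

Definition determining_form_sol (W : (R -> vfield R) -> (R -> vfield R))
    (v : R -> R -> vfield R) :=
  forall t, X (v t) /\
    exists D, [/\ X D,
      nrmX (h^-1 *: (v (t + h) - v t) - D) @[h --> (0 : R)^'] --> 0%E &
      forall s, exists2 p,
        isPNB L N (cutv (v t) s + W (v t) s) (cutv (v t) s + W (v t) s) p &
        nrm L (D s + nu *: Apow L 1 (v t s) + p - PN L N f) = 0].

End Determining.

Section Bochner.
Context {R : realType}.
Variables (nu L : R).

(* H is separable, so weak and strong measurability agree (Pettis). *)
Definition measH (p : R -> vfield R) := (forall s, H L (p s)) /\
  forall u, H L u ->
    measurable_fun (setT : set (measurableTypeR R)) (fun s => dot L (p s) u).

Definition L1H : set (R -> vfield R) := [set xi | measH xi /\
  (leb R).-integrable setT (fun s => (nrm L (xi s))%:E)].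

Definition LinfH : set (R -> vfield R) := [set p | measH p /\
  exists M, {ae leb R, forall s : R, nrm L (p s) <= M}].

Definition pairing (p xi : R -> vfield R) : R :=
  \int[leb R]_(s in setT) dot L (p s) (xi s).

(* equality in L^oo(R, H) *)
Definition eqH (p q : R -> vfield R) :=
  {ae leb R, forall s : R, nrm L (p s - q s) = 0}.

Definition C_Linf_weakstar : set (R -> R -> vfield R) := [set p |
  (forall t, LinfH (p t)) /\
  forall xi, L1H xi -> continuous (fun t => pairing (p t) xi)].

Definition C_V_on (K : set (R * R)) (w : R -> R -> vfield R) :=
  (forall x, K x -> V L (w x.1 x.2)) /\
  forall x, K x ->
    nrmV L (w y.1 y.2 - w x.1 x.2) @[y --> within K (nbhs x)] --> (0 : R).

Definition cvg_C_V (K : set (R * R)) (wn : nat -> R -> R -> vfield R)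
    (w : R -> R -> vfield R) :=
  (forall n, C_V_on K (wn n)) /\
  ereal_sup [set (nrmV L (wn n x.1 x.2 - w x.1 x.2))%:E | x in K]
    @[n --> \oo] --> 0%E.

(* lim_n sup_{|t| <= T} |F n t| = 0 *)
Definition cvg0_unif (T : R) (F : nat -> R -> R) :=
  ereal_sup [set `|F n t|%:E | t in `[- T, T]%classic] @[n --> \oo] --> 0%E.

(* weak solution on R of d/ds u + nu A u + B(u, u) = g, with
   u in L^oo_loc(R, V) *)
Definition NSE_weak_sol (u g : R -> vfield R) :=
  [/\ measH u,
      forall M : R, exists C : R, {ae leb R, forall s : R, `|s| <= M ->
        V L (u s) /\ nrmV L (u s) <= C} &
      weak_eq nu L setT u u g].

End Bochner.

(* Main.v *)
Require Import Defs.
From mathcomp Require Import all_boot all_order all_algebra.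
From mathcomp Require Import all_classical all_reals all_analysis.
From mathcomp Require Import measurable_realfun.
From mathcomp Require Import zify ring lra.

(* The v-modes v_j(t, s) = v(t + t_nj, s - t - t_nj) only converge weakly-star, so
   the quadratic term keeps the defect B(v_j - vbar), whose limit is - Rbar; all
   other terms of B(v_j + w_j) pass to the limit because w_j converges strongly.

   Q_N part.  For fixed t the equation satisfied by W(v) at time t + t_nj,
   translated in s, passes to the limit directly.

   P_N part.  The determining form gives d/dt of v_j(t, s) along lines s - t =
   const.  For a test function psi in s, Phi_j(t) = int psi(s) (v_j(t, s), phi) ds
   is therefore differentiable, and Phi_j' converges to the weak form J(t) of the
   limit equation along every bounded sequence of times.  Phi_j converges to
   int psi (vbar, phi), which does not depend on t, so by the mean value theorem
   and the continuity of J we get J = 0.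

   Fields in H are tested against a Parseval frame of explicit trigonometric
   fields, in which A is diagonal.  Once the weak equation holds for each t,
   subtracting two of them shows that Rbar is independent of t. *)

Set Implicit Arguments.
Unset Strict Implicit.
Unset Printing Implicit Defensive.

Import Order.TTheory GRing.Theory Num.Theory.
Import numFieldNormedType.Exports.

Local Open Scope classical_set_scope.
Local Open Scope ring_scope.

(** * Square integrable fields *)

(** Formally, [s -> s - (t + t_n)] makes [v_j] solve a transport equation of speed one in [(t, s)];
    once the limit does not depend on [t], only its [s] derivative is left. The two halves need
    different arguments because [W(v)] solves an equation in [s] for each [t], whereas [v(t)] solves
    none, so the low modes are reached through [t]. Pointwise limits of [Phi_j] say nothing about
    [Phi_j'], and the points given by the mean value theorem move with [j]; hence every convergence
    is stated along bounded sequences [tau j], which the suprema over [[-T, T]] allow, and [J] is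
    continuous because [Rbar] is weak star continuous in [t]. The cross terms of the quadratic term
    are linear in the oscillation [v_j - vbar], which lives in finitely many modes: each one pairs a
    weakly null scalar coefficient with a fixed weight. A second obstacle is that [vbar] and [Rbar]
    are given modulo null sets of [s], and [PN], [Apow], [B] are choices modulo null norm. Fields
    are therefore compared through countably many frame coefficients, and [vbar] is replaced by a
    representative lying in P_N H for every [s]. *)

Section SquareIntegrable.
Context {R : realType} (L : R).
Local Notation T2 := (measurableTypeR R * measurableTypeR R)%type.
Local Notation mu := (leb2 R).
Local Notation D := (Omega L : set T2).
Implicit Types (p q : sfield R) (u v w : vfield R).

Lemma measurable_Omega : measurable D.
Proof. by apply: measurableX; exact: measurable_itv. Qed.

Lemma mu_Omega : mu D = ((Num.max L 0) ^+ 2)%:E.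
Proof.
rewrite /Omega product_measure1E; try exact: measurable_itv.
rewrite /= lebesgue_measure_itv /= lte_fin.
by case: ltP => hL; rewrite ?mule0 expr2 ?mul0r// -EFinD oppr0 addr0.
Qed.

Definition sL2 q := measurable_fun D (q : T2 -> R) /\
  mu.-integrable D (fun x => (q x ^+ 2)%:E).

Lemma sL2_mul p q : sL2 p -> sL2 q -> mu.-integrable D (EFin \o (fun x => p x * q x)).
Proof.
move=> [mp ip] [mq iq].
apply: (le_integrable measurable_Omega _ _ (integrableD measurable_Omega ip iq)).
  by apply/measurable_EFinP; apply: measurable_funM.
move=> x _ /=; rewrite lee_fin.
rewrite [leRHS]ger0_norm ?addr_ge0 ?sqr_ge0 // normrM -[p x ^+ 2]real_normK ?num_real//
  -[q x ^+ 2]real_normK ?num_real//.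
have := sqr_ge0 (`|p x| - `|q x|); have := normr_ge0 (p x); have := normr_ge0 (q x).
nra.
Qed.

Lemma sL2_bounded q (C : R) : measurable_fun D (q : T2 -> R) -> (forall x, `|q x| <= C) -> sL2 q.
Proof.
move=> mq bq; split => //.
apply: measurable_bounded_integrable => //.
- exact: measurable_Omega.
- by move: mu_Omega => /= ->; exact: ltry.
- by apply: measurable_funX.
- exists (C ^+ 2); split; first exact: num_real.
  move=> M CM x _ /=; rewrite ger0_norm ?sqr_ge0//.
  apply: le_trans (ltW CM).
  rewrite -[_ ^+ 2]real_normK ?num_real// lerXn2r ?nnegrE//.
  exact: le_trans (bq x).
Qed.

Lemma sL2D p q : sL2 p -> sL2 q -> sL2 (fun x => p x + q x).
Proof.
move=> hp hq; have [mp ip] := hp; have [mq iq] := hq.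
have ipq := sL2_mul hp hq.
split; first exact: measurable_funD.
have /(integrableZl measurable_Omega 2) i2 := ipq.
have := integrableD measurable_Omega (integrableD measurable_Omega ip i2) iq.
apply: eq_integrable; first exact: measurable_Omega.
by move=> x _ /=; rewrite -!EFinM -!EFinD; congr EFin; ring.
Qed.

Lemma sL2M b q (C : R) : measurable_fun D (b : T2 -> R) -> (forall x, `|b x| <= C) ->
  sL2 q -> sL2 (fun x => b x * q x).
Proof.
move=> mb bb [mq iq]; split; first exact: measurable_funM.
apply: (le_integrable measurable_Omega _ _ (integrableZl measurable_Omega (C ^+ 2) iq)).
  by apply/measurable_EFinP; apply: measurable_funX; apply: measurable_funM.
move=> x _ /=; rewrite lee_fin !ger0_norm ?sqr_ge0 ?(mulr_ge0 (sqr_ge0 _))// ?sqr_ge0// exprMn.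
rewrite ler_wpM2r ?sqr_ge0// -[b x ^+ 2]real_normK ?num_real// lerXn2r ?nnegrE//.
exact: le_trans (bb x).
Qed.

Lemma sL2Z c q : sL2 q -> sL2 (fun x => c * q x).
Proof. by apply: (@sL2M (cst c) q `|c|) => // x; exact: lexx. Qed.

Lemma L2P u : L2 L u <-> sL2 (cmp1 u) /\ sL2 (cmp2 u).
Proof.
split => [[m1 m2 i]|[[m1 i1] [m2 i2]]]; last first.
  split => //.
  by have := integrableD measurable_Omega i1 i2; apply: eq_integrable => //; exact: measurable_Omega.
split; split => //; apply: (le_integrable measurable_Omega _ _ i).
- by apply/measurable_EFinP; exact: measurable_funX.
- by move=> x _ /=; rewrite lee_fin !ger0_norm ?addr_ge0 ?sqr_ge0// lerDl sqr_ge0.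
- by apply/measurable_EFinP; exact: measurable_funX.
- by move=> x _ /=; rewrite lee_fin !ger0_norm ?addr_ge0 ?sqr_ge0// lerDr sqr_ge0.
Qed.

Lemma L2D u v : L2 L u -> L2 L v -> L2 L (u + v).
Proof. by move=> /L2P[? ?] /L2P[? ?]; apply/L2P; split; exact: sL2D. Qed.

Lemma L2Z c u : L2 L u -> L2 L (c *: u).
Proof. by move=> /L2P[? ?]; apply/L2P; split; exact: sL2Z. Qed.

Lemma L20 : L2 L 0.
Proof.
by apply/L2P; split; apply: (@sL2_bounded _ 0);
  [exact: measurable_cst|move=> x; by rewrite le_eqVlt (normr0 R) eqxx|exact: measurable_cst|move=> x; by rewrite le_eqVlt (normr0 R) eqxx].
Qed.

Lemma L2N u : L2 L u -> L2 L (- u).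
Proof. by rewrite -scaleN1r; exact: L2Z. Qed.

Lemma L2B u v : L2 L u -> L2 L v -> L2 L (u - v).
Proof. by move=> hu hv; apply: L2D => //; exact: L2N. Qed.

Lemma L2_sum (I : Type) (s : seq I) (P : pred I) (F : I -> vfield R) :
  (forall i, P i -> L2 L (F i)) -> L2 L (\sum_(i <- s | P i) F i).
Proof. by move=> h; elim/big_ind : _ => //; [exact: L20|exact: L2D]. Qed.

Lemma dot_integrable u v : L2 L u -> L2 L v ->
  mu.-integrable D (EFin \o (fun x => (u x).1 * (v x).1 + (u x).2 * (v x).2)).
Proof.
move=> /L2P[u1 u2] /L2P[v1 v2].
have := integrableD measurable_Omega (sL2_mul u1 v1) (sL2_mul u2 v2).
by apply: eq_integrable; first exact: measurable_Omega.
Qed.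

Lemma dotC u v : dot L u v = dot L v u.
Proof. by apply: eq_Rintegral => x _; rewrite mulrC [in X in _ + X]mulrC. Qed.

Lemma dotDl u v w : L2 L u -> L2 L v -> L2 L w ->
  dot L (u + v) w = dot L u w + dot L v w.
Proof.
move=> hu hv hw; rewrite /dot -RintegralD //; try exact: dot_integrable; last exact: measurable_Omega.
by apply: eq_Rintegral => x _ /=; ring.
Qed.

Lemma dotZl c u w : L2 L u -> L2 L w -> dot L (c *: u) w = c * dot L u w.
Proof.
move=> hu hw; rewrite /dot -RintegralZl //; try exact: dot_integrable; last exact: measurable_Omega.
by apply: eq_Rintegral => x _ /=; rewrite /GRing.scale/=; ring.
Qed.

Lemma dotNl u w : L2 L u -> L2 L w -> dot L (- u) w = - dot L u w.
Proof. by move=> hu hw; rewrite -scaleN1r dotZl// mulN1r. Qed.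

Lemma dotBl u v w : L2 L u -> L2 L v -> L2 L w ->
  dot L (u - v) w = dot L u w - dot L v w.
Proof. by move=> hu hv hw; rewrite dotDl ?dotNl//; exact: L2N. Qed.

Lemma dotDr u v w : L2 L u -> L2 L v -> L2 L w ->
  dot L w (u + v) = dot L w u + dot L w v.
Proof. by move=> *; rewrite dotC dotDl// [dot _ w u]dotC [dot _ w v]dotC. Qed.

Lemma dotZr c u w : L2 L u -> L2 L w -> dot L w (c *: u) = c * dot L w u.
Proof. by move=> *; rewrite dotC dotZl// [dot _ w u]dotC. Qed.

Lemma dot0l w : L2 L w -> dot L 0 w = 0.
Proof. by move=> hw; rewrite -(scale0r (0 : vfield R)) dotZl ?mul0r//; exact: L20. Qed.

Lemma dot_suml (I : Type) (s : seq I) (P : pred I) (c : I -> R) (F : I -> vfield R) w :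
  (forall i, P i -> L2 L (F i)) -> L2 L w ->
  dot L (\sum_(i <- s | P i) c i *: F i) w = \sum_(i <- s | P i) c i * dot L (F i) w.
Proof.
move=> hF hw; elim: s => [|i s ih]; first by rewrite !big_nil dot0l.
rewrite !big_cons; case: ifP => // Pi.
by rewrite dotDl ?dotZl ?ih//; [exact: hF|exact/L2Z/hF|apply: L2_sum => j /hF; exact: L2Z].
Qed.

Lemma dot_ge0 u : 0 <= dot L u u.
Proof. by apply: Rintegral_ge0 => x _; rewrite addr_ge0// -expr2 sqr_ge0. Qed.

Lemma nrm_ge0 u : 0 <= nrm L u.
Proof. exact: sqrtr_ge0. Qed.

Lemma nrm2 u : nrm L u ^+ 2 = dot L u u.
Proof. by rewrite sqr_sqrtr// dot_ge0. Qed.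

Lemma dot_le_nrm u v : L2 L u -> L2 L v -> `|dot L u v| <= nrm L u * nrm L v.
Proof.
move=> hu hv.
have q t : 0 <= dot L u u + 2 * t * dot L u v + t ^+ 2 * dot L v v.
  have := dot_ge0 (u + t *: v).
  have htv := L2Z t hv; have huv := L2D hu htv.
  rewrite dotDl// !dotDr// !dotZl// !dotZr// [dot L v u]dotC; lra.
rewrite -sqrtrM ?dot_ge0// -sqrtr_sqr ler_wsqrtr//.
have := dot_ge0 u; have := dot_ge0 v.
set a := dot L u u in q *; set b := dot L u v in q *; set c := dot L v v in q *.
move=> c0 a0; have [c00|cn0] := eqVneq c 0.
  rewrite c00 mulr0; have [->|b0] := eqVneq b 0; first by rewrite expr0n.
  (* For [c = 0] the quadratic is affine in [t]; at this [t] its value is [-1], a contradiction. *)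
  have := q (- (a + 1) / (2 * b)).
  rewrite c00 mulr0 addr0 (_ : 2 * _ * b = - (a + 1)); last by field.
  lra.
have cp : 0 < c by rewrite lt_neqAle eq_sym cn0.
(* The minimum point of the quadratic; nonnegativity there is the discriminant inequality. *)
have := q (- b / c).
rewrite (_ : a + _ + _ = (a * c - b ^+ 2) / c); last by field.
by rewrite pmulr_lge0 ?invr_gt0// subr_ge0.
Qed.

Lemma nrmD u v : L2 L u -> L2 L v -> nrm L (u + v) <= nrm L u + nrm L v.
Proof.
move=> hu hv; rewrite -(@ler_pXn2r _ 2)// ?nnegrE ?addr_ge0 ?nrm_ge0//.
rewrite sqrrD !nrm2 dotDl// ?dotDr//; last exact: L2D.
rewrite [dot L v u]dotC.
have := dot_le_nrm hu hv; have := ler_norm (dot L u v); lra.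
Qed.

Lemma nrmZ c u : L2 L u -> nrm L (c *: u) = `|c| * nrm L u.
Proof.
move=> hu; rewrite /nrm dotZl ?dotZr//; last exact: L2Z.
by rewrite mulrA -expr2 sqrtrM ?sqr_ge0// sqrtr_sqr.
Qed.

Lemma nrmN u : L2 L u -> nrm L (- u) = nrm L u.
Proof. by move=> hu; rewrite -scaleN1r nrmZ// normrN1 mul1r. Qed.

Lemma nrmB u v : L2 L u -> L2 L v -> nrm L (u - v) <= nrm L u + nrm L v.
Proof. by move=> hu hv; rewrite -[nrm L v]nrmN//; apply: nrmD => //; exact: L2N. Qed.

Lemma nrm0P u v : L2 L u -> L2 L v -> nrm L u = 0 -> dot L u v = 0.
Proof.
move=> hu hv u0; have := dot_le_nrm hu hv.
by rewrite u0 mul0r normr_le0 => /eqP.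
Qed.

End SquareIntegrable.

Lemma is_derive_mulr {R : realType} (c x : R) : is_derive x (1 : R) (fun y : R => c * y) c.
Proof.
by have := is_deriveZ c (is_derive_id x (1:R)); rewrite /GRing.scale /= mulr1.
Qed.

(** * Integrals of trigonometric modes over the square *)

Section TrigIntegrals.
Context {R : realType} (L : R).
Hypothesis L0 : 0 < L.
Local Notation T1 := (measurableTypeR R).
Local Notation T2 := (measurableTypeR R * measurableTypeR R)%type.
Local Notation mu := (leb2 R).
Local Notation D := (Omega L : set T2).

Lemma integrable_itv_bounded (f : R -> R) (C : R) :
  measurable_fun setT (f : T1 -> R) -> (forall x, `|f x| <= C) ->
  (leb R).-integrable `[0, L] (EFin \o f).
Proof.
move=> mf bf; apply: measurable_bounded_integrable.
- exact: measurable_itv.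
- by rewrite /= lebesgue_measure_itv /=; case: ifP => _; rewrite -?EFinD ltry.
- exact: measurable_funTS.
- exists C; split; first exact: num_real.
  by move=> M CM x _ /=; exact: le_trans (bf x) (ltW CM).
Qed.

(** Fubini: the restriction of the integrand to the square is the product of the two restrictions to
    the interval, so the double integral over the plane factors. *)
Lemma Rintegral_Omega_prod (f g : R -> R) (C : R) :
  measurable_fun setT (f : T1 -> R) -> measurable_fun setT (g : T1 -> R) ->
  (forall x, `|f x| <= C) -> (forall x, `|g x| <= C) ->
  \int[mu]_(x in D) (f x.1 * g x.2) =
  \int[leb R]_(x in `[0, L]) f x * \int[leb R]_(x in `[0, L]) g x.
Proof.
move=> mf mg bf bg.
have C0 : 0 <= C by exact: le_trans (normr_ge0 _) (bf 0).
have If := integrable_itv_bounded mf bf; have Ig := integrable_itv_bounded mg bg.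
have mI : measurable (`[0, L]%classic : set T1) by exact: measurable_itv.
have mD := @measurable_Omega R L.
have Ig' : (leb R).-integrable setT (EFin \o (g \_ `[0, L])).
  by rewrite -restrict_EFin; apply/integrable_restrict => //=; rewrite setTI.
have If' : (leb R).-integrable setT (EFin \o (f \_ `[0, L])).
  by rewrite -restrict_EFin; apply/integrable_restrict => //=; rewrite setTI.
have IFG : mu.-integrable D (EFin \o (fun x => f x.1 * g x.2)).
  apply: measurable_bounded_integrable => //.
  - by move: (@mu_Omega R L) => /= ->; exact: ltry.
  - apply: measurable_funTS; apply: measurable_funM.
      exact: (measurableT_comp mf measurable_fst).
    exact: (measurableT_comp mg measurable_snd).
  - exists (C * C); split; first exact: num_real.
    move=> M CM x _ /=; rewrite normrM; apply: le_trans (ltW CM).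
    by rewrite ler_pM.
have E (z : T2) : ((fun x => f x.1 * g x.2) \_ D) z =
    (f \_ `[0, L]) z.1 * (g \_ `[0, L]) z.2.
  case: z => x y; rewrite !patchE /= /Omega in_setX /=.
  by do 2 case: (_ \in _) => //=; rewrite ?mulr0 ?mul0r.
rewrite Rintegral_mkcond /Rintegral -integral12_prod_meas1; last first.
  by move/(integrable_mkcond _ mD): IFG; rewrite restrict_EFin.
transitivity (fine (\int[leb R]_x (((f \_ `[0, L]) x)%:E * (\int[leb R]_(y in `[0, L]) g y)%R%:E))%E).
  congr fine; apply: eq_integral => x _; rewrite /fubini_F.
  under eq_integral => y _ do rewrite E /= EFinM.
  rewrite integralZl //; congr (_ * _)%E.
  rewrite /Rintegral fineK; last exact: integrable_fin_num.
  by rewrite [in RHS]integral_mkcond restrict_EFin.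
rewrite integralZr // fineM ?fin_num_fine//; last exact: integrable_fin_num.
by rewrite [X in _ = fine X * _]integral_mkcond restrict_EFin.
Qed.

Let k0 : R := kappa0 L.

Lemma kappa0_gt0 : 0 < k0.
Proof. by rewrite divr_gt0// mulr_gt0// pi_gt0. Qed.

Lemma cos_sin_2pin (n : nat) : cos (2 * pi * n%:R) = 1 :> R /\ sin (2 * pi * n%:R) = 0 :> R.
Proof.
elim: n => [|n [c s]]; first by rewrite mulr0 cos0 sin0.
rewrite -[n.+1%:R]natr1 mulrDr mulr1 cosD sinD c s.
have -> : 2 * pi = pi *+ 2 :> R by rewrite mulr_natl.
by rewrite cos2pi sin2pi !mul0r !mulr0 mulr1 subr0 addr0.
Qed.

Lemma cos_sin_2piz (m : int) : cos (2 * pi * m%:~R) = 1 :> R /\ sin (2 * pi * m%:~R) = 0 :> R.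
Proof.
case: (intP m) => [|n|n]; first by rewrite mulr0 cos0 sin0.
  exact: cos_sin_2pin.
by rewrite mulrNz mulrN cosN sinN; case: (cos_sin_2pin n.+1) => -> ->; rewrite oppr0.
Qed.

Lemma measurable_cosZ (c : R) : measurable_fun setT ((fun x => cos (c * x)) : T1 -> R).
Proof.
apply: continuous_measurable_fun => x.
apply: continuous_comp; last exact: continuous_cos.
by apply: continuousM; [exact: cvg_cst|exact: cvg_id].
Qed.

Lemma measurable_sinZ (c : R) : measurable_fun setT ((fun x => sin (c * x)) : T1 -> R).
Proof.
apply: continuous_measurable_fun => x.
apply: continuous_comp; last exact: continuous_sin.
by apply: continuousM; [exact: cvg_cst|exact: cvg_id].
Qed.

Lemma Rintegral_FTC (f F : R -> R) : continuous f ->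
  (forall x : R, is_derive x (1:R) F (f x)) ->
  \int[leb R]_(x in `[0, L]) f x = F L - F 0.
Proof.
move=> cf dF; rewrite /Rintegral (@continuous_FTC2 _ f F)//.
- by apply: continuous_subspaceT.
- have cF x : {for x, continuous F}.
    by apply: differentiable_continuous; apply/derivable1_diffP; case: (dF x).
  split=> [x _| |].
  + by case: (dF x).
  + exact: (cvg_at_right_filter (cF _)).
  + exact: (cvg_at_left_filter (cF _)).
- by move=> x _; rewrite derive1E; apply: derive_val.
Qed.

Lemma Rintegral_cos_1d (m : int) :
  \int[leb R]_(x in `[0, L]) cos (k0 * m%:~R * x) = L * (m == 0)%:R.
Proof.
have [->|m0] := eqVneq m 0.
  under eq_Rintegral do rewrite mulr0 mul0r cos0.
  rewrite Rintegral_cst; last exact: measurable_itv.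
  by move: (lebesgue_measure_itv `[0, L]%R) => /= ->; rewrite lte_fin L0 oppr0 adde0 mul1r mulr1.
have c0 : k0 * m%:~R != 0 :> R by rewrite mulf_neq0 ?intr_eq0// gt_eqF// kappa0_gt0.
have dF (x : R) : is_derive x (1:R) (fun x => (k0 * m%:~R)^-1 * sin (k0 * m%:~R * x)) (cos (k0 * m%:~R * x)).
  apply: (is_derive_eq (is_deriveZ _ (is_derive1_comp (is_derive_sin _) (is_derive_mulr _ _)))).
  by rewrite /GRing.scale /= mulrCA mulVf// mulr1.
rewrite (Rintegral_FTC _ dF).
- rewrite mulr0 sin0 mulr0 subr0 /k0 /kappa0 mulrAC divfK ?gt_eqF//.
  by case: (cos_sin_2piz m) => _ ->; rewrite !mulr0.
- move=> x; apply: continuous_comp; last exact: continuous_cos.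
  by apply: continuousM; [exact: cvg_cst|exact: cvg_id].
Qed.

Lemma Rintegral_sin_1d (m : int) :
  \int[leb R]_(x in `[0, L]) sin (k0 * m%:~R * x) = 0.
Proof.
have [->|m0] := eqVneq m 0.
  under eq_Rintegral do rewrite mulr0 mul0r sin0.
  rewrite Rintegral_cst; last exact: measurable_itv.
  by rewrite mul0r.
have c0 : k0 * m%:~R != 0 :> R by rewrite mulf_neq0 ?intr_eq0// gt_eqF// kappa0_gt0.
have dF (x : R) : is_derive x (1:R) (fun x => - (k0 * m%:~R)^-1 * cos (k0 * m%:~R * x)) (sin (k0 * m%:~R * x)).
  apply: (is_derive_eq (is_deriveZ _ (is_derive1_comp (is_derive_cos _) (is_derive_mulr _ _)))).
  by rewrite /GRing.scale /= mulrCA [X in _ * X]mulNr mulVf// mulrN1 opprK.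
rewrite (Rintegral_FTC _ dF).
- rewrite mulr0 cos0 /k0 /kappa0 mulrAC divfK ?gt_eqF//.
  by case: (cos_sin_2piz m) => -> _; rewrite subrr.
- move=> x; apply: continuous_comp; last exact: continuous_sin.
  by apply: continuousM; [exact: cvg_cst|exact: cvg_id].
Qed.


(** Sine and cosine share one family indexed by a boolean, so that multiplication acts on types by
    [(+)] and differentiation by [~~]. *)
Definition tg (k : int * int) (b : bool) : sfield R := fun x =>
  (if b then sin else cos) (k0 * (k.1%:~R * x.1 + k.2%:~R * x.2)).

Lemma measurable_tg k b : measurable_fun setT (tg k b : T2 -> R).
Proof.
have ml : measurable_fun setT
    ((fun x => k0 * (k.1%:~R * x.1 + k.2%:~R * x.2)) : T2 -> R).
  apply: measurable_funM; first exact: measurable_cst.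
  apply: measurable_funD; apply: measurable_funM; [exact: measurable_cst|exact: measurable_fst|
    exact: measurable_cst|exact: measurable_snd].
rewrite /tg; case: b; apply: (measurableT_comp _ ml); apply: continuous_measurable_fun.
- exact: continuous_sin.
- exact: continuous_cos.
Qed.

Lemma tg_le1 k b x : `|tg k b x| <= 1.
Proof. by rewrite /tg; case: b; rewrite ler_norml ?sin_geN1 ?sin_le1 ?cos_geN1 ?cos_le1. Qed.

Lemma sL2_tg k b : sL2 L (tg k b).
Proof.
by apply: (sL2_bounded _ (tg_le1 k b)); apply: measurable_funTS; exact: measurable_tg.
Qed.

Lemma bounded_Omega_integrable (q : sfield R) (C : R) :
  measurable_fun setT (q : T2 -> R) -> (forall x, `|q x| <= C) -> mu.-integrable D (EFin \o q).
Proof.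
move=> mq bq; apply: measurable_bounded_integrable.
- exact: measurable_Omega.
- by move: (@mu_Omega R L) => /= ->; exact: ltry.
- exact: measurable_funTS.
- exists C; split; first exact: num_real.
  by move=> M CM x _ /=; exact: le_trans (bq x) (ltW CM).
Qed.

Lemma tg_integrable k b : mu.-integrable D (EFin \o tg k b).
Proof. exact: bounded_Omega_integrable (measurable_tg k b) (tg_le1 k b). Qed.

(** The addition formulas split a mode into two products of one-variable functions, to which Fubini
    applies; a product with a sine factor integrates to zero. *)
Lemma Rintegral_tg k b :
  \int[mu]_(x in D) tg k b x = if b then 0 else L ^+ 2 * (k == (0, 0))%:R.
Proof.
case: k => k1 k2.
have mD := @measurable_Omega R L.
pose A b1 b2 (x : T2) : R := (if b1 then sin else cos) (k0 * k1%:~R * x.1) *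
  (if b2 then sin else cos) (k0 * k2%:~R * x.2).
have mc c0 (b0 : bool) : measurable_fun setT ((fun x => (if b0 then sin else cos) (c0 * x)) : T1 -> R).
  by case: b0; [exact: measurable_sinZ|exact: measurable_cosZ].
have bc c0 (b0 : bool) (x : R) : `|(if b0 then sin else cos) (c0 * x)| <= 1 :> R.
  by case: b0; rewrite ler_norml ?sin_geN1 ?sin_le1 ?cos_geN1 ?cos_le1.
have IA b1 b2 : mu.-integrable D (EFin \o A b1 b2).
  apply: (@bounded_Omega_integrable _ 1).
    apply: measurable_funM.
      exact: (measurableT_comp (mc _ _) measurable_fst).
    exact: (measurableT_comp (mc _ _) measurable_snd).
  by move=> x; rewrite /A normrM -[1]mul1r ler_pM.
have EA b1 b2 : \int[mu]_(x in D) A b1 b2 x =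
    (if b1 then 0 else L * (k1 == 0)%:R) * (if b2 then 0 else L * (k2 == 0)%:R).
  rewrite /A (@Rintegral_Omega_prod (fun x => (if b1 then sin else cos) (k0 * k1%:~R * x))
    (fun x => (if b2 then sin else cos) (k0 * k2%:~R * x)) 1) //.
  by case: b1; case: b2; rewrite ?Rintegral_cos_1d ?Rintegral_sin_1d.
case: b.
  transitivity (\int[mu]_(x in D) (A true false x + A false true x)).
    by apply: eq_Rintegral => x _; rewrite /A /tg /= mulrDr sinD !mulrA.
  by rewrite RintegralD // !EA mul0r mulr0 addr0.
transitivity (\int[mu]_(x in D) (A false false x - A true true x)).
  by apply: eq_Rintegral => x _; rewrite /A /tg /= mulrDr cosD !mulrA.
rewrite RintegralB // !EA mul0r subr0 xpair_eqE -mulnb natrM; ring.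
Qed.

Lemma tgN k b x : tg (- k) b x = (-1) ^+ b * tg k b x.
Proof.
rewrite /tg /= !mulrNz !mulNr -opprD mulrN.
by case: b; rewrite ?sinN ?cosN ?mulN1r ?mul1r.
Qed.

(** All four product-to-sum formulas at once. The minus sign sits on the difference frequency for
    cosine times sine, and on the sum frequency for sine times sine. *)
Lemma tgM k m b b' x : tg k b x * tg m b' x =
  2^-1 * ((if ~~ b && b' then -1 else 1) * tg (k - m) (b (+) b') x +
          (if b && b' then -1 else 1) * tg (k + m) (b (+) b') x).
Proof.
rewrite /tg /= !rmorphB !rmorphD /= !mulrDl !mulNr.
rewrite (_ : k0 * (_ - _ + _) = k0 * (k.1%:~R * x.1 + k.2%:~R * x.2) -
  k0 * (m.1%:~R * x.1 + m.2%:~R * x.2)); last by ring.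
rewrite (_ : k0 * (_ + _ + (_ + _)) = k0 * (k.1%:~R * x.1 + k.2%:~R * x.2) +
  k0 * (m.1%:~R * x.1 + m.2%:~R * x.2)); last by ring.
by case: b; case: b'; rewrite /= ?cosB ?cosD ?sinB ?sinD; field.
Qed.

Definition ip (p q : sfield R) : R := \int[mu]_(x in D) (p x * q x).

(** Two terms occur because the frequencies [k] and [- k] give the same function up to the sign
    [(-1) ^+ b]. At [k = 0] both are present: they add up to [L ^+ 2] for the cosine and cancel for
    the sine. *)
Lemma ip_tg k b m b' : ip (tg k b) (tg m b') =
  L ^+ 2 / 2 * (b == b')%:R * ((m == k)%:R + (-1) ^+ b * (m == - k)%:R).
Proof.
have mD := @measurable_Omega R L.
rewrite /ip; under eq_Rintegral do rewrite tgM.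
have It k' b0 := tg_integrable k' b0.
have IZ c k' b0 : mu.-integrable D (EFin \o (fun x => c * tg k' b0 x)).
  by have := integrableZl mD c (It k' b0); apply: eq_integrable => // x _.
rewrite RintegralZl //; last first.
  by have := integrableD mD (IZ (if ~~ b && b' then -1 else 1) (k - m) (b (+) b'))
    (IZ (if b && b' then -1 else 1) (k + m) (b (+) b')); apply: eq_integrable.
rewrite RintegralD // !RintegralZl // !Rintegral_tg.
rewrite (_ : (k - m == (0, 0)) = (m == k)); last by rewrite (subr_eq0 k m) eq_sym.
rewrite (_ : (k + m == (0, 0)) = (m == - k)); last by rewrite addrC (addr_eq0 m k).
by case: b; case: b'; rewrite /= ?expr0 ?expr1; field.
Qed.

Lemma ipC p q : ip p q = ip q p.
Proof. by apply: eq_Rintegral => x _; rewrite mulrC. Qed.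

Lemma ipDl c p q r : sL2 L p -> sL2 L q -> sL2 L r ->
  ip (fun x => c * p x + q x) r = c * ip p r + ip q r.
Proof.
move=> hp hq hr; have mD := @measurable_Omega R L.
rewrite /ip; under eq_Rintegral do rewrite mulrDl -mulrA.
have I1 := sL2_mul hp hr; have I2 := sL2_mul hq hr.
rewrite RintegralD // ?RintegralZl //.
by have := integrableZl mD c I1; apply: eq_integrable.
Qed.

End TrigIntegrals.

Definition rng (M : nat) : seq int := [seq n%:Z - M%:Z | n <- iota 0 (2 * M).+1].
Definition box (M : nat) : seq (int * int) := [seq (i, j) | i <- rng M, j <- rng M].

Lemma mem_rng M i : (i \in rng M) = (absz i <= M)%N.
Proof.
apply/mapP/idP => [[n]|iM]; first by rewrite mem_iota => nM ->; lia.
by exists (absz (i + M%:Z)); [rewrite mem_iota|]; lia.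
Qed.

Lemma uniq_rng M : uniq (rng M).
Proof. by rewrite map_inj_uniq ?iota_uniq// => i j; lia. Qed.

Lemma mem_box M k : (k \in box M) = (absz k.1 <= M)%N && (absz k.2 <= M)%N.
Proof.
case: k => i j; rewrite -!mem_rng; apply/allpairsP/andP => [[[a b] [/= ? ? [-> ->]]]//|[? ?]].
by exists (i, j).
Qed.

Lemma uniq_box M : uniq (box M).
Proof. by rewrite allpairs_uniq ?uniq_rng// => -[? ?] [? ?] _ _ [-> ->]. Qed.

Lemma sum_delta {R : pzSemiRingType} (I : eqType) (s : seq I) (k : I) (F : I -> R) : uniq s -> k \in s ->
  \sum_(i <- s) (i == k)%:R * F i = F k.
Proof.
move=> us ks; rewrite (bigD1_seq k)//= eqxx mul1r big1 ?addr0// => i ik.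
by rewrite (negbTE ik) mul0r.
Qed.

(** * Trigonometric polynomials *)

Section Fourier.
Context {R : realType} (L : R).
Hypothesis L0 : 0 < L.
Local Notation T2 := (measurableTypeR R * measurableTypeR R)%type.
Local Notation k0 := (kappa0 L).
Local Notation tg := (tg L).
Local Notation ip := (ip L).

Lemma strig0 : strig L (fun=> 0).
Proof. by exists [::] => x; rewrite big_nil. Qed.

Lemma strigD p q : strig L p -> strig L q -> strig L (fun x => p x + q x).
Proof. by move=> [s hs] [t ht]; exists (s ++ t) => x; rewrite big_cat hs ht. Qed.

Lemma strigZ c q : strig L q -> strig L (fun x => c * q x).
Proof.
move=> [s hs]; exists [seq (d.1, (c * d.2.1, c * d.2.2)) | d <- s] => x.
by rewrite hs big_map mulr_sumr; apply: eq_bigr => d _ /=; ring.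
Qed.

Lemma strig_tg k b : strig L (tg k b).
Proof.
exists [:: (k, ((~~ b)%:R, b%:R))] => x; rewrite big_seq1 /tg /=.
by case: b; rewrite /= !mul0r !mul1r ?addr0 ?add0r.
Qed.

(** Induction on the list of frequencies, one mode at a time; each list entry holds a cosine and a
    sine, hence uses the step twice. *)
Lemma strig_ind (P : sfield R -> Prop) :
  P (fun=> 0) ->
  (forall c k b q, strig L q -> P q -> P (fun x => c * tg k b x + q x)) ->
  forall q, strig L q -> P q.
Proof.
move=> P0 PD q [s]; elim: s q => [|[k [a b]] s ih] q hq.
  by rewrite (_ : q = fun=> 0)//; apply/funext => x; rewrite hq big_nil.
pose q' x := \sum_(c <- s) (c.2.1 * cos (kappa0 L * (c.1.1%:~R * x.1 + c.1.2%:~R * x.2)) +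
     c.2.2 * sin (kappa0 L * (c.1.1%:~R * x.1 + c.1.2%:~R * x.2))).
have sq' : strig L q' by exists s.
rewrite (_ : q = fun x => a * tg k false x + (b * tg k true x + q' x)); last first.
  by apply/funext => x; rewrite hq big_cons /= addrA.
apply: (PD); last by apply: (PD) => //; exact: ih.
by apply: strigD => //; apply: strigZ; exact: strig_tg.
Qed.

Lemma strigM p q : strig L p -> strig L q -> strig L (fun x => p x * q x).
Proof.
move=> hp hq; move: p hp; apply: strig_ind.
  by rewrite (_ : (fun _ => _) = fun=> 0); [exact: strig0|apply/funext => x; rewrite mul0r].
move=> c k b p hp ih.
rewrite (_ : (fun _ => _) = fun x => c * (tg k b x * q x) + p x * q x); last first.
  by apply/funext => x; rewrite mulrDl mulrA.
apply: strigD => //; apply: strigZ; move: q hq {ih}; apply: strig_ind.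
  by rewrite (_ : (fun _ => _) = fun=> 0); [exact: strig0|apply/funext => x; rewrite mulr0].
move=> c' k' b' q hq ih.
rewrite (_ : (fun _ => _) = fun x => c' * (tg k b x * tg k' b' x) + tg k b x * q x); last first.
  by apply/funext => x; rewrite mulrDr mulrCA.
apply: strigD => //; apply: strigZ.
rewrite (funext (tgM L k k' b b')).
by apply: strigZ; apply: strigD; apply: strigZ; exact: strig_tg.
Qed.

Lemma strig_bounded q : strig L q ->
  measurable_fun setT (q : T2 -> R) /\ exists C : R, forall x, `|q x| <= C.
Proof.
elim/strig_ind => [|c k b {}q _ [mq [C bq]]].
  by split; [exact: measurable_cst|exists 0 => x; rewrite normr0].
split.
  apply: measurable_funD => //; apply: measurable_funM; first exact: measurable_cst.
  exact: measurable_tg.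
exists (`|c| * 1 + C) => x; apply: le_trans (ler_normD _ _) _.
by rewrite lerD// normrM ler_wpM2l// tg_le1.
Qed.

Lemma sL2_strig q : strig L q -> sL2 L q.
Proof.
by move=> /strig_bounded[mq [C bq]]; apply: (sL2_bounded _ bq); exact: measurable_funTS.
Qed.

Lemma is_derive_affine (c p q x : R) :
  is_derive x (1:R) (fun y => c * (p * y + q)) (c * p).
Proof.
apply: (is_derive_eq (is_deriveZ c (is_deriveD (is_derive_mulr p x) (is_derive_cst q x 1)))).
by rewrite /GRing.scale /= addr0.
Qed.

(** The sign produced by differentiating: sine goes to cosine, cosine to minus sine. *)
Definition dsign (b : bool) : R := if b then 1 else -1.

Lemma is_derive_tg1 k b (x : R * R) :
  is_derive x.1 (1:R) (fun y => tg k b (y, x.2)) (k0 * k.1%:~R * dsign b * tg k (~~ b) x).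
Proof.
have h : is_derive x.1 (1 : R) (fun y => k0 * (k.1%:~R * y + k.2%:~R * x.2)) (k0 * k.1%:~R).
  exact: is_derive_affine.
case: b; rewrite /tg /dsign /=.
  by apply: (is_derive_eq (is_derive1_comp (is_derive_sin _) h)); ring.
by apply: (is_derive_eq (is_derive1_comp (is_derive_cos _) h)); ring.
Qed.

Lemma is_derive_tg2 k b (x : R * R) :
  is_derive x.2 (1:R) (fun y => tg k b (x.1, y)) (k0 * k.2%:~R * dsign b * tg k (~~ b) x).
Proof.
have h : is_derive x.2 (1 : R) (fun y => k0 * (k.1%:~R * x.1 + k.2%:~R * y)) (k0 * k.2%:~R).
  rewrite (_ : (fun _ => _) = fun y => k0 * (k.2%:~R * y + k.1%:~R * x.1)).
    exact: is_derive_affine.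
  by apply/funext => y; rewrite addrC.
case: b; rewrite /tg /dsign /=.
  by apply: (is_derive_eq (is_derive1_comp (is_derive_sin _) h)); ring.
by apply: (is_derive_eq (is_derive1_comp (is_derive_cos _) h)); ring.
Qed.

Lemma strig_derivable q : strig L q ->
  (forall x, derivable (fun y : R => q (y, x.2)) x.1 (1 : R)) /\
  (forall x, derivable (fun y : R => q (x.1, y)) x.2 (1 : R)).
Proof.
elim/strig_ind => [|c k b {}q _ [h1 h2]]; first by split => x; exact: derivable_cst.
split => x; apply: derivableD => //; apply: derivableZ.
  by case: (is_derive_tg1 k b x).
by case: (is_derive_tg2 k b x).
Qed.

Lemma d1_tgD c k b q : strig L q ->
  d1 (fun x => c * tg k b x + q x) =
  fun x => c * (k0 * k.1%:~R * dsign b) * tg k (~~ b) x + d1 q x.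
Proof.
move=> /strig_derivable[h _]; apply/funext => x; rewrite /d1 !derive1E.
rewrite (_ : (fun _ => _) = (c \*: (fun y => tg k b (y, x.2))) + (fun y => q (y, x.2)))//.
case: (is_deriveD (is_deriveZ c (is_derive_tg1 k b x)) (derivableP (h x))) => _ ->.
by rewrite /GRing.scale /= !mulrA.
Qed.

Lemma d2_tgD c k b q : strig L q ->
  d2 (fun x => c * tg k b x + q x) =
  fun x => c * (k0 * k.2%:~R * dsign b) * tg k (~~ b) x + d2 q x.
Proof.
move=> /strig_derivable[_ h]; apply/funext => x; rewrite /d2 !derive1E.
rewrite (_ : (fun _ => _) = (c \*: (fun y => tg k b (x.1, y))) + (fun y => q (x.1, y)))//.
case: (is_deriveD (is_deriveZ c (is_derive_tg2 k b x)) (derivableP (h x))) => _ ->.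
by rewrite /GRing.scale /= !mulrA.
Qed.

Lemma d1_0 : d1 (fun=> 0 : R) = fun=> 0.
Proof. by apply/funext => x; rewrite /d1 derive1E derive_cst. Qed.

Lemma d2_0 : d2 (fun=> 0 : R) = fun=> 0.
Proof. by apply/funext => x; rewrite /d2 derive1E derive_cst. Qed.

Lemma strig_d1 q : strig L q -> strig L (d1 q).
Proof.
elim/strig_ind => [|c k b {}q hq ih]; first by rewrite d1_0; exact: strig0.
by rewrite d1_tgD//; apply: strigD => //; apply: strigZ; exact: strig_tg.
Qed.

Lemma strig_d2 q : strig L q -> strig L (d2 q).
Proof.
elim/strig_ind => [|c k b {}q hq ih]; first by rewrite d2_0; exact: strig0.
by rewrite d2_tgD//; apply: strigD => //; apply: strigZ; exact: strig_tg.
Qed.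

Lemma d1_lin c p q : strig L p -> strig L q ->
  d1 (fun x => c * p x + q x) = fun x => c * d1 p x + d1 q x.
Proof.
move=> /strig_derivable[hp _] /strig_derivable[hq _]; apply/funext => x; rewrite /d1 !derive1E.
rewrite (_ : (fun _ => _) = (c \*: (fun y => p (y, x.2))) + (fun y => q (y, x.2)))//.
by case: (is_deriveD (is_deriveZ c (derivableP (hp x))) (derivableP (hq x))) => _ ->.
Qed.

Lemma d2_lin c p q : strig L p -> strig L q ->
  d2 (fun x => c * p x + q x) = fun x => c * d2 p x + d2 q x.
Proof.
move=> /strig_derivable[_ hp] /strig_derivable[_ hq]; apply/funext => x; rewrite /d2 !derive1E.
rewrite (_ : (fun _ => _) = (c \*: (fun y => p (x.1, y))) + (fun y => q (x.1, y)))//.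
by case: (is_deriveD (is_deriveZ c (derivableP (hp x))) (derivableP (hq x))) => _ ->.
Qed.

Lemma ip0l p : ip (fun=> 0) p = 0.
Proof.
rewrite /ip; under eq_Rintegral do rewrite mul0r.
by rewrite Rintegral_cst ?mul0r//; exact: measurable_Omega.
Qed.

Lemma ip_tgDl c k b q m b' : strig L q ->
  ip (fun x => c * tg k b x + q x) (tg m b') = c * ip (tg k b) (tg m b') + ip q (tg m b').
Proof. by move=> hq; rewrite ipDl//; [exact: sL2_tg|exact: sL2_strig|exact: sL2_tg]. Qed.

(** Integration by parts; periodicity leaves no boundary term. It is checked mode by mode from the
    orthogonality relations, separating [k = m], [k = - m] and the rest. *)
Lemma ip_d1 q k b : strig L q ->
  ip (d1 q) (tg k b) = - (k0 * k.1%:~R * dsign b) * ip q (tg k (~~ b)).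
Proof.
elim/strig_ind => [|c m b' {}q hq ih]; first by rewrite d1_0 !ip0l mulr0.
rewrite d1_tgD// ip_tgDl; last exact: strig_d1.
rewrite ip_tgDl// ih !ip_tg// => {ih}.
have [->|km] := eqVneq k m.
  (* When [m = - m] both deltas of [ip_tg] are nonzero, but then [m.1 = 0] and every factor coming
     from the derivative vanishes. *)
  have [mm|mm] := eqVneq m (- m); last by case: b; case: b'; rewrite /dsign /= ?expr1 ?expr0; ring.
  have -> : m.1 = 0 by move/(congr1 fst): mm => /= /eqP; rewrite -addr_eq0 -mulr2n mulrn_eq0/= => /eqP.
  rewrite !mulr0z; case: b; case: b'; rewrite /dsign /=; ring.
have [->|km'] := eqVneq k (- m).
  by rewrite /= mulrNz; case: b; case: b'; rewrite /dsign /= ?expr1 ?expr0; ring.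
rewrite /=; ring.
Qed.

Lemma ip_d2 q k b : strig L q ->
  ip (d2 q) (tg k b) = - (k0 * k.2%:~R * dsign b) * ip q (tg k (~~ b)).
Proof.
elim/strig_ind => [|c m b' {}q hq ih]; first by rewrite d2_0 !ip0l mulr0.
rewrite d2_tgD// ip_tgDl; last exact: strig_d2.
rewrite ip_tgDl// ih !ip_tg// => {ih}.
have [->|km] := eqVneq k m.
  have [mm|mm] := eqVneq m (- m); last by case: b; case: b'; rewrite /dsign /= ?expr1 ?expr0; ring.
  have -> : m.2 = 0 by move/(congr1 snd): mm => /= /eqP; rewrite -addr_eq0 -mulr2n mulrn_eq0/= => /eqP.
  rewrite !mulr0z; case: b; case: b'; rewrite /dsign /=; ring.
have [->|km'] := eqVneq k (- m).
  by rewrite /= mulrNz; case: b; case: b'; rewrite /dsign /= ?expr1 ?expr0; ring.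
rewrite /=; ring.
Qed.

(** The sum over the symmetric box meets each mode twice, at [k] and at [- k]. This is why the
    prefactor is the inverse of [L ^+ 2] and not twice it, and why it is also right at [k = 0]. *)
Lemma strig_fourier q : strig L q -> exists M0, forall M, (M0 <= M)%N -> forall x,
  q x = (L ^+ 2)^-1 * \sum_(k <- box M) (ip q (tg k false) * tg k false x +
                                        ip q (tg k true) * tg k true x).
Proof.
have L2 : L ^+ 2 != 0 by rewrite expf_neq0// gt_eqF.
elim/strig_ind => [|c m b {}q hq [M0 ih]].
  by exists 0%N => M _ x; rewrite big1 ?mulr0// => k _; rewrite !ip0l !mul0r addr0.
exists (maxn M0 (maxn (absz m.1) (absz m.2))) => M; rewrite !geq_max => /and3P[M0M M1 M2] x.
rewrite [q x](ih M)// -[c * _](mulKf L2) -mulrDr; congr (_ * _).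
under [RHS]eq_bigr do rewrite !ip_tgDl// !mulrDl addrACA.
rewrite [RHS]big_split /=; congr (_ + _).
have mM : m \in box M by rewrite mem_box M1 M2.
have mM' : - m \in box M by rewrite mem_box /= !abszN M1 M2.
transitivity (L ^+ 2 / 2 * c * (\sum_(k <- box M) (k == m)%:R * tg k b x +
   (-1) ^+ b * \sum_(k <- box M) (k == - m)%:R * tg k b x)).
  by rewrite (sum_delta _ (uniq_box M) mM) (sum_delta _ (uniq_box M) mM') tgN mulrA -expr2 sqrr_sign mul1r; field.
rewrite mulr_sumr -big_split mulr_sumr; apply: eq_bigr => k _.
by rewrite !ip_tg//; case: b; rewrite /tg /= ?expr1 ?expr0; ring.
Qed.

End Fourier.

Section SquaredModulus.
Context {R : realType}.

Definition n2 (k : int * int) : R := k.1%:~R ^+ 2 + k.2%:~R ^+ 2.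

Lemma n2_ge0 k : 0 <= n2 k. Proof. by rewrite addr_ge0// sqr_ge0. Qed.

Lemma n2_eq0 k : (n2 k == 0) = (k == 0).
Proof.
by case: k => a b; rewrite /n2 paddr_eq0 ?sqr_ge0// !sqrf_eq0 !intr_eq0.
Qed.

Lemma n2_ge1 k : k != 0 -> 1 <= n2 k.
Proof.
case: k => a b; rewrite /n2 /= -!rmorphXn /= -rmorphD /= -[1]/(1%:~R) ler_int => h.
have : a != 0 \/ b != 0.
  have [a0|a0] := eqVneq a 0; last by left.
  by right; apply: contraNneq h => b0; rewrite a0 b0.
by case; nia.
Qed.

End SquaredModulus.

Section LowFrequencies.
Local Notation index := (int * int * bool)%type.

Definition fr (M : nat) : seq index := [seq (k, b) | k <- box M, b <- [:: false; true]].

Lemma boxN N k : k \in box N -> - k \in box N.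
Proof.
by case: k => a b; rewrite -[- (a, b)]/(- a, - b) !mem_box /= !abszN.
Qed.

Lemma boxD N k l : k \in box N -> l \in box N -> k + l \in box (2 * N).
Proof.
case: k l => [a b] [c d]; rewrite -[(a, b) + (c, d)]/(a + c, b + d) !mem_box /=.
by move=> /andP[h1 h2] /andP[h3 h4]; apply/andP; split; lia.
Qed.

Lemma box_sub N M : (N <= M)%N -> {subset box N <= box M}.
Proof. by move=> NM k; rewrite !mem_box => /andP[h1 h2]; rewrite (leq_trans h1) ?(leq_trans h2). Qed.

Lemma mem_fr M (i : index) : (i \in fr M) = (i.1 \in box M).
Proof.
case: i => k b; apply/allpairsP/idP => [[[k' b'] [/= ? _ [-> _]]]//|/= kM].
by exists (k, b); split => //; case: b.
Qed.

Lemma uniq_fr M : uniq (fr M).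
Proof. by rewrite allpairs_uniq ?uniq_box// => -[? ?] [? ?] _ _ [-> ->]. Qed.

(** Stated over the integers, hence independent of the real field and of [L]; it selects the
    eigenvalues at most [(k0 * N) ^+ 2]. *)
Definition low N (i : index) := (i.1.1 ^+ 2 + i.1.2 ^+ 2 <= N%:Z ^+ 2 :> int)%R.

Lemma lowE (R : realType) N i : low N i = (n2 i.1 <= N%:R ^+ 2 :> R).
Proof. by rewrite /low -(ler_int R) rmorphD !rmorphXn. Qed.

Lemma low_box N i : low N i -> i.1 \in box N.
Proof.
case: i => -[a b] c; rewrite /low mem_box /= => h; apply/andP; split; nia.
Qed.

Lemma perm_low_fr N M : (N <= M)%N -> perm_eq [seq i <- fr M | low N i] [seq i <- fr N | low N i].
Proof.
move=> NM; apply: uniq_perm; rewrite ?filter_uniq ?uniq_fr// => i.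
rewrite !mem_filter !mem_fr; case: (boolP (low N i)) => //= /low_box iN.
by rewrite iN; move: iN; rewrite !mem_box => /andP[h1 h2]; rewrite !(leq_trans _ NM).
Qed.

End LowFrequencies.

(** * A Parseval frame of divergence-free eigenfields *)

Section Frame.
Context {R : realType} (L : R).
Hypothesis L0 : 0 < L.
Local Notation T2 := (measurableTypeR R * measurableTypeR R)%type.
Local Notation mu := (leb2 R).
Local Notation D := (Omega L : set T2).
Local Notation k0 := (kappa0 L).
Local Notation tg := (tg L).
Local Notation ip := (ip L).
Local Notation index := (int * int * bool)%type.
Implicit Types (u v w phi : vfield R) (i j : index).

Definition lam i : R := k0 ^+ 2 * n2 i.1.
(** This normalisation gives each nonzero frame element squared norm [1 / 2], so that [k] and [- k]
    together count once. At [k = 0] the value is the default [0^-1 = 0]. *)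
Definition fcoef (k : int * int) : R := (L * Num.sqrt (n2 k))^-1.

(* A Parseval frame of H rather than a basis: k and -k give the same field up to sign. *)
Definition E i : vfield R := fun x =>
  (- i.1.2%:~R * fcoef i.1 * tg i.1 i.2 x, i.1.1%:~R * fcoef i.1 * tg i.1 i.2 x).

Lemma fcoef2 k : fcoef k ^+ 2 * n2 k = (L ^+ 2)^-1 * (k != 0)%:R.
Proof.
rewrite /fcoef exprVn exprMn sqr_sqrtr ?n2_ge0//.
have [->|k0] := eqVneq k 0; first by rewrite /n2 /= !mulr0z expr0n /= addr0 !mulr0.
by rewrite mulr1 invfM -mulrA mulVf ?mulr1// n2_eq0.
Qed.

Lemma E0 b : E (0, b) = 0.
Proof. by apply/funext => x; rewrite /E /= !mulr0z oppr0 !mul0r. Qed.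

Lemma strig_cmp1E i : strig L (cmp1 (E i)).
Proof. by rewrite /cmp1 /E /=; apply: strigZ; exact: strig_tg. Qed.

Lemma strig_cmp2E i : strig L (cmp2 (E i)).
Proof. by rewrite /cmp2 /E /=; apply: strigZ; exact: strig_tg. Qed.

Lemma d1_tg c k b : d1 (fun x => c * tg k b x) = fun x => c * (k0 * k.1%:~R * dsign b) * tg k (~~ b) x.
Proof.
have := @d1_tgD R L c k b _ (strig0 L); rewrite d1_0.
by under eq_fun do rewrite addr0; move=> ->; apply/funext => x; rewrite addr0.
Qed.

Lemma d2_tg c k b : d2 (fun x => c * tg k b x) = fun x => c * (k0 * k.2%:~R * dsign b) * tg k (~~ b) x.
Proof.
have := @d2_tgD R L c k b _ (strig0 L); rewrite d2_0.
by under eq_fun do rewrite addr0; move=> ->; apply/funext => x; rewrite addr0.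
Qed.

Lemma VV_E i : VV L (E i).
Proof.
case: i => k b; split.
- exact: strig_cmp1E.
- exact: strig_cmp2E.
- by move=> x; rewrite /divg /cmp1 /cmp2 /E /= d1_tg d2_tg /=; ring.
- rewrite /E /= RintegralZl ?Rintegral_tg//; [|exact: measurable_Omega|exact: tg_integrable].
  case: b; rewrite ?mulr0//; have [->|] := eqVneq k (0, 0); last by rewrite !mulr0.
  by rewrite /= oppr0 !mul0r.
- rewrite /E /= RintegralZl ?Rintegral_tg//; [|exact: measurable_Omega|exact: tg_integrable].
  case: b; rewrite ?mulr0//; have [->|] := eqVneq k (0, 0); last by rewrite !mulr0.
  by rewrite /= !mul0r.
Qed.

Lemma VV_lin c phi psi : VV L phi -> VV L psi -> VV L (c *: phi + psi).
Proof.
move=> [p1 p2 pd pi1 pi2] [q1 q2 qd qi1 qi2].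
have c1 : cmp1 (c *: phi + psi) = fun x => c * cmp1 phi x + cmp1 psi x by [].
have c2 : cmp2 (c *: phi + psi) = fun x => c * cmp2 phi x + cmp2 psi x by [].
have mD := @measurable_Omega R L.
have I q : strig L q -> mu.-integrable D (EFin \o q).
  by move=> /strig_bounded[mq [C bq]]; exact: bounded_Omega_integrable bq.
split.
- by rewrite c1; apply: strigD => //; exact: strigZ.
- by rewrite c2; apply: strigD => //; exact: strigZ.
- move=> x; rewrite /divg c1 c2 (@d1_lin R L)// (@d2_lin R L)//.
  by rewrite addrACA -mulrDr -/(divg phi x) -/(divg psi x) pd qd mulr0 addr0.
- rewrite (_ : (fun x => _) = fun x => c * cmp1 phi x + cmp1 psi x)//.
  rewrite RintegralD//; [|by have := integrableZl mD c (I _ p1); apply: eq_integrable|exact: I].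
  by rewrite RintegralZl//; [rewrite pi1 qi1 mulr0 addr0|exact: I].
- rewrite (_ : (fun x => _) = fun x => c * cmp2 phi x + cmp2 psi x)//.
  rewrite RintegralD//; [|by have := integrableZl mD c (I _ p2); apply: eq_integrable|exact: I].
  by rewrite RintegralZl//; [rewrite pi2 qi2 mulr0 addr0|exact: I].
Qed.

Lemma VV0 : VV L 0.
Proof. by rewrite -(E0 true); exact: VV_E. Qed.

Lemma VVZ c phi : VV L phi -> VV L (c *: phi).
Proof. by move=> h; rewrite -[_ *: _]addr0; apply: VV_lin => //; exact: VV0. Qed.

Lemma VVD phi psi : VV L phi -> VV L psi -> VV L (phi + psi).
Proof. by move=> h ?; rewrite -[phi]scale1r; apply: VV_lin. Qed.

Lemma VV_sum (I : Type) (s : seq I) (P : pred I) (F : I -> vfield R) :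
  (forall n : I, P n -> VV L (F n)) -> VV L (\sum_(i <- s | P i) F i).
Proof. by move=> h; elim/big_ind : _ => //; [exact: VV0|exact: VVD]. Qed.

Lemma L2_VV phi : VV L phi -> L2 L phi.
Proof. by case=> h1 h2 _ _ _; apply/L2P; split; exact: sL2_strig. Qed.

Lemma L2_E i : L2 L (E i). Proof. exact/L2_VV/VV_E. Qed.

Lemma dot_E u i : L2 L u -> dot L u (E i) = fcoef i.1 *
  (- i.1.2%:~R * ip (cmp1 u) (tg i.1 i.2) + i.1.1%:~R * ip (cmp2 u) (tg i.1 i.2)).
Proof.
move=> /L2P[h1 h2]; case: i => k b /=; have mD := @measurable_Omega R L.
have I1 := sL2_mul h1 (sL2_tg L k b); have I2 := sL2_mul h2 (sL2_tg L k b).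
rewrite mulrDr !mulrA /ip -!RintegralZl// -RintegralD//.
- by apply: eq_Rintegral => x _; rewrite /E /cmp1 /cmp2 /=; ring.
- by have := integrableZl mD (fcoef k * - k.2%:~R) I1; apply: eq_integrable.
- by have := integrableZl mD (fcoef k * k.1%:~R) I2; apply: eq_integrable.
Qed.

(** Orthogonality between different eigenvalues is all that functions of A require; inside one
    eigenspace the frame is redundant. *)
Lemma dot_EE_neq i j : (n2 i.1 : R) != n2 j.1 -> dot L (E i) (E j) = 0.
Proof.
move=> ij; rewrite dot_E; last exact: L2_E.
have Z c : ip (fun x => c * tg i.1 i.2 x) (tg j.1 j.2) = 0.
  have := @ipDl R L c _ _ _ (sL2_tg L i.1 i.2) (sL2_strig (strig0 L)) (sL2_tg L j.1 j.2).
  under eq_fun do rewrite addr0; move=> ->.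
  rewrite ip0l// addr0 ip_tg//.
  have h1 : (j.1 == i.1) = false by apply/negbTE; apply: contraNneq ij => ->.
  have h2 : (j.1 == - i.1) = false.
    by apply/negbTE; apply: contraNneq ij => ->; rewrite /n2 /= !rmorphN /= !sqrrN.
  by rewrite h1 h2 mulr0 addr0 !mulr0.
by rewrite /cmp1 /cmp2 /E /= !Z !mulr0 addr0 mulr0.
Qed.

Lemma dot_EE i : i.1 != 0 -> dot L (E i) (E i) = 2^-1.
Proof.
case: i => k b /= k00; rewrite dot_E; last exact: L2_E.
have Z c : ip (fun x => c * tg k b x) (tg k b) = c * (L ^+ 2 / 2).
  have := @ipDl R L c _ _ _ (sL2_tg L k b) (sL2_strig (strig0 L)) (sL2_tg L k b).
  under eq_fun do rewrite addr0; move=> ->.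
  rewrite ip0l// addr0 ip_tg// !eqxx (_ : k == - k = false) ?mulr0 ?addr0 ?mulr1//.
  apply/negbTE; apply: contra k00; rewrite -addr_eq0; case: k => a c' /= /eqP[/eqP h1 /eqP h2].
  by apply/eqP; congr pair; lia.
rewrite /cmp1 /cmp2 /E /= !Z.
have -> : fcoef k * (- k.2%:~R * (- k.2%:~R * fcoef k * (L ^+ 2 / 2)) +
   k.1%:~R * (k.1%:~R * fcoef k * (L ^+ 2 / 2))) = (fcoef k ^+ 2 * n2 k) * (L ^+ 2 / 2).
  by rewrite /n2; ring.
by rewrite fcoef2 k00 mulr1 mulrA mulVf ?mul1r// expf_neq0// gt_eqF.
Qed.

(** Zero divergence makes each pair of Fourier coefficients orthogonal to [k], hence a multiple of
    the direction [(- k.2, k.1)] of [E]. The expansion is finite and is an equality of functions, so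
    linear identities can be rewritten with it without any limit. *)
Lemma VV_frame phi : VV L phi -> exists M0, forall M, (M0 <= M)%N ->
  phi = \sum_(i <- fr M) dot L phi (E i) *: E i.
Proof.
move=> Vphi; have Lphi := L2_VV Vphi; case: Vphi => p q pdiv p0 q0.
have [M1 h1] := strig_fourier L0 p; have [M2 h2] := strig_fourier L0 q.
exists (maxn M1 M2) => M; rewrite geq_max => /andP[M1M M2M].
(* The divergence is tested against the mode of opposite type and integrated by parts. *)
have Z k b : k.1%:~R * ip (cmp1 phi) (tg k b) + k.2%:~R * ip (cmp2 phi) (tg k b) = 0.
  have := ip0l L (tg k (~~ b)).
  rewrite (_ : (fun _ => 0) = fun x => 1 * d1 (cmp1 phi) x + d2 (cmp2 phi) x); last first.
    by apply/funext => x; rewrite mul1r -/(divg phi x) pdiv.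
  rewrite ipDl ?mul1r; [|exact/sL2_strig/strig_d1|exact/sL2_strig/strig_d2|exact: sL2_tg].
  rewrite ip_d1// ip_d2// negbK => h.
  have kd : k0 * dsign (~~ b) != 0 :> R.
    apply: mulf_neq0; first by rewrite gt_eqF// kappa0_gt0.
    by case: (b); rewrite /dsign/= ?oppr_eq0 oner_neq0.
  by apply: (mulfI kd); apply: oppr_inj; rewrite mulr0 oppr0 -[RHS]h; ring.
(* The zero mean removes [k = 0], where the frame element vanishes. *)
have Z0 b : ip (cmp1 phi) (tg 0 b) = 0 /\ ip (cmp2 phi) (tg 0 b) = 0.
  have t0 x : tg 0 b x = (~~ b)%:R.
    by rewrite /tg /= !mulr0z !mul0r addr0 mulr0; case: b; rewrite ?sin0 ?cos0.
  case: b t0 => t0; split.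
  - by rewrite ipC -(ip0l L (cmp1 phi)); congr ip; apply/funext => x; rewrite t0.
  - by rewrite ipC -(ip0l L (cmp2 phi)); congr ip; apply/funext => x; rewrite t0.
  - by rewrite /ip -[RHS]p0; apply: eq_Rintegral => x _; rewrite t0 mulr1.
  - by rewrite /ip -[RHS]q0; apply: eq_Rintegral => x _; rewrite t0 mulr1.
(* Projecting [(P, Q)] on the direction orthogonal to [k] changes nothing, since the component along
   [k] is zero by [Z]. *)
have key k b : let P := ip (cmp1 phi) (tg k b) in let Q := ip (cmp2 phi) (tg k b) in
    dot L phi (E (k, b)) *: E (k, b) = fun x => (L ^+ 2)^-1 *: (P * tg k b x, Q * tg k b x).
  move=> P Q; apply/funext => x; rewrite dot_E//=.
  rewrite /GRing.scale/= /GRing.scale /= /scale_pair /GRing.scale /= -/P -/Q.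
  have hZ : k.1%:~R * P + k.2%:~R * Q = 0 by exact: Z.
  have [k00|k00] := eqVneq k 0.
    have [P0 Q0] := Z0 b.
    have PP : P = 0 by rewrite /P k00.
    have QQ : Q = 0 by rewrite /Q k00.
    by rewrite PP QQ !(mulr0, mul0r, addr0).
  have f2 : (L ^+ 2)^-1 = fcoef k ^+ 2 * n2 k by rewrite fcoef2 k00 mulr1.
  rewrite f2 /n2; congr pair.
    have -> : fcoef k * (- k.2%:~R * P + k.1%:~R * Q) * (- k.2%:~R * fcoef k * tg k b x) =
      fcoef k ^+ 2 * ((k.1%:~R ^+ 2 + k.2%:~R ^+ 2) * P - k.1%:~R * (k.1%:~R * P + k.2%:~R * Q)) * tg k b x.
      by ring.
    by rewrite hZ mulr0 subr0; ring.
  have -> : fcoef k * (- k.2%:~R * P + k.1%:~R * Q) * (k.1%:~R * fcoef k * tg k b x) =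
      fcoef k ^+ 2 * ((k.1%:~R ^+ 2 + k.2%:~R ^+ 2) * Q - k.2%:~R * (k.1%:~R * P + k.2%:~R * Q)) * tg k b x.
    by ring.
  by rewrite hZ mulr0 subr0; ring.
rewrite /fr big_allpairs /=.
under eq_bigr do rewrite !big_cons big_nil addr0 !key.
apply/funext => x; rewrite (surjective_pairing (phi x)) -/(cmp1 phi x) -/(cmp2 phi x).
rewrite (h1 M)// (h2 M)// fct_sumE [RHS]surjective_pairing; congr pair.
  rewrite (raddf_sum fst) mulr_sumr; apply: eq_bigr => k _ /=.
  by rewrite /GRing.scale /= mulrDr.
rewrite (raddf_sum snd) mulr_sumr; apply: eq_bigr => k _ /=.
by rewrite /GRing.scale /= mulrDr.
Qed.

End Frame.

(** * Spectral decomposition *)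

Section Spectral.
Context {R : realType} (L : R).
Hypothesis L0 : 0 < L.
Local Notation k0 := (kappa0 L).
Local Notation E := (E L).
Local Notation lamL := (lam L).
Local Notation index := (int * int * bool)%type.
Implicit Types (u v w phi psi z g om : vfield R).

Lemma lapl_E (i : index) : lapl (E i) = (- lamL i) *: E i.
Proof.
case: i => k b; apply/funext => x; rewrite /lapl /cmp1 /cmp2 /E /=.
rewrite !d1_tg// !d2_tg// !negbK /lam /n2 /GRing.scale /= /scale_pair /GRing.scale /=.
by congr pair; rewrite /dsign /GRing.scale /=; case: b => /=; ring.
Qed.

Lemma lapl_lin c phi psi : VV L phi -> VV L psi ->
  lapl (c *: phi + psi) = c *: lapl phi + lapl psi.
Proof.
move=> [p1 p2 _ _ _] [q1 q2 _ _ _].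
have c1 : cmp1 (c *: phi + psi) = fun x => c * cmp1 phi x + cmp1 psi x by [].
have c2 : cmp2 (c *: phi + psi) = fun x => c * cmp2 phi x + cmp2 psi x by [].
apply/funext => x; rewrite /lapl c1 c2 !(@d1_lin R L)// ?(@d2_lin R L)//;
  do ?[exact: strig_d1|exact: strig_d2].
transitivity (c * (d1 (d1 (cmp1 phi)) x + d2 (d2 (cmp1 phi)) x) +
  (d1 (d1 (cmp1 psi)) x + d2 (d2 (cmp1 psi)) x),
  c * (d1 (d1 (cmp2 phi)) x + d2 (d2 (cmp2 phi)) x) +
  (d1 (d1 (cmp2 psi)) x + d2 (d2 (cmp2 psi)) x)); last by [].
by congr pair; rewrite mulrDr; exact: addrACA.
Qed.

Lemma lapl0 : lapl (0 : vfield R) = 0.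
Proof.
by have := lapl_lin (-1) (VV0 L0) (VV0 L0); rewrite scaler0 addr0 scaleN1r addNr.
Qed.

Lemma lapl_sum (I : Type) (s : seq I) (c : I -> R) (F : I -> vfield R) :
  (forall n : I, VV L (F n)) ->
  lapl (\sum_(n <- s) c n *: F n) = \sum_(n <- s) c n *: lapl (F n).
Proof.
move=> h; elim: s => [|n s ih]; first by rewrite !big_nil lapl0.
rewrite !big_cons lapl_lin ?ih//; apply: VV_sum => // m _; exact: VVZ.
Qed.

Lemma nlapl_frame phi : VV L phi -> exists M0, forall M, (M0 <= M)%N ->
  - lapl phi = \sum_(i <- fr M) (lamL i * dot L phi (E i)) *: E i.
Proof.
move=> Vphi; have [M0 h] := VV_frame L0 Vphi; exists M0 => M hM.
rewrite {1}(h M hM) lapl_sum; last by move=> n; exact: VV_E.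
rewrite -sumrN; apply: eq_bigr => i _.
by rewrite lapl_E scalerA -scaleNr mulrN opprK mulrC.
Qed.

Lemma VV_nlapl phi : VV L phi -> VV L (- lapl phi).
Proof.
move=> /nlapl_frame[M0 h]; rewrite (h M0)//; apply: VV_sum => // i _.
by apply: VVZ => //; exact: VV_E.
Qed.

Lemma nrm0 : nrm L (0 : vfield R) = 0.
Proof. by rewrite /nrm dot0l ?sqrtr0//; exact: L20. Qed.

Lemma H_VV phi : VV L phi -> H L phi.
Proof.
move=> Vphi; split; first exact: L2_VV.
by move=> e e0; exists phi => //; rewrite subrr nrm0.
Qed.

Lemma H_L2 u : H L u -> L2 L u. Proof. by case. Qed.

Lemma H_E i : H L (E i). Proof. exact/H_VV/VV_E. Qed.

Lemma H0 : H L 0. Proof. exact/H_VV/VV0. Qed.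

Lemma H_lin c u v : H L u -> H L v -> H L (c *: u + v).
Proof.
move=> [Lu hu] [Lv hv]; split; first by apply: L2D => //; exact: L2Z.
move=> e e0.
have e2 : 0 < e / 2 by rewrite divr_gt0.
have [p Vp up] := hu (e / 2 / (`|c| + 1)) (divr_gt0 e2 (ltr_wpDl (normr_ge0 _) ltr01)).
have [q Vq vq] := hv (e / 2) e2.
exists (c *: p + q); first exact: VV_lin.
have Lp := L2_VV Vp; have Lq := L2_VV Vq.
rewrite (_ : c *: u + v - (c *: p + q) = c *: (u - p) + (v - q)); last first.
  by rewrite scalerBr opprD addrACA.
have Lup := L2B Lu Lp.
apply: le_lt_trans (nrmD (L2Z c Lup) (L2B Lv Lq)) _; rewrite nrmZ//.
have : `|c| * nrm L (u - p) <= e / 2.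
  have c1 : 0 < `|c| + 1 by rewrite ltr_wpDl.
  move: up; rewrite ltr_pdivlMr// => /ltW; apply: le_trans.
  by rewrite mulrC ler_wpM2l ?nrm_ge0// lerDl.
lra.
Qed.

Lemma HZ c u : H L u -> H L (c *: u).
Proof. by move=> h; rewrite -[_ *: _]addr0; apply: H_lin => //; exact: H0. Qed.

Lemma HD u v : H L u -> H L v -> H L (u + v).
Proof. by move=> h ?; rewrite -[u]scale1r; apply: H_lin. Qed.

Lemma HB u v : H L u -> H L v -> H L (u - v).
Proof. by move=> h ?; rewrite -scaleN1r addrC; apply: H_lin. Qed.

Lemma H_sum (I : Type) (s : seq I) (P : pred I) (F : I -> vfield R) :
  (forall n : I, P n -> H L (F n)) -> H L (\sum_(n <- s | P n) F n).
Proof. by move=> h; elim/big_ind : _ => //; [exact: H0|exact: HD]. Qed.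

Lemma dot_nrm0 u v w : L2 L u -> L2 L v -> L2 L w -> nrm L (u - v) = 0 ->
  dot L u w = dot L v w.
Proof.
move=> hu hv hw h; apply/eqP; rewrite -subr_eq0 -dotBl//; apply/eqP.
by apply: nrm0P => //; exact: L2B.
Qed.

(** Norm by duality, with the dense set [VV] in place of [u] itself. *)
Lemma nrm_le_VV u (K : R) : H L u -> 0 <= K ->
  (forall phi, VV L phi -> `|dot L u phi| <= K * nrm L phi) -> nrm L u <= K.
Proof.
move=> [Lu hu] K0 h; rewrite leNgt; apply/negP => uK.
have u0 : 0 < nrm L u by exact: le_lt_trans uK.
(* With [d = nrm L (u - p)] one gets [|u|^2 <= K (|u| + d) + |u| d]; this is below [|u|^2] as soon
   as [d < e]. *)
pose e := nrm L u * (nrm L u - K) / (K + nrm L u).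
have e0 : 0 < e by rewrite divr_gt0 ?ltr_wpDl// mulr_gt0// subr_gt0.
have [p Vp pe] := hu e e0; have Lp := L2_VV Vp; have Lup := L2B Lu Lp.
have h1 := h p Vp.
have h2 : nrm L p <= nrm L u + nrm L (u - p).
  rewrite -[in leLHS](subKr u p) (le_trans (nrmB Lu Lup))//.
have h3 := dot_le_nrm Lu Lup.
have h4 : nrm L u ^+ 2 = dot L u p + dot L u (u - p).
  by rewrite nrm2 -dotDr// addrC subrK.
move: pe; rewrite /e ltr_pdivlMr ?ltr_wpDl// => pe.
have := ler_norm (dot L u p); have := ler_norm (dot L u (u - p)).
have := nrm_ge0 L (u - p).
nra.
Qed.

Lemma dot_frame u phi : L2 L u -> VV L phi -> exists M0, forall M, (M0 <= M)%N ->
  dot L u phi = \sum_(i <- fr M) dot L phi (E i) * dot L u (E i).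
Proof.
move=> Lu Vphi; have [M0 h] := VV_frame L0 Vphi; exists M0 => M hM.
rewrite dotC [in LHS](h M hM) dot_suml//; last by move=> i _; exact: L2_E.
by apply: eq_bigr => i _; rewrite [dot _ u _]dotC.
Qed.

Lemma dot_VV0 u phi : L2 L u -> VV L phi -> (forall i, dot L u (E i) = 0) -> dot L u phi = 0.
Proof.
move=> Lu /(dot_frame Lu)[M0 h] h0; rewrite (h M0)// big1// => i _.
by rewrite h0 mulr0.
Qed.

Lemma H_ext u : H L u -> (forall i, dot L u (E i) = 0) -> nrm L u = 0.
Proof.
move=> Hu h; apply/eqP; rewrite eq_le nrm_ge0 andbT; apply: nrm_le_VV => // phi Vphi.
by rewrite dot_VV0 ?normr0 ?mul0r//; exact: H_L2.
Qed.

(** In the frame expansion of [dot L phi (E i)] only the [j] with the eigenvalue of [i] contribute,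
    and there the weight is constant. This gives the calculus of functions of A without an
    orthonormal basis. *)
Lemma frame_weight phi : VV L phi -> exists M0, forall M, (M0 <= M)%N ->
  forall (h : R -> R) i, \sum_(j <- fr M) h (n2 j.1) * dot L phi (E j) * dot L (E j) (E i) =
    h (n2 i.1) * dot L phi (E i).
Proof.
move=> Vphi; have [M0 fM] := VV_frame L0 Vphi; exists M0 => M hM h i.
have := congr1 (fun v => dot L v (E i)) (fM M hM); rewrite dot_suml; [|by move=> j _; exact: L2_E|exact: L2_E].
move=> /= ->; rewrite mulr_sumr; apply: eq_bigr => j _.
have [->|ij] := eqVneq (n2 j.1 : R) (n2 i.1); first by rewrite mulrA.
by rewrite (dot_EE_neq _ ij)// !mulr0.
Qed.

(** A bounded function of A is a bounded operator. By duality the multiplier is moved to the test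
    field, where all sums are finite. *)
Lemma multiplier_le u g (h : R -> R) (c : R) : H L u -> H L g -> 0 <= c ->
  (forall i : index, i.1 != 0 -> `|h (n2 i.1)| <= c) ->
  (forall i : index, i.1 != 0 -> dot L u (E i) = h (n2 i.1) * dot L g (E i)) ->
  nrm L u <= c * nrm L g.
Proof.
move=> Hu Hg c0 hc hug; have Lu := H_L2 Hu; have Lg := H_L2 Hg.
apply: nrm_le_VV => //; first by rewrite mulr_ge0// nrm_ge0.
move=> phi Vphi; have Lphi := L2_VV Vphi.
have [M1 h1] := dot_frame Lu Vphi; have [M2 h2] := frame_weight Vphi.
have [M3 h3] := dot_frame Lphi Vphi.
pose M := maxn M1 (maxn M2 M3).
have hM1 : (M1 <= M)%N by rewrite leq_max leqnn.
have hM2 : (M2 <= M)%N by rewrite !leq_max leqnn orbT.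
have hM3 : (M3 <= M)%N by rewrite !leq_max leqnn !orbT.
pose phi' := \sum_(i <- fr M) (h (n2 i.1) * dot L phi (E i)) *: E i.
have Lphi' : L2 L phi' by apply: L2_sum => i _; apply: L2Z; exact: L2_E.
have -> : dot L u phi = dot L g phi'.
  rewrite (h1 M)// [RHS]dotC dot_suml//; last by move=> i _; exact: L2_E.
  apply: eq_bigr => -[k b] _; have [->|k0] := eqVneq k 0.
    by rewrite E0 ![dot L _ 0]dotC !dot0l ?mulr0// ?mul0r//.
  by rewrite hug// [dot L (E _) g]dotC; ring.
have h5 i : dot L phi' (E i) = h (n2 i.1) * dot L phi (E i).
  by rewrite dot_suml; [exact: h2|move=> j _; exact: L2_E|exact: L2_E].
(* By [frame_weight] the coefficients of [phi'] are those of [phi] times [h], and Parseval compares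
   the two sums of squares. *)
have h4 : nrm L phi' <= c * nrm L phi.
  rewrite -(@ler_pXn2r _ 2)// ?nnegrE ?mulr_ge0 ?nrm_ge0// exprMn !nrm2.
  rewrite {1}/phi' dot_suml//; last by move=> i _; exact: L2_E.
  rewrite (h3 M)// mulr_sumr; apply: ler_sum => -[k b] _.
  rewrite [dot L (E _) phi']dotC h5; have [->|k00] := eqVneq k 0.
    by rewrite E0 ![dot L _ 0]dotC !dot0l// !mulr0.
  rewrite mulrACA -!expr2 ler_wpM2r ?sqr_ge0// -[leLHS]real_normK ?num_real//.
  by rewrite lerXn2r ?nnegrE//; exact: (hc (k, b)).
apply: le_trans (dot_le_nrm Lg Lphi') _.
by rewrite mulrC [leRHS]mulrAC ler_wpM2r// nrm_ge0.
Qed.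

(** A concrete model of P_N: an actual trigonometric polynomial for every [u], whereas [PN] is a
    choice fixed only up to null norm. *)
Definition Pi N u := \sum_(i <- fr N | low N i) dot L u (E i) *: E i.

Lemma VV_Pi N u : VV L (Pi N u).
Proof. by apply: VV_sum => // i _; apply: VVZ => //; exact: VV_E. Qed.

(** Being low depends only on the eigenvalue. Hence low and high frame elements are orthogonal, and
    expanding a low [E i] over a large box only meets low elements, all of them already in
    [fr N]. *)
Lemma dot_Pi N u i : L2 L u -> dot L (Pi N u) (E i) = if low N i then dot L u (E i) else 0.
Proof.
move=> Lu; rewrite dot_suml; [|by move=> j _; exact: L2_E|exact: L2_E].
case: ifPn => li; last first.
  apply: big1 => j lj; rewrite (dot_EE_neq _ _) ?mulr0//.
  by apply: contraNneq li => h; move: lj; rewrite !(lowE R) h.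
have [M0 h] := dot_frame Lu (VV_E L0 i).
rewrite (h (maxn M0 N)) ?leq_maxl// [RHS](bigID (low N)) /= [X in _ + X]big1 ?addr0; last first.
  move=> j lj; rewrite (dot_EE_neq _ _) ?mul0r//.
  by apply: contraNneq lj => hij; move: li; rewrite !(lowE R) hij.
rewrite -[RHS]big_filter (perm_big _ (perm_low_fr (leq_maxr M0 N))) big_filter.
by apply: eq_bigr => j _; rewrite mulrC [dot L (E j) _]dotC.
Qed.

Lemma lam_gt0 (i : index) : i.1 != 0 -> 0 < lamL i.
Proof.
by move=> k0; rewrite mulr_gt0 ?exprn_gt0 ?kappa0_gt0// (lt_le_trans ltr01)// n2_ge1.
Qed.

Lemma eigen_E i : i.1 != 0 -> eigen L (lamL i) (E i).
Proof.
move=> i0; split; [exact: H_E| |split; [exact: H_E|exact/HZ/H_E|]].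
  by rewrite /nrm dot_EE// gt_eqF// sqrtr_gt0 invr_gt0.
move=> phi Vphi; have [M1 h1] := nlapl_frame Vphi; have [M2 h2] := frame_weight Vphi.
rewrite (h1 (maxn M1 M2)) ?leq_maxl// dotC dot_suml; [|by move=> j _; exact: L2_E|exact: L2_E].
rewrite (h2 _ (leq_maxr _ _) (fun x => k0 ^+ 2 * x)) dotZl//; [|exact: L2_E|exact: L2_VV].
by rewrite [dot L (E i) _]dotC.
Qed.

(** Symmetry of A: testing the eigenvalue equation with [E i] gives [(lam i - l) (om, E i) = 0].
    This links the abstract eigenvectors in [isApow] and [PH] to the explicit frame. *)
Lemma eigen_coef l om i : eigen L l om -> lamL i != l -> dot L om (E i) = 0.
Proof.
move=> [Hom _ [_ _ h]] li; have Lom := H_L2 Hom; have LE := L2_E L0 i.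
have := h _ (VV_E L0 i); rewrite lapl_E scaleNr opprK dotZr// dotZl// => /eqP.
by rewrite -subr_eq0 -mulrBl mulf_eq0 subr_eq0 (negbTE li) => /eqP.
Qed.

Lemma high_eigen N l om i : eigen L l om -> l <= (k0 * N%:R) ^+ 2 -> ~~ low N i ->
  dot L om (E i) = 0.
Proof.
move=> eo lN li; apply: (eigen_coef eo); apply: contraNneq li => lE; move: lN.
by rewrite -lE (lowE R) /lam (exprMn 2 k0) ler_pM2l// exprn_gt0// kappa0_gt0.
Qed.

Lemma Pi_PH N u : PH L N (Pi N u).
Proof.
split; first exact/H_VV/VV_Pi.
pose s := [seq i <- fr N | low N i && (i.1 != 0)].
have -> : Pi N u = \sum_(i <- s) dot L u (E i) *: E i.
  rewrite big_filter /Pi [LHS](bigID (fun i : index => i.1 == 0)) /= big1 ?add0r//.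
  by move=> [k b] /andP[_ /eqP /= ->]; rewrite E0 scaler0.
exists (size s), (fun n => dot L u (E (tnth (in_tuple s) n))),
  (fun n => lamL (tnth (in_tuple s) n)), (fun n => E (tnth (in_tuple s) n)); split.
  move=> n; have := mem_tnth n (in_tuple s); rewrite mem_filter => /andP[/andP[lo n0] _].
  split; first exact: eigen_E.
  by rewrite /lam (exprMn 2 k0) ler_pM2l ?exprn_gt0 ?kappa0_gt0// -lowE.
by rewrite big_tnth subrr nrm0.
Qed.

Lemma PH_coef N u i : PH L N u -> ~~ low N i -> dot L u (E i) = 0.
Proof.
move=> [Hu [n [c [l [om [h e]]]]]] li.
have Lo m : L2 L (om m) by have [[/H_L2]] := h m.
rewrite (dot_nrm0 _ _ _ e); [|exact: H_L2|by apply: L2_sum => m _; exact: L2Z|exact: L2_E].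
rewrite dot_suml//; last exact: L2_E.
by apply: big1 => m _; have [eo lo] := h m; rewrite (high_eigen eo lo li) mulr0.
Qed.

Lemma PH_H N u : PH L N u -> H L u. Proof. by case. Qed.

Lemma PHP N u : H L u -> (forall i, ~~ low N i -> dot L u (E i) = 0) -> nrm L (u - Pi N u) = 0.
Proof.
move=> Hu h; have Lu := H_L2 Hu; have VP := VV_Pi N u.
apply: H_ext; first by apply: HB => //; exact: H_VV.
move=> i; rewrite dotBl//; [|exact: L2_VV|exact: L2_E].
rewrite dot_Pi//; case: ifPn => li; first by rewrite subrr.
by rewrite h// subr0.
Qed.

Lemma PH_Pi N u : PH L N u -> nrm L (u - Pi N u) = 0.
Proof. by move=> hu; apply: PHP => [|i li]; [exact: PH_H hu|exact: PH_coef hu li]. Qed.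

Lemma PH_intro N u : H L u -> (forall i, ~~ low N i -> dot L u (E i) = 0) -> PH L N u.
Proof.
move=> Hu h; split => //; have [_ [n [c [l [om [ho e]]]]]] := Pi_PH N u.
have Lo m : L2 L (om m) by have [[/H_L2]] := ho m.
have LS : L2 L (\sum_(i < n) c i *: om i) by apply: L2_sum => m _; exact: L2Z.
exists n, c, l, om; split => //; apply/eqP; rewrite eq_le nrm_ge0 andbT.
have Lu := H_L2 Hu; have LP := L2_VV (VV_Pi N u).
rewrite -[u](subrK (Pi N u)) -addrA.
by apply: le_trans (nrmD (L2B Lu LP) (L2B LP LS)) _; rewrite e PHP// addr0.
Qed.

Lemma dot_PH N u z : L2 L u -> PH L N z -> dot L u z = dot L u (Pi N z).
Proof.
move=> Lu hz; rewrite [LHS]dotC [RHS]dotC.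
by apply: (dot_nrm0 _ _ Lu (PH_Pi hz)); [exact/H_L2/PH_H/hz|exact/L2_VV/VV_Pi].
Qed.

Lemma dot_PH0 N u z : L2 L u -> PH L N z -> (forall i, low N i -> dot L u (E i) = 0) ->
  dot L u z = 0.
Proof.
move=> Lu hz h; rewrite (dot_PH Lu hz) dotC dot_suml//; last by move=> i _; exact: L2_E.
by apply: big1 => i li; rewrite [dot L (E i) u]dotC h// mulr0.
Qed.

Lemma PN_spec N u : L2 L u ->
  PH L N (PN L N u) /\ forall z, PH L N z -> dot L (u - PN L N u) z = 0.
Proof.
move=> Lu; apply: (@xgetPex _ 0 [set p | PH L N p /\ forall z, PH L N z -> dot L (u - p) z = 0]).
exists (Pi N u); split; first exact: Pi_PH.
have LP := L2_VV (VV_Pi N u).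
move=> z hz; apply: (dot_PH0 _ hz); first exact: L2B.
move=> i li; rewrite dotBl//; last exact: L2_E.
by rewrite dot_Pi// li subrr.
Qed.

Lemma QH_Pi N u : H L u -> QH L N (u - Pi N u).
Proof.
move=> Hu; have Lu := H_L2 Hu; have VP := VV_Pi N u; have LP := L2_VV VP.
split; first by apply: HB => //; exact: H_VV.
move=> z hz; apply: (dot_PH0 _ hz); first exact: L2B.
by move=> i li; rewrite dotBl//; [rewrite dot_Pi// li subrr|exact: L2_E].
Qed.

Lemma Apow_PH a N u : PH L N u -> isApow L a u
  (\sum_(i <- fr N | low N i) (lamL i `^ a * dot L u (E i)) *: E i).
Proof.
move=> hu; have Hu := PH_H hu; split => //.
  by apply: H_sum => i _; exact/HZ/H_E.
move=> l om eo; have [Hom _ _] := eo; have Lom := H_L2 Hom.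
rewrite dot_suml//; last by move=> i _; exact: L2_E.
rewrite (dot_nrm0 (H_L2 Hu) (L2_VV (VV_Pi N u)) Lom (PH_Pi hu)) dot_suml//; last by move=> i _; exact: L2_E.
rewrite mulr_sumr; apply: eq_bigr => i _.
have [<-|li] := eqVneq (lamL i) l; first by rewrite mulrA.
by rewrite [dot L (E i) om]dotC (eigen_coef eo li) !mulr0.
Qed.

Lemma Apow_spec a u : domA L a u -> isApow L a u (Apow L a u).
Proof. by move=> h; exact: (@xgetPex _ 0 [set g | isApow L a u g]). Qed.

Lemma domA_PH a N u : PH L N u -> domA L a u.
Proof. by move=> h; eexists; exact: Apow_PH h. Qed.

Lemma isApow_coef a u g i : isApow L a u g -> i.1 != 0 ->
  dot L g (E i) = lamL i `^ a * dot L u (E i).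
Proof. by move=> [_ _ h] i0; apply: h; exact: eigen_E. Qed.

(** Connects the spectral A of the determining form with the distributional one of the weak
    equations; the frame coefficients of both sides agree. *)
Lemma Apow1_lapl u phi : domA L 1 u -> VV L phi -> dot L (Apow L 1 u) phi = dot L u (- lapl phi).
Proof.
move=> /Apow_spec hA Vphi; have [Hu Hg _] := hA.
have Lu := H_L2 Hu; have Lg := H_L2 Hg; have Lphi := L2_VV Vphi.
have [M1 h1] := nlapl_frame Vphi; have [M2 h2] := dot_frame Lg Vphi.
rewrite (h1 (maxn M1 M2)) ?leq_maxl// (h2 (maxn M1 M2)) ?leq_maxr// [RHS]dotC dot_suml//; last by move=> i _; exact: L2_E.
apply: eq_bigr => -[k b] _; have [->|k00] := eqVneq k 0.
  by rewrite E0 ![dot L _ 0]dotC !dot0l// !(mulr0, mul0r).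
rewrite (isApow_coef hA)// powRr1; last by rewrite ltW// lam_gt0.
by rewrite [dot L (E _) u]dotC; ring.
Qed.

(** Poincare inequality: the multiplier is the eigenvalue to the power [- 1 / 2], and the smallest
    eigenvalue is at least [k0 ^+ 2]. *)
Lemma nrm_le_nrmV u : V L u -> nrm L u <= k0^-1 * nrmV L u.
Proof.
move=> /Apow_spec hA; have [Hu Hg _] := hA.
have kp := kappa0_gt0 L0.
apply: (multiplier_le (h := fun x => (k0 ^+ 2 * x) `^ (- (1 / 2)))) => //.
- by rewrite invr_ge0 ltW.
- move=> i i0; rewrite ger0_norm ?powR_ge0// powRN.
  have k0E : k0 = (k0 ^+ 2) `^ (1 / 2) :> R.
    by rewrite -powR_mulrn ?ltW// -powRrM mul1r mulfV// powRr1// ltW.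
  rewrite lef_pV2 ?posrE ?powR_gt0//; last exact: (lam_gt0 i0).
  rewrite [leLHS]k0E; apply: ge0_ler_powR; rewrite ?nnegrE ?divr_ge0// ?sqr_ge0//.
    exact: ltW (lam_gt0 i0).
  by rewrite ler_peMr ?sqr_ge0// n2_ge1.
- move=> i i0; rewrite (isApow_coef hA i0) -/(lam L i) mulrA -powRD.
    by rewrite addNr powRr0 mul1r.
  by apply/implyP => _; rewrite gt_eqF// lam_gt0.
Qed.

(** Inverse inequality on low modes: the multiplier is the square root of the eigenvalue, cut off
    above [(k0 * N) ^+ 2]. *)
Lemma nrmV_PH_le N u : PH L N u -> nrmV L u <= k0 * N%:R * nrm L u.
Proof.
move=> hu; have hA := Apow_spec (domA_PH (1 / 2) hu); have [Hu Hg _] := hA.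
have kp := kappa0_gt0 L0.
apply: (multiplier_le (h := fun x => if x <= N%:R ^+ 2 then (k0 ^+ 2 * x) `^ (1 / 2) else 0)) => //.
- by rewrite mulr_ge0// ltW.
- move=> i i0; case: ifPn => li; last by rewrite normr0 mulr_ge0// ltW.
  rewrite ger0_norm ?powR_ge0//.
  have -> : k0 * N%:R = ((k0 * N%:R) ^+ 2) `^ (1 / 2) :> R.
    have kN : 0 <= k0 * N%:R by rewrite mulr_ge0// ltW.
    by rewrite -powR_mulrn// -powRrM mul1r mulfV ?powRr1.
  apply: ge0_ler_powR; rewrite ?nnegrE ?divr_ge0// ?sqr_ge0//.
    exact: ltW (lam_gt0 i0).
  by rewrite (exprMn 2 k0) ler_pM2l// exprn_gt0.
- move=> i i0; rewrite (isApow_coef hA i0); case: ifPn => // li.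
  by rewrite (PH_coef hu) ?(lowE R)// !mulr0.
Qed.

Lemma V_sub u v : V L u -> V L v -> V L (u - v).
Proof.
move=> [g [Hu Hg h]] [g' [Hv Hg' h']]; exists (g - g'); split; [exact: HB|exact: HB|].
move=> l om eo; have [Ho _ _] := eo.
by rewrite (dotBl (H_L2 Hg) (H_L2 Hg') (H_L2 Ho)) (dotBl (H_L2 Hu) (H_L2 Hv) (H_L2 Ho))
  (h l om eo) (h' l om eo) mulrBr.
Qed.

Lemma V_H u : V L u -> H L u. Proof. by case=> g []. Qed.

End Spectral.

(** * The convection term *)

Section Convection.
Context {R : realType} (L : R).
Hypothesis L0 : 0 < L.
Local Notation T2 := (measurableTypeR R * measurableTypeR R)%type.
Local Notation mu := (leb2 R).
Local Notation D := (Omega L : set T2).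
Local Notation k0 := (kappa0 L).
Local Notation E := (E L).
Local Notation index := (int * int * bool)%type.
Implicit Types (u v w phi psi z g : vfield R).

(** The transposed gradient of [phi] applied to [v]: [(u.nabla)phi . v = u . gradT phi v]. It turns
    [Bform] into a scalar product, so the linearity and bounds of [dot] carry over. *)
Definition gradT phi v : vfield R := fun x =>
  (d1 (cmp1 phi) x * (v x).1 + d1 (cmp2 phi) x * (v x).2,
   d2 (cmp1 phi) x * (v x).1 + d2 (cmp2 phi) x * (v x).2).

Lemma grad_bounded phi : VV L phi -> exists2 C : R, 0 <= C &
  [/\ forall x, `|d1 (cmp1 phi) x| <= C, forall x, `|d1 (cmp2 phi) x| <= C,
      forall x, `|d2 (cmp1 phi) x| <= C & forall x, `|d2 (cmp2 phi) x| <= C].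
Proof.
move=> [p1 p2 _ _ _].
have [_ [C1 h1]] := strig_bounded (strig_d1 p1); have [_ [C2 h2]] := strig_bounded (strig_d1 p2).
have [_ [C3 h3]] := strig_bounded (strig_d2 p1); have [_ [C4 h4]] := strig_bounded (strig_d2 p2).
have C10 : 0 <= C1 by exact: le_trans (normr_ge0 _) (h1 (0, 0)).
have C20 : 0 <= C2 by exact: le_trans (normr_ge0 _) (h2 (0, 0)).
have C30 : 0 <= C3 by exact: le_trans (normr_ge0 _) (h3 (0, 0)).
have C40 : 0 <= C4 by exact: le_trans (normr_ge0 _) (h4 (0, 0)).
exists (C1 + C2 + C3 + C4); first lra.
by split => x; [have := h1 x|have := h2 x|have := h3 x|have := h4 x]; lra.
Qed.

Lemma L2_gradT phi v : VV L phi -> L2 L v -> L2 L (gradT phi v).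
Proof.
move=> Vphi /L2P[v1 v2]; have [C C0 [h1 h2 h3 h4]] := grad_bounded Vphi.
have [p1 p2 _ _ _] := Vphi.
have m q : strig L q -> measurable_fun D (q : T2 -> R).
  by move=> /strig_bounded[mq _]; exact: measurable_funTS.
apply/L2P; split; apply: sL2D; (apply: (sL2M (C := C)) => //; apply: m).
- exact: strig_d1.
- exact: strig_d1.
- exact: strig_d2.
- exact: strig_d2.
Qed.

Lemma nrm_gradT phi : VV L phi -> exists2 C : R, 0 <= C &
  forall v, L2 L v -> nrm L (gradT phi v) <= C * nrm L v.
Proof.
move=> Vphi; have [C C0 [h1 h2 h3 h4]] := grad_bounded Vphi.
(* Each of the two components has square at most [2 * C ^+ 2] times that of [v], which sums to
   [(2 * C) ^+ 2]. *)
exists (2 * C); first by rewrite mulr_ge0.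
move=> v Lv; have LT := L2_gradT Vphi Lv; have mD := @measurable_Omega R L.
rewrite -(@ler_pXn2r _ 2)// ?nnegrE ?mulr_ge0 ?nrm_ge0// exprMn !nrm2 /dot.
rewrite -RintegralZl//; last exact: dot_integrable.
apply: le_Rintegral => //.
- exact: dot_integrable.
- by have := integrableZl mD ((2 * C) ^+ 2) (dot_integrable Lv Lv); apply: eq_integrable.
move=> x _ /=.
have sq (a b p q : R) : `|a| <= C -> `|b| <= C ->
    (a * p + b * q) * (a * p + b * q) <= 2 * (C ^+ 2 * (p * p + q * q)).
  move=> aC bC.
  have a2 : a ^+ 2 <= C ^+ 2 by rewrite -[leLHS]real_normK ?num_real// lerXn2r ?nnegrE.
  have b2 : b ^+ 2 <= C ^+ 2 by rewrite -[leLHS]real_normK ?num_real// lerXn2r ?nnegrE.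
  have pp := sqr_ge0 p; have qq := sqr_ge0 q; have := sqr_ge0 (a * p - b * q).
  have := ler_wpM2r pp a2; have := ler_wpM2r qq b2; nra.
by have := sq _ _ (v x).1 (v x).2 (h1 x) (h2 x); have := sq _ _ (v x).1 (v x).2 (h3 x) (h4 x); lra.
Qed.

Lemma BformE u v phi : VV L phi -> L2 L u -> L2 L v -> Bform L u v phi = - dot L u (gradT phi v).
Proof.
by move=> _ _ _; congr (- _); apply: eq_Rintegral => x _; rewrite /gradT /=; ring.
Qed.

Lemma gradT_linr c phi v w : gradT phi (c *: v + w) = c *: gradT phi v + gradT phi w.
Proof.
apply/funext => x.
transitivity (c * (gradT phi v x).1 + (gradT phi w x).1, c * (gradT phi v x).2 + (gradT phi w x).2); last by [].
rewrite /gradT /=; congr pair; rewrite /GRing.scale /=; ring.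
Qed.

Lemma gradT_linl c phi psi v : VV L phi -> VV L psi ->
  gradT (c *: phi + psi) v = c *: gradT phi v + gradT psi v.
Proof.
move=> [p1 p2 _ _ _] [q1 q2 _ _ _].
have c1 : cmp1 (c *: phi + psi) = fun x => c * cmp1 phi x + cmp1 psi x by [].
have c2 : cmp2 (c *: phi + psi) = fun x => c * cmp2 phi x + cmp2 psi x by [].
apply/funext => x; rewrite /gradT c1 c2 !(@d1_lin R L)// ?(@d2_lin R L)//.
transitivity (c * (gradT phi v x).1 + (gradT psi v x).1, c * (gradT phi v x).2 + (gradT psi v x).2); last by [].
by rewrite /gradT /=; congr pair; rewrite !mulrDl mulrDr !mulrA addrACA.
Qed.

Lemma Bform_linl c u u' v phi : VV L phi -> L2 L u -> L2 L u' -> L2 L v ->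
  Bform L (c *: u + u') v phi = c * Bform L u v phi + Bform L u' v phi.
Proof.
move=> Vp Lu Lu' Lv; have LT := L2_gradT Vp Lv; have Lcu := L2Z c Lu; have Ls := L2D Lcu Lu'.
by rewrite !BformE// dotDl// dotZl//; ring.
Qed.

Lemma Bform_linr c u v v' phi : VV L phi -> L2 L u -> L2 L v -> L2 L v' ->
  Bform L u (c *: v + v') phi = c * Bform L u v phi + Bform L u v' phi.
Proof.
move=> Vp Lu Lv Lv'; have LT := L2_gradT Vp Lv; have LT' := L2_gradT Vp Lv'.
have Lcv := L2Z c Lv; have Ls := L2D Lcv Lv'.
by rewrite !BformE// gradT_linr dotDr ?dotZr//; [ring|exact: L2Z].
Qed.

Lemma Bform_linphi c u v phi psi : VV L phi -> VV L psi -> L2 L u -> L2 L v ->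
  Bform L u v (c *: phi + psi) = c * Bform L u v phi + Bform L u v psi.
Proof.
move=> Vp Vq Lu Lv; have LT := L2_gradT Vp Lv; have LT' := L2_gradT Vq Lv.
rewrite BformE ?gradT_linl//; last exact: VV_lin.
by rewrite !BformE// dotDr ?dotZr//; [rewrite opprD mulrN|exact: L2Z].
Qed.

Lemma Bform0l v phi : VV L phi -> L2 L v -> Bform L 0 v phi = 0.
Proof.
by move=> ? ?; rewrite BformE//; [rewrite dot0l ?oppr0//; exact: L2_gradT|exact: L20].
Qed.

Lemma Bform0r u phi : VV L phi -> L2 L u -> Bform L u 0 phi = 0.
Proof.
move=> Vp Lu; have := Bform_linr (-1) Vp Lu (L20 L) (L20 L).
by rewrite scaler0 addr0 mulN1r addNr.
Qed.

Lemma Bform0phi u v : L2 L u -> L2 L v -> Bform L u v 0 = 0.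
Proof.
move=> Lu Lv; have := Bform_linphi (-1) (VV0 L0) (VV0 L0) Lu Lv.
by rewrite scaler0 addr0 mulN1r addNr.
Qed.

Lemma BformDl u u' v phi : VV L phi -> L2 L u -> L2 L u' -> L2 L v ->
  Bform L (u + u') v phi = Bform L u v phi + Bform L u' v phi.
Proof. by move=> *; rewrite -[u]scale1r Bform_linl// mul1r scale1r. Qed.

Lemma BformDr u v v' phi : VV L phi -> L2 L u -> L2 L v -> L2 L v' ->
  Bform L u (v + v') phi = Bform L u v phi + Bform L u v' phi.
Proof. by move=> *; rewrite -[v]scale1r Bform_linr// mul1r scale1r. Qed.

Lemma BformBl u u' v phi : VV L phi -> L2 L u -> L2 L u' -> L2 L v ->
  Bform L (u - u') v phi = Bform L u v phi - Bform L u' v phi.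
Proof. by move=> *; rewrite addrC -scaleN1r Bform_linl// mulN1r addrC. Qed.

Lemma BformBr u v v' phi : VV L phi -> L2 L u -> L2 L v -> L2 L v' ->
  Bform L u (v - v') phi = Bform L u v phi - Bform L u v' phi.
Proof. by move=> *; rewrite addrC -scaleN1r Bform_linr// mulN1r addrC. Qed.

Lemma Bform_suml (I : Type) (s : seq I) (P : pred I) (c : I -> R) (F : I -> vfield R) v phi :
  VV L phi -> (forall n, L2 L (F n)) -> L2 L v ->
  Bform L (\sum_(n <- s | P n) c n *: F n) v phi = \sum_(n <- s | P n) c n * Bform L (F n) v phi.
Proof.
move=> Vp hF Lv; elim: s => [|n s ih]; first by rewrite !big_nil Bform0l.
rewrite !big_cons; case: ifP => // _; rewrite Bform_linl ?ih//.
by apply: L2_sum => m _; exact: L2Z.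
Qed.

Lemma Bform_sumr (I : Type) (s : seq I) (P : pred I) (c : I -> R) (F : I -> vfield R) u phi :
  VV L phi -> (forall n, L2 L (F n)) -> L2 L u ->
  Bform L u (\sum_(n <- s | P n) c n *: F n) phi = \sum_(n <- s | P n) c n * Bform L u (F n) phi.
Proof.
move=> Vp hF Lv; elim: s => [|n s ih]; first by rewrite !big_nil Bform0r.
rewrite !big_cons; case: ifP => // _; rewrite Bform_linr ?ih//.
by apply: L2_sum => m _; exact: L2Z.
Qed.

Lemma Bform_sumphi (I : Type) (s : seq I) (P : pred I) (c : I -> R) (F : I -> vfield R) u v :
  (forall n, VV L (F n)) -> L2 L u -> L2 L v ->
  Bform L u v (\sum_(n <- s | P n) c n *: F n) = \sum_(n <- s | P n) c n * Bform L u v (F n).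
Proof.
move=> hF Lu Lv; elim: s => [|n s ih]; first by rewrite !big_nil Bform0phi.
rewrite !big_cons; case: ifP => // _; rewrite Bform_linphi ?ih//.
by apply: VV_sum => // m _; exact: VVZ.
Qed.

Lemma Bform_bound phi : VV L phi -> exists2 C : R, 0 <= C &
  forall u v, L2 L u -> L2 L v -> `|Bform L u v phi| <= C * nrm L u * nrm L v.
Proof.
move=> Vp; have [C C0 h] := nrm_gradT Vp; exists C => // u v Lu Lv.
rewrite BformE// normrN; apply: le_trans (dot_le_nrm Lu (L2_gradT Vp Lv)) _.
by rewrite mulrAC [leRHS]mulrC ler_wpM2l ?nrm_ge0// h.
Qed.

Lemma Bform_nrm0 u u' v v' phi : VV L phi -> L2 L u -> L2 L u' -> L2 L v -> L2 L v' ->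
  nrm L (u - u') = 0 -> nrm L (v - v') = 0 -> Bform L u v phi = Bform L u' v' phi.
Proof.
move=> Vp Lu Lu' Lv Lv' hu hv; have [C _ hC] := Bform_bound Vp.
have Luu := L2B Lu Lu'; have Lvv := L2B Lv Lv'.
have -> : Bform L u v phi = Bform L u' v phi.
  rewrite -[u](subrK u') BformDl// -[RHS]add0r; congr (_ + _); apply/eqP.
  by rewrite -normr_le0; apply: le_trans (hC _ _ Luu Lv) _; rewrite hu mulr0 mul0r.
rewrite -[v](subrK v') BformDr// -[RHS]add0r; congr (_ + _); apply/eqP.
by rewrite -normr_le0; apply: le_trans (hC _ _ Lu' Lvv) _; rewrite hv mulr0.
Qed.

(* A product of two trigonometric functions only contains the sum and the difference of the frequencies. *)
Lemma Bform_EEE (i j m : index) : m.1 != i.1 - j.1 -> m.1 != i.1 + j.1 ->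
  m.1 != - (i.1 - j.1) -> m.1 != - (i.1 + j.1) -> Bform L (E i) (E j) (E m) = 0.
Proof.
move=> h1 h2 h3 h4.
have Z : ip L (fun x => tg L i.1 i.2 x * tg L j.1 j.2 x) (tg L m.1 (~~ m.2)) = 0.
  rewrite (_ : (fun _ => _) = fun x =>
    (2^-1 * (if ~~ i.2 && j.2 then -1 else 1)) * tg L (i.1 - j.1) (i.2 (+) j.2) x +
    ((2^-1 * (if i.2 && j.2 then -1 else 1)) * tg L (i.1 + j.1) (i.2 (+) j.2) x + 0)); last first.
    by apply/funext => x; rewrite tgM addr0 mulrDr !mulrA.
  rewrite ipDl; [|exact: sL2_tg| |exact: sL2_tg]; last first.
    by apply: sL2D; [exact/sL2Z/sL2_tg|exact/sL2_strig/strig0].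
  rewrite ipDl; [|exact: sL2_tg|exact/sL2_strig/strig0|exact: sL2_tg].
  rewrite ip0l !ip_tg// (negbTE h1) (negbTE h2) (negbTE h3) (negbTE h4).
  by rewrite !(mulr0, addr0).
(* The last two factors are the transport direction of [E i] paired with the frequency [m], and the
   scalar product of the directions of [E m] and [E j]. *)
pose c := k0 * dsign m.2 * fcoef L i.1 * fcoef L j.1 * fcoef L m.1 *
   (- i.1.2%:~R * m.1.1%:~R + i.1.1%:~R * m.1.2%:~R) *
   (m.1.2%:~R * j.1.2%:~R + m.1.1%:~R * j.1.1%:~R).
transitivity (- \int[mu]_(x in D) (c * (tg L i.1 i.2 x * tg L j.1 j.2 x * tg L m.1 (~~ m.2) x))).
  congr (- _); apply: eq_Rintegral => x _.
  rewrite {5 6 7 8}/E /cmp1 /cmp2 /=.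
  rewrite !d1_tg// !d2_tg// /c /=; ring.
rewrite RintegralZl; [by rewrite -/(ip _ _ _) Z mulr0 oppr0|exact: measurable_Omega|].
apply: sL2_mul; last exact: sL2_tg.
by apply: sL2_strig; apply: strigM; exact: strig_tg.
Qed.

Lemma Bform_high N u (m : index) : PH L N u -> m \notin fr (2 * N) -> Bform L u u (E m) = 0.
Proof.
move=> hu mN; have Lu := H_L2 (PH_H hu); have LP := L2_VV (VV_Pi L0 N u).
have P0 := PH_Pi L0 hu.
rewrite (Bform_nrm0 (VV_E L0 m) Lu LP Lu LP P0 P0).
rewrite {1}/Pi Bform_suml//; [|exact: VV_E|by move=> n; exact: L2_E].
apply: big1 => i /low_box il; rewrite /Pi Bform_sumr//; [|exact: VV_E|by move=> n; exact: L2_E|exact: L2_E].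
rewrite big1 ?mulr0// => j /low_box jl.
have nm (k : int * int) : k \in box (2 * N) -> m.1 != k.
  by move=> kN; apply: contra mN => /eqP mk; rewrite mem_fr mk.
by rewrite Bform_EEE ?mulr0//; apply: nm; do ?[apply: boxN]; apply: boxD => //; exact: boxN.
Qed.

(** [B] is a choice with default [0], so a representative must be exhibited. For low-mode fields the
    form vanishes on frequencies outside the box [2 * N], and a finite frame sum represents it. *)
Lemma B_PH N u : PH L N u -> H L (B L u u) /\
  forall phi, VV L phi -> dot L (B L u u) phi = Bform L u u phi.
Proof.
move=> hu; have Lu := H_L2 (PH_H hu).
apply: (@xgetPex _ 0 [set g | H L g /\ forall phi, VV L phi -> dot L g phi = Bform L u u phi]).
exists (\sum_(i <- fr (2 * N)) Bform L u u (E i) *: E i); split.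
  by apply: H_sum => // i _; apply: HZ => //; exact: H_E.
move=> phi Vp; have Lp := L2_VV Vp; rewrite dot_suml//; last by move=> i _; exact: L2_E.
have [M0 h] := VV_frame L0 Vp; pose M := maxn M0 (2 * N).
rewrite [in RHS](h M) ?leq_maxl// Bform_sumphi//; last by move=> i; exact: VV_E.
rewrite [RHS](bigID (fun i => i \in fr (2 * N))) /= [X in _ + X]big1 ?addr0; last first.
  by move=> i iN; rewrite (Bform_high hu iN) mulr0.
have -> : \sum_(i <- fr M | i \in fr (2 * N)) dot L phi (E i) * Bform L u u (E i) =
    \sum_(i <- fr (2 * N)) dot L phi (E i) * Bform L u u (E i).
  rewrite -big_filter; apply: perm_big.
  apply: uniq_perm; rewrite ?filter_uniq ?uniq_fr// => i.
  rewrite mem_filter; case: (boolP (i \in fr (2 * N))) => //=.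
  by rewrite !mem_fr => iN; rewrite (box_sub _ iN)// leq_maxr.
by apply: eq_bigr => i _; rewrite mulrC [dot L (E i) _]dotC.
Qed.

End Convection.

(** * Functions of time *)

Section TimeIntegrals.
Import HBNNSimple.
Context {R : realType}.
Local Notation T1 := (measurableTypeR R).
Local Notation lm := (leb R).
Implicit Types (f g F G psi : R -> R).

Lemma aeS (P Q : R -> Prop) : (forall s, P s -> Q s) ->
  {ae lm, forall s : R, P s} -> {ae lm, forall s : R, Q s}.
Proof. exact: (@filterS _ _ (ae_filter_ringOfSetsType lm)). Qed.

Lemma ae2 (P Q S : R -> Prop) : (forall s, P s -> Q s -> S s) ->
  {ae lm, forall s : R, P s} -> {ae lm, forall s : R, Q s} -> {ae lm, forall s : R, S s}.
Proof. exact: (@filterS2 _ _ (ae_filter_ringOfSetsType lm)). Qed.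

(* No measurability is assumed: the integral is a supremum over simple functions, which may be cut off on a null set. *)
Lemma ge0_ae_le_integral_nm (f g : T1 -> \bar R) :
  (forall x, 0 <= f x)%E -> (forall x, 0 <= g x)%E ->
  {ae lm, forall x, f x = g x} -> (\int[lm]_x f x <= \int[lm]_x g x)%E.
Proof.
move=> f0 g0 [N [mN N0 fgN]].
rewrite !ge0_integralTE//; apply: ge_ereal_sup => _ [h hf <-].
have mNC : measurable (~` N) by exact: measurableC.
pose h' := mul_nnsfun h (indic_nnsfun R mNC).
have hh : (\int[lm]_x (h x)%:E = \int[lm]_x (h' x)%:E)%E.
  apply: ge0_ae_eq_integral => //.
  - by apply/measurable_EFinP.
  - by apply/measurable_EFinP.
  - by move=> x _; rewrite lee_fin.
  - by move=> x _; rewrite lee_fin.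
  exists N; split => // x /= hx; apply: contrapT => xN; apply: hx => _.
  by rewrite /h' /= mindicE mem_set// mulr1.
rewrite -integralT_nnsfun hh integralT_nnsfun; apply: ereal_sup_ubound; exists h' => //= x.
rewrite /h' /= mindicE; have [xN|xN] := boolP (x \in ~` N); last by rewrite mulr0.
rewrite mulr1; have <- : f x = g x; last exact: hf.
by apply: contrapT => fx; move: xN; rewrite inE; apply; exact: fgN.
Qed.

(** Lets representatives be exchanged inside integrals whose integrand is not yet known to be
    measurable, such as those containing the choice [B]. Positive and negative parts are treated
    separately. *)
Lemma ae_Rintegral f g : {ae lm, forall s : R, f s = g s} ->
  \int[lm]_(s in setT) f s = \int[lm]_(s in setT) g s.
Proof.
move=> fg; rewrite /Rintegral; congr fine.
have fg' : {ae lm, forall s : R, g s = f s} by apply: aeS fg => s ->.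
rewrite integralE [RHS]integralE; congr (_ - _)%E; apply/eqP; rewrite eq_le; apply/andP; split;
  apply: ge0_ae_le_integral_nm => //; [apply: aeS fg|apply: aeS fg'|apply: aeS fg|apply: aeS fg'];
  by move=> s; rewrite ?funeposE ?funenegE => ->.
Qed.

Lemma cont_bounded F : continuous F -> forall S : R, exists C : R, forall s, `|s| <= S -> `|F s| <= C.
Proof.
move=> cF S; have [S0|S0] := leP 0 S; last first.
  by exists 0 => s sS; have := le_lt_trans sS S0; rewrite ltNge normr_ge0.
have cN : {within `[- S, S], continuous (fun s => `|F s|)}.
  by apply: continuous_subspaceT => s; apply: continuous_comp; [exact: cF|exact: norm_continuous].
have SS : - S <= S by lra.
have [c _ hc] := EVT_max SS cN; exists `|F c| => s sS; apply: hc.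
by rewrite in_itv /= -ler_norml.
Qed.

(** Measurable and locally essentially bounded: a class that contains the coefficients of elements
    of [LinfH] and all continuous functions, is stable under products, and is integrable against
    [Cc]. *)
Definition good F := measurable_fun setT (F : T1 -> R) /\
  forall S : R, exists C : R, {ae lm, forall s : R, `|s| <= S -> `|F s| <= C}.

Lemma good_cont F : continuous F -> good F.
Proof.
move=> cF; split; first exact: continuous_measurable_fun.
by move=> S; have [C h] := cont_bounded cF S; exists C; apply: aeW.
Qed.

Lemma good_cst c : good (fun=> c).
Proof. by apply: good_cont => x; exact: cvg_cst. Qed.

Lemma goodD F G : good F -> good G -> good (fun s => F s + G s).
Proof.
move=> [mF bF] [mG bG]; split; first exact: measurable_funD.
move=> S; have [C hC] := bF S; have [C' hC'] := bG S; exists (C + C').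
apply: ae2 hC hC' => s h h' sS.
by apply: le_trans (ler_normD _ _) _; rewrite lerD ?h ?h'.
Qed.

Lemma goodM F G : good F -> good G -> good (fun s => F s * G s).
Proof.
move=> [mF bF] [mG bG]; split; first exact: measurable_funM.
move=> S; have [C hC] := bF S; have [C' hC'] := bG S; exists (C * C').
by apply: ae2 hC hC' => s h h' sS; rewrite normrM ler_pM ?h ?h'.
Qed.

Lemma goodZ c F : good F -> good (fun s => c * F s).
Proof. by move=> h; apply: goodM => //; exact: good_cst. Qed.

Lemma goodB F G : good F -> good G -> good (fun s => F s - G s).
Proof.
move=> hF hG; rewrite (_ : (fun _ => _) = fun s => F s + (-1) * G s); last first.
  by apply/funext => s; rewrite mulN1r.
by apply: goodD => //; exact: goodZ.
Qed.

Lemma good_sum (I : Type) (s : seq I) (P : pred I) (F : I -> R -> R) :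
  (forall n, good (F n)) -> good (fun x => \sum_(n <- s | P n) F n x).
Proof.
move=> h; elim: s => [|n s ih].
  by rewrite (_ : (fun _ => _) = fun=> 0); [exact: good_cst|apply/funext => x; rewrite big_nil].
case: (boolP (P n)) => Pn.
  rewrite (_ : (fun _ => _) = fun x => F n x + \sum_(m <- s | P m) F m x); last first.
    by apply/funext => x; rewrite big_cons Pn.
  exact: goodD.
by rewrite (_ : (fun _ => _) = fun x => \sum_(m <- s | P m) F m x)//;
  apply/funext => x; rewrite big_cons (negbTE Pn).
Qed.

(** Larger than [Cc1], so that the derivative of a test function is again an admissible weight. *)
Definition Cc psi := continuous psi /\ exists M : R, forall s, M < `|s| -> psi s = 0.

Lemma Cc_bounded psi : Cc psi -> exists2 K : R, 0 <= K & forall s, `|psi s| <= K.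
Proof.
move=> [cp [M hM]]; have [K hK] := cont_bounded cp M.
exists `|K| => // s; have [sM|sM] := leP `|s| M; last by rewrite hM// normr0.
exact: le_trans (hK s sM) (ler_norm K).
Qed.

Lemma bounded_support_integrable f (M C : R) : measurable_fun setT (f : T1 -> R) ->
  (forall s, M < `|s| -> f s = 0) -> {ae lm, forall s : R, `|f s| <= C} ->
  lm.-integrable setT (EFin \o f).
Proof.
move=> mf f0 fC; apply/integrableP; split; first exact/measurable_EFinP.
pose g (s : T1) : \bar R := (`|C| * \1_(`[- M, M]%classic : set R) s)%:E.
apply: (@le_lt_trans _ _ (\int[lm]_s g s)%E).
  apply: ae_ge0_le_integral => //.
  - by apply: measurableT_comp => //; exact/measurable_EFinP.
  - by move=> s _; rewrite lee_fin mulr_ge0.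
  - apply/measurable_EFinP; apply: measurable_funM; first exact: measurable_cst.
    by apply: measurable_indic; exact: measurable_itv.
  - apply: aeS fC => s fC _; rewrite /= lee_fin indicE.
    have [sM|sM] := leP `|s| M; last by rewrite f0// normr0 mulr_ge0.
    rewrite mem_set ?mulr1 ?(le_trans fC (ler_norm C))//.
    by rewrite /= in_itv /= -ler_norml.
rewrite /g; under eq_integral do rewrite EFinM.
rewrite ge0_integralZl//; last first.
  by apply/measurable_EFinP; apply: measurable_indic; exact: measurable_itv.
rewrite integral_indic//.
rewrite setIT; move: (lebesgue_measure_itv `[- M, M]%R) => /= ->.
by case: ifP => _; rewrite ?mule0 ?ltry// -EFinD -EFinM ltry.
Qed.

Lemma Cc_good_bounded psi F : Cc psi -> good F ->
  measurable_fun setT ((fun s => psi s * F s) : T1 -> R) /\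
  exists M C : R, (forall s, M < `|s| -> psi s * F s = 0) /\
    {ae lm, forall s : R, `|psi s * F s| <= C}.
Proof.
move=> hp [mF bF]; have [K K0 hK] := Cc_bounded hp; have [cp [M hM]] := hp.
split; first by apply: measurable_funM => //; exact: continuous_measurable_fun.
have [C hC] := bF M; exists M, (K * `|C|); split.
  by move=> s sM; rewrite hM// mul0r.
apply: aeS hC => s hC; have [sM|sM] := leP `|s| M.
  by rewrite normrM ler_pM// (le_trans (hC sM))// ler_norm.
by rewrite hM// mul0r normr0 mulr_ge0.
Qed.

Lemma Cc_good_integrable psi F : Cc psi -> good F ->
  lm.-integrable setT (EFin \o (fun s => psi s * F s)).
Proof.
move=> hp hF; have [mf [M [C [h1 h2]]]] := Cc_good_bounded hp hF.
exact: bounded_support_integrable h1 h2.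
Qed.

Definition wint psi F : R := \int[lm]_(s in setT) (psi s * F s).

Lemma wintD psi F G : Cc psi -> good F -> good G ->
  wint psi (fun s => F s + G s) = wint psi F + wint psi G.
Proof.
move=> hp hF hG; rewrite /wint -RintegralD//; try exact: Cc_good_integrable.
by apply: eq_Rintegral => s _; rewrite mulrDr.
Qed.

Lemma wintZ psi c F : Cc psi -> good F -> wint psi (fun s => c * F s) = c * wint psi F.
Proof.
move=> hp hF; rewrite /wint -RintegralZl//; last exact: Cc_good_integrable.
by apply: eq_Rintegral => s _; rewrite mulrCA.
Qed.

Lemma wintB psi F G : Cc psi -> good F -> good G ->
  wint psi (fun s => F s - G s) = wint psi F - wint psi G.
Proof.
move=> hp hF hG; rewrite -mulN1r -wintZ// -wintD//; last exact: goodZ.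
by apply: eq_Rintegral => s _; rewrite mulN1r.
Qed.

Lemma wint_sum psi (I : Type) (s : seq I) (P : pred I) (F : I -> R -> R) : Cc psi ->
  (forall n, good (F n)) ->
  wint psi (fun x => \sum_(n <- s | P n) F n x) = \sum_(n <- s | P n) wint psi (F n).
Proof.
move=> hp h; elim: s => [|n s ih].
  rewrite big_nil /wint; under eq_Rintegral do rewrite big_nil mulr0.
  by rewrite Rintegral_cst ?mul0r.
rewrite big_cons; case: ifP => Pn.
  rewrite -ih -wintD//; last exact: good_sum.
  by apply: eq_Rintegral => x _; rewrite big_cons Pn.
by rewrite -ih; apply: eq_Rintegral => x _; rewrite big_cons Pn.
Qed.

Lemma wint_le psi F (M e : R) : Cc psi -> good F -> (forall s, M < `|s| -> psi s = 0) ->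
  0 <= e -> (forall s, `|s| <= M -> `|F s| <= e) ->
  `|wint psi F| <= e * \int[lm]_(s in setT) `|psi s|.
Proof.
move=> hp hF hM e0 Fe; have I1 := Cc_good_integrable hp hF.
apply: le_trans (le_normr_Rintegral _ I1) _ => //.
have I2 : lm.-integrable setT (EFin \o (fun s => `|psi s|)).
  have [c1 _] := hp; have [K K0 hK] := Cc_bounded hp.
  apply: (@bounded_support_integrable _ M K).
  - by apply: measurableT_comp => //; exact: continuous_measurable_fun.
  - by move=> s /hM ->; rewrite normr0.
  - by apply: aeW => s; rewrite normr_id.
rewrite -RintegralZl//; apply: le_Rintegral => //.
- exact: integrable_norm.
- by have := integrableZl measurableT e I2; apply: eq_integrable.
move=> s _; rewrite normrM mulrC; have [sM|sM] := leP `|s| M.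
  by rewrite ler_wpM2r// Fe.
by rewrite hM// normr0 !mulr0.
Qed.

(** The substitution rule for nonnegative continuous functions is applied to the positive and
    negative parts, so no integrability of [f] is required. *)
Lemma Rintegral_shift f (a : R) : continuous f ->
  \int[lm]_(s in setT) f s = \int[lm]_(s in setT) f (s + a).
Proof.
move=> cf; rewrite /Rintegral; congr fine.
have D (x : R) : is_derive x (1 : R) (fun y : R => y + a) 1.
  by apply: (is_derive_eq (is_deriveD (is_derive_id x 1) (is_derive_cst a x 1))); rewrite addr0.
have DE : derive1 (fun y : R => y + a) = fun=> 1.
  by apply/funext => x; rewrite derive1E; case: (D x).
have key (h : R -> R) : continuous h -> (forall x, 0 <= h x) ->
    (\int[lm]_s (h s)%:E = \int[lm]_s (h (s + a))%:E)%E.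
  move=> ch h0.
  rewrite (@increasing_ge0_integration_by_substitutionT _ (fun y => y + a))//.
  - by apply: eq_integral => x _; rewrite /GRing.mul /= DE mulr1.
  - by move=> x y; rewrite ltrD2r.
  - by rewrite DE => x; exact: cvg_cst.
  - by rewrite DE; exact: is_cvg_cst.
  - by rewrite DE; exact: is_cvg_cst.
  - exact: cvg_addrr_Ny.
  - exact: cvg_addrr.
have cp (h : R -> R) : continuous h -> continuous (fun x => Num.max (h x) 0).
  move=> ch x; apply: continuous_max; [exact: ch|exact: cvg_cst].
rewrite integralE [RHS]integralE; congr (_ - _)%E.
- transitivity (\int[lm]_s (Num.max (f s) 0)%:E)%E.
    by apply: eq_integral => s _; rewrite funeposE -EFin_max.
  rewrite key//; first by apply: eq_integral => s _; rewrite funeposE -EFin_max.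
  + exact: cp.
  + by move=> x; rewrite le_max lexx orbT.
- transitivity (\int[lm]_s (Num.max (- f s) 0)%:E)%E.
    by apply: eq_integral => s _; rewrite funenegE -EFinN -EFin_max.
  rewrite (key (fun s => Num.max (- f s) 0)); first by apply: eq_integral => s _; rewrite funenegE -EFinN -EFin_max.
  + by apply: cp => x; apply: continuousN; exact: cf.
  + by move=> x; rewrite le_max lexx orbT.
Qed.

End TimeIntegrals.

Lemma contD {R : realType} (T : topologicalType) (f g : T -> R) :
  continuous f -> continuous g -> continuous (fun x => f x + g x).
Proof. by move=> cf cg x; apply: (@continuousD _ _ _ f g); [exact: cf|exact: cg]. Qed.

Lemma contM {R : realType} (T : topologicalType) (f g : T -> R) :
  continuous f -> continuous g -> continuous (fun x => f x * g x).
Proof. by move=> cf cg x; apply: (@continuousM _ _ f g); [exact: cf|exact: cg]. Qed.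

Lemma cont_cst {R : realType} (T : topologicalType) (c : R) : continuous (fun _ : T => c).
Proof. by move=> x; exact: cvg_cst. Qed.

(** * Test functions in time and the fundamental lemma of the calculus of variations *)

Section TestFunctions.
Context {R : realType}.
Local Notation T1 := (measurableTypeR R).
Local Notation lm := (leb R).
Implicit Types (f g F G psi : R -> R) (a b s : R).

Lemma is_derive_quad f (x d K : R) :
  (forall h, `|f (x + h) - f x - d * h| <= K * h ^+ 2) -> is_derive x (1 : R) f d.
Proof.
move=> hf.
have c : h^-1 *: ((f \o shift x) (h *: 1) - f x) @[h --> 0^'] --> d.
  apply/cvgrPdist_le => e e0.
  have K1 : 0 < `|K| + 1 by rewrite ltr_wpDl.
  near=> h.
  have h0 : h != 0 by near: h; exact: nbhs_dnbhs_neq.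
  have hn : 0 < `|h| by rewrite normr_gt0.
  have he : `|h| <= e / (`|K| + 1).
    near: h; apply/dnbhs0_le; exact: divr_gt0.
  rewrite /= /GRing.scale /= mulr1 [h + x]addrC.
  rewrite distrC -(ler_pM2r hn) -normrM mulrBl.
  rewrite mulrAC mulVf// mul1r; apply: le_trans (hf h) _.
  rewrite -[h ^+ 2]real_normK ?num_real// expr2 mulrA ler_pM2r//.
  apply: le_trans (_ : `|K| * `|h| <= e); first by rewrite ler_wpM2r// ler_norm.
  move: he; rewrite ler_pdivlMr// => he; apply: le_trans he.
  by rewrite mulrC ler_wpM2l// lerDl.
by split; [apply/cvg_ex; exists d|exact: cvg_lim].
Unshelve. all: by end_near. Qed.

Definition C1 f := exists2 f' : R -> R, continuous f' & forall x : R, is_derive x (1 : R) f (f' x).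

Lemma C1_continuous f : C1 f -> continuous f.
Proof.
move=> [f' _ h] x; apply: differentiable_continuous; apply/derivable1_diffP.
by case: (h x).
Qed.

Lemma C1_derive1 f : C1 f -> (forall s : R, derivable f s 1) /\ continuous (derive1 f).
Proof.
move=> [f' c h]; split; first by move=> s; case: (h s).
rewrite (_ : derive1 f = f')//; apply/funext => x.
by rewrite derive1E; case: (h x).
Qed.

Lemma C1_cst c : C1 (fun=> c).
Proof. by exists (fun=> 0); [move=> x; exact: cvg_cst|move=> x; exact: is_derive_cst]. Qed.

Lemma C1_id : C1 (fun x => x).
Proof. by exists (fun=> 1); [move=> x; exact: cvg_cst|move=> x; exact: is_derive_id]. Qed.

Lemma C1D f g : C1 f -> C1 g -> C1 (fun x => f x + g x).
Proof.
move=> [f' cf hf] [g' cg hg]; exists (fun x => f' x + g' x).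
  by move=> x; apply: continuousD; [exact: cf|exact: cg].
by move=> x; exact: is_deriveD.
Qed.

Lemma C1M f g : C1 f -> C1 g -> C1 (fun x => f x * g x).
Proof.
move=> hf hg; have cf := C1_continuous hf; have cg := C1_continuous hg.
move: hf hg => [f' cf' hf] [g' cg' hg]; exists (fun x => f x * g' x + g x * f' x).
  by apply: contD; exact: contM.
by move=> x; exact: is_deriveM.
Qed.

Lemma C1X f n : C1 f -> C1 (fun x => f x ^+ n).
Proof.
move=> hf; elim: n => [|n ih]; first exact: C1_cst.
rewrite (_ : (fun _ => _) = fun x => f x * f x ^+ n); first exact: C1M.
by apply/funext => x; rewrite exprS.
Qed.

Lemma C1_comp f g : C1 f -> C1 g -> C1 (f \o g).
Proof.
move=> [f' cf' hf] hg; have cg := C1_continuous hg; move: hg => [g' cg' hg].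
exists (fun x => f' (g x) * g' x).
  apply: contM => // x.
  by apply: continuous_comp; [exact: cg|exact: cf'].
by move=> x; exact: is_derive1_comp.
Qed.

(** A C^1 function vanishing on a half line; composed with [(s - a) * (b - s)] it gives a compactly
    supported one. The error of its first-order expansion is at most [h ^+ 2]. *)
Lemma C1_pos2 : C1 (fun x => Num.max 0 x ^+ 2).
Proof.
exists (fun x => 2 * Num.max 0 x).
  apply: contM; first exact: cont_cst.
  by move=> x; apply: continuous_max; [exact: cvg_cst|exact: cvg_id].
move=> x; apply: (@is_derive_quad _ _ _ 1) => h; rewrite mul1r.
rewrite ler_norml; have [hx|hx] := leP 0 x; have [hxh|hxh] := leP 0 (x + h); apply/andP; split; nra.
Qed.

(* [bump a b n] increases to the indicator function of ]a, b[ as n grows *)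
Definition bump (a b : R) (n : nat) : R -> R := fun s =>
  1 - (1 - (4 / (b - a) ^+ 2) ^+ 2 * Num.max 0 ((s - a) * (b - s)) ^+ 2) ^+ n.

Lemma C1_bump a b n : C1 (bump a b n).
Proof.
have lin c d : C1 (fun s => c * s + d).
  by apply: C1D; [apply: C1M; [exact: C1_cst|exact: C1_id]|exact: C1_cst].
have q : C1 (fun s => Num.max 0 ((s - a) * (b - s)) ^+ 2).
  apply: (C1_comp (g := fun s => (s - a) * (b - s)) C1_pos2); apply: C1M.
    by have := lin 1 (- a); under eq_fun do rewrite mul1r.
  by have := lin (-1) b; under eq_fun do rewrite mulN1r addrC.
rewrite /bump (_ : (fun _ => _) = fun s => 1 + (-1) * (1 + (- (4 / (b - a) ^+ 2) ^+ 2) *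
  Num.max 0 ((s - a) * (b - s)) ^+ 2) ^+ n); last first.
  by apply/funext => s; rewrite mulN1r mulNr.
apply: C1D; first exact: C1_cst.
apply: C1M; first exact: C1_cst.
apply: C1X; apply: C1D; first exact: C1_cst.
by apply: C1M; first exact: C1_cst.
Qed.

Lemma bump_out a b n s : a < b -> ~~ (a < s < b) -> bump a b n s = 0.
Proof.
move=> ab h; rewrite /bump max_l; first by rewrite expr0n /= mulr0 subr0 expr1n subrr.
move: h; rewrite negb_and -!leNgt => /orP[h|h].
  by rewrite mulr_le0_ge0 ?subr_le0 ?subr_ge0// (le_trans h)// ltW.
by rewrite mulr_ge0_le0 ?subr_le0 ?subr_ge0// (le_trans _ h)// ltW.
Qed.

(** The maximum of [(s - a) * (b - s)] is [(b - a) ^+ 2 / 4], which the factor [4 / (b - a) ^+ 2]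
    normalises to one. *)
Lemma bump_base a b s : a < b ->
  0 <= 1 - (4 / (b - a) ^+ 2) ^+ 2 * Num.max 0 ((s - a) * (b - s)) ^+ 2 <= 1.
Proof.
move=> ab; rewrite -exprMn; set q := _ * _.
have ba : 0 < (b - a) ^+ 2 by rewrite exprn_gt0// subr_gt0.
have q0 : 0 <= q by apply: mulr_ge0; [rewrite divr_ge0// ltW|rewrite le_max lexx].
have q1 : q <= 1.
  rewrite /q mulrAC ler_pdivrMr// mul1r.
  have := sqr_ge0 ((s - a) - (b - s)); have [h|h] := leP 0 ((s - a) * (b - s)); last by move=> _; rewrite mulr0 ltW.
  nra.
apply/andP; split; last by rewrite gerBl sqr_ge0.
by rewrite subr_ge0 expr_le1.
Qed.

Lemma bump_range a b n s : a < b -> 0 <= bump a b n s <= 1.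
Proof.
move=> ab; have /andP[h0 h1] := bump_base s ab.
by rewrite /bump subr_ge0 gerBl exprn_ge0// exprn_ile1.
Qed.

Lemma bump_cvg a b s : a < b -> a < s < b -> bump a b n s @[n --> \oo] --> (1 : R).
Proof.
move=> ab /andP[sa sb]; have /andP[h0 h1] := bump_base s ab.
rewrite -[X in _ --> X]subr0; apply: cvgB; first exact: cvg_cst.
apply: cvg_expr; rewrite ger0_norm// gtrBl mulr_gt0// exprn_gt0//.
  by rewrite divr_gt0// exprn_gt0// subr_gt0.
by rewrite lt_max mulr_gt0 ?orbT// subr_gt0.
Qed.

Lemma itv_norm_le a b s : a < s < b -> `|s| <= `|a| + `|b|.
Proof.
move=> /andP[h3 h4]; rewrite ler_norml.
have := ler_norm (- a); have := ler_norm b; rewrite normrN.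
have := normr_ge0 a; have := normr_ge0 b => *; apply/andP; split; lra.
Qed.

Lemma Cc1_bump a b n : a < b -> Cc1 (bump a b n).
Proof.
move=> ab; have [h1 h2] := C1_derive1 (C1_bump a b n); split => //.
exists (`|a| + `|b|) => s hs; apply: bump_out => //; apply: contraTN hs => h.
by rewrite -leNgt itv_norm_le.
Qed.

Lemma Cc1_Cc psi : Cc1 psi -> Cc psi.
Proof.
move=> [h _ h3]; split => // x.
by apply: differentiable_continuous; apply/derivable1_diffP.
Qed.

Lemma restrict_itvE g a b s : (g \_ `]a, b[) s = if a < s < b then g s else 0.
Proof.
have [hs|hs] := boolP (a < s < b); rewrite patchE.
  by rewrite mem_set//= in_itv.
by rewrite memNset//= in_itv; exact/negP.
Qed.

Lemma good_restrict_integrable g a b : good g ->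
  lm.-integrable setT (EFin \o (g \_ `]a, b[)).
Proof.
move=> [mg bg]; have [C hC] := bg (`|a| + `|b|).
apply: (@bounded_support_integrable _ _ (`|a| + `|b|) `|C|).
- by apply/(measurable_restrictT _ _).1; [exact: measurable_itv|exact: measurable_funTS].
- move=> s hs; rewrite restrict_itvE; case: ifPn => // h.
  by move: hs; rewrite ltNge itv_norm_le.
- apply: aeS hC => s hC; rewrite restrict_itvE; case: ifPn => [h|_]; last by rewrite normr0.
  by apply: le_trans (ler_norm C); apply: hC; exact: itv_norm_le.
Qed.

(** The bumps take values in [[0, 1]] and tend to the indicator of the interval, so dominated
    convergence with bound [|g|] there passes from test functions to intervals. *)
Lemma good_int0 g a b : good g -> (forall psi, Cc1 psi -> wint psi g = 0) -> a < b ->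
  \int[lm]_(s in `]a, b[) g s = 0.
Proof.
move=> hg h ab; have Ig := good_restrict_integrable a b hg; have [mg _] := hg.
pose f_ n (s : T1) : \bar R := (bump a b n s * g s)%:E.
pose f (s : T1) : \bar R := ((g \_ `]a, b[) s)%:E.
have mf_ n : measurable_fun setT (f_ n).
  apply/measurable_EFinP; apply: measurable_funM => //.
  by apply: continuous_measurable_fun; apply: C1_continuous; exact: C1_bump.
have mf : measurable_fun setT f by have /integrableP[] := Ig.
have f_f : {ae lm, forall s, setT s -> f_ n s @[n --> \oo] --> f s}.
  apply: aeW => s _; rewrite /f_ /f restrict_itvE; case: ifPn => hs.
    apply: cvg_EFin; first by near=> n.
    by rewrite -[X in _ --> X]mul1r; apply: cvgM; [exact: bump_cvg|exact: cvg_cst].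
  rewrite (_ : (fun _ => _) = fun=> 0%E); first exact: cvg_cst.
  by apply/funext => n; rewrite bump_out ?mul0r//; apply/negP.
have f_g : {ae lm, forall s, forall n, setT s -> (`|f_ n s| <= (EFin \o (Num.Def.normr \o (g \_ `]a, b[))) s)%E}.
  apply: aeW => s n _; rewrite /f_ /= lee_fin restrict_itvE; case: ifPn => hs.
    have /andP[b0 b1] := bump_range n s ab.
    by rewrite normrM (ger0_norm b0) ler_piMl.
  by rewrite bump_out ?mul0r ?normr0.
have [_ _ lim] := dominated_convergence measurableT mf_ mf f_f (integrable_norm Ig) f_g.
have E n : (\int[lm]_s f_ n s = 0)%E.
  have hp := Cc1_bump n ab; have I := Cc_good_integrable (Cc1_Cc hp) hg.
  by rewrite -(fineK (integrable_fin_num measurableT I)); congr EFin; exact: h.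
rewrite Rintegral_mkcond /Rintegral -/(f _).
suff -> : (\int[lm]_s f s = 0)%E by [].
apply: (@cvg_unique _ _ _ _ _ _ lim); first exact: ereal_hausdorff.
by rewrite (_ : [sequence _]_n = fun=> 0%E); [exact: cvg_cst|apply/funext => n; exact: E].
Unshelve. all: by end_near. Qed.

(** Integrals over all intervals vanish, so the primitive of [g] cut to a bounded interval is zero;
    Lebesgue differentiation then gives [g = 0] almost everywhere there, and countably many
    intervals suffice. *)
Lemma good_weak0 g : good g -> (forall psi, Cc1 psi -> wint psi g = 0) ->
  {ae lm, forall s : R, g s = 0}.
Proof.
move=> hg h.
suff key n : {ae lm, forall s : R, `|s| < n.+1%:R -> g s = 0}.
  apply: aeS (ae_foralln key) => s hs.
  have [n hn] : exists n : nat, `|s| < n.+1%:R.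
    by exists (Num.truncn `|s|); rewrite truncnS_gt.
  exact: hs hn.
have Ig := good_restrict_integrable (- n.+1%:R) n.+1%:R hg.
pose f := g \_ `]- n.+1%:R, n.+1%:R[.
have If y : lm.-integrable `]-oo, y] (EFin \o f).
  by apply: integrableS Ig => //; exact: measurable_itv.
have Lf : locally_integrable setT f.
  have := integrable_locally (f := f) measurableT Ig.
  by rewrite patch_setT.
have F0 : (fun x => \int[lm]_(t in `]-oo, x]) f t) = fun=> 0.
  apply/funext => x; rewrite /f -Rintegral_mkcondr.
  have [xn|xn] := leP x (- n.+1%:R).
    rewrite (_ : _ `&` _ = set0) ?Rintegral_set0//.
    rewrite -subset0 => s [] /=; rewrite !in_itv /= => sx /andP[ns _].
    by have := lt_le_trans ns (le_trans sx xn); rewrite ltxx.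
  have [nx|nx] := leP n.+1%:R x.
    rewrite (_ : _ `&` _ = `]- n.+1%:R, n.+1%:R[%classic); last first.
      rewrite eqEsubset; split => s /=; rewrite !in_itv /=; first by case.
      by move=> /andP[h1 h2]; split; [exact: ltW (lt_le_trans h2 nx)|rewrite h1 h2].
    by apply: good_int0 => //; rewrite gtrN.
  rewrite (_ : _ `&` _ = `]- n.+1%:R, x]%classic); last first.
    rewrite eqEsubset; split => s /=; rewrite !in_itv /=.
      by move=> [h1 /andP[h2 h3]]; rewrite h1 h2.
    by move=> /andP[h1 h2]; rewrite h1 h2 (le_lt_trans h2 nx).
  rewrite -Rintegral_itv_bndo_bndc ?good_int0//.
  have mI : measurable (`]- n.+1%:R, x[%classic : set T1) by exact: measurable_itv.
  apply/(integrable_mkcond _ mI); rewrite restrict_EFin.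
  exact: good_restrict_integrable.
have := FTC1Ny If Lf; rewrite F0; apply: aeS => s [_ hs] sn.
by move: hs; rewrite derive1E derive_cst /f restrict_itvE -ltr_norml sn.
Qed.

End TestFunctions.

Lemma cvg_of_bound {R : realType} (T : topologicalType) (F N : T -> R) (x : T) :
  N y @[y --> x] --> (0 : R) -> (forall y, `|F y - F x| <= N y) -> F y @[y --> x] --> F x.
Proof.
move=> hN h; apply/cvgrPdist_le => e e0.
move/cvgrPdist_le : hN => /(_ e e0); apply: filterS => y.
rewrite sub0r normrN => hy; rewrite distrC; apply: le_trans (h y) _.
exact: le_trans (ler_norm _) hy.
Qed.

(** * Time-dependent fields *)

Section TimeDependentFields.
Context {R : realType} (L : R) (N : nat).
Hypothesis L0 : 0 < L.
Local Notation T1 := (measurableTypeR R).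
Local Notation lm := (leb R).
Local Notation E := (E L).
Local Notation index := (int * int * bool)%type.
Implicit Types (u phi : vfield R).

Definition ncont (T : topologicalType) (z : T -> vfield R) :=
  (forall x, L2 L (z x)) /\ forall x, nrm L (z y - z x) @[y --> x] --> (0 : R).

Lemma ncont_cst (T : topologicalType) u : L2 L u -> ncont (fun _ : T => u).
Proof.
move=> Lu; split => // x; rewrite (_ : (fun _ => _) = fun=> 0); first exact: cvg_cst.
by apply/funext => y; rewrite subrr nrm0.
Qed.

Lemma ncontD (T : topologicalType) (z z' : T -> vfield R) : ncont z -> ncont z' ->
  ncont (fun x => z x + z' x).
Proof.
move=> [Lz hz] [Lz' hz']; split; first by move=> x; exact: L2D.
move=> x; have h0 : nrm L (z y - z x) + nrm L (z' y - z' x) @[y --> x] --> (0 : R).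
  by rewrite -[X in _ --> X]addr0; apply: cvgD; [exact: hz|exact: hz'].
have hz0 : nrm L ((z x + z' x) - (z x + z' x)) = 0 by rewrite subrr nrm0.
rewrite -[X in _ --> X]hz0; apply: (cvg_of_bound h0) => y; rewrite hz0 subr0 ger0_norm ?nrm_ge0//.
by rewrite opprD addrACA; apply: nrmD; exact: L2B.
Qed.

Lemma ncontZ (T : topologicalType) c (z : T -> vfield R) : ncont z -> ncont (fun x => c *: z x).
Proof.
move=> [Lz hz]; split; first by move=> x; exact: L2Z.
move=> x; rewrite (_ : (fun _ => _) = fun y => `|c| * nrm L (z y - z x)); last first.
  by apply/funext => y; rewrite -scalerBr nrmZ//; exact: L2B.
by rewrite -[X in _ --> X](mulr0 `|c|); apply: cvgM; [exact: cvg_cst|exact: hz].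
Qed.

Lemma ncont_dot (T : topologicalType) (z : T -> vfield R) phi : ncont z -> L2 L phi ->
  continuous (fun x => dot L (z x) phi).
Proof.
move=> [Lz hz] Lp x; apply: (@cvg_of_bound _ _ _ (fun y => nrm L (z y - z x) * nrm L phi)).
  by rewrite -[X in _ --> X](mul0r (nrm L phi)); apply: cvgM; [exact: hz|exact: cvg_cst].
by move=> y; rewrite -dotBl//; apply: dot_le_nrm => //; exact: L2B.
Qed.

Lemma ncont_nrm (T : topologicalType) (z : T -> vfield R) : ncont z -> continuous (fun x => nrm L (z x)).
Proof.
move=> [Lz hz] x; apply: (cvg_of_bound (hz x)) => y.
have h1 : nrm L (z y) <= nrm L (z y - z x) + nrm L (z x).
  by rewrite -[in leLHS](subrK (z x) (z y)); apply: nrmD => //; exact: L2B.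
have h2 : nrm L (z x) <= nrm L (z y - z x) + nrm L (z y).
  have e : z x = z y - (z y - z x) by rewrite subKr.
  by rewrite {1}e [leRHS]addrC; apply: nrmB => //; exact: L2B.
by rewrite ler_norml; apply/andP; split; lra.
Qed.

Lemma ncont_Bform (T : topologicalType) (z z' : T -> vfield R) phi : ncont z -> ncont z' -> VV L phi ->
  continuous (fun x => Bform L (z x) (z' x) phi).
Proof.
move=> [Lz hz] [Lz' hz'] Vp x; have [C C0 hC] := Bform_bound Vp.
apply: (@cvg_of_bound _ _ _ (fun y => C * (nrm L (z y - z x) * (nrm L (z' x) + nrm L (z' y - z' x)) +
  nrm L (z x) * nrm L (z' y - z' x)))).
  rewrite -[X in _ --> X](mulr0 C); apply: cvgM; first exact: cvg_cst.
  rewrite [X in _ --> X](_ : _ = 0 * (nrm L (z' x) + 0) + nrm L (z x) * 0); last by rewrite mul0r mulr0 addr0.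
  apply: cvgD; apply: cvgM; [exact: hz| |exact: cvg_cst|exact: hz'].
  by apply: cvgD; [exact: cvg_cst|exact: hz'].
move=> y; have Ld := L2B (Lz y) (Lz x); have Ld' := L2B (Lz' y) (Lz' x).
have -> : Bform L (z y) (z' y) phi - Bform L (z x) (z' x) phi =
    Bform L (z y - z x) (z' y) phi + Bform L (z x) (z' y - z' x) phi.
  by rewrite BformBl// BformBr//; ring.
apply: le_trans (ler_normD _ _) _; rewrite mulrDr !mulrA.
apply: lerD; last exact: hC.
apply: le_trans (hC _ _ Ld (Lz' y)) _; rewrite ler_wpM2l ?mulr_ge0 ?nrm_ge0//.
by rewrite -[in leLHS](subrK (z' x) (z' y)) [leRHS]addrC; exact: nrmD.
Qed.

(* A field whose low modes are merely measurable and locally bounded in time, up to a norm-continuous part. *)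
Definition gv (z : R -> vfield R) := (forall s, L2 L (z s)) /\
  exists (c : index -> R -> R) (w : R -> vfield R), [/\ forall i, good (c i), ncont w &
    forall s, nrm L (z s - (\sum_(i <- fr N | low N i) c i s *: E i + w s)) = 0].

Lemma L2_lowsum (c : index -> R) : L2 L (\sum_(i <- fr N | low N i) c i *: E i).
Proof. by apply: L2_sum => i _; apply: L2Z; exact: L2_E. Qed.

Lemma gv_ncont z : ncont z -> gv z.
Proof.
move=> hz; have [Lz _] := hz; split => //; exists (fun _ _ => 0), z; split => //.
  by move=> i; exact: good_cst.
by move=> s; rewrite big1 ?add0r ?subrr ?nrm0// => i _; rewrite scale0r.
Qed.

Lemma gv_Pi (p : R -> vfield R) : (forall i, good (fun s => dot L (p s) (E i))) ->
  gv (fun s => Pi L N (p s)).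
Proof.
move=> h; split; first by move=> s; exact/L2_VV/VV_Pi.
exists (fun i s => dot L (p s) (E i)), (fun=> 0); split => //.
  exact/ncont_cst/L20.
by move=> s; rewrite addr0 subrr nrm0.
Qed.

Lemma gvD z z' : gv z -> gv z' -> gv (fun s => z s + z' s).
Proof.
move=> [Lz [c [w [hc hw h]]]] [Lz' [c' [w' [hc' hw' h']]]].
split; first by move=> s; exact: L2D.
exists (fun i s => c i s + c' i s), (fun s => w s + w' s); split.
- by move=> i; exact: goodD.
- exact: ncontD.
move=> s; have [Lw _] := hw; have [Lw' _] := hw'.
have -> : z s + z' s - (\sum_(i <- fr N | low N i) (c i s + c' i s) *: E i + (w s + w' s)) =
    (z s - (\sum_(i <- fr N | low N i) c i s *: E i + w s)) +
    (z' s - (\sum_(i <- fr N | low N i) c' i s *: E i + w' s)).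
  under eq_bigr do rewrite scalerDl.
  by rewrite big_split /= [in LHS]addrACA opprD addrACA.
have h1 := L2B (Lz s) (L2D (L2_lowsum (c ^~ s)) (Lw s)).
have h2 := L2B (Lz' s) (L2D (L2_lowsum (c' ^~ s)) (Lw' s)).
apply/eqP; rewrite eq_le nrm_ge0 andbT; apply: le_trans (nrmD h1 h2) _.
by rewrite h h' addr0.
Qed.

Lemma gvN z : gv z -> gv (fun s => - z s).
Proof.
move=> [Lz [c [w [hc hw h]]]]; split; first by move=> s; exact: L2N.
have [Lw _] := hw.
exists (fun i s => -1 * c i s), (fun s => -1 *: w s); split.
- by move=> i; exact: goodZ.
- exact: ncontZ.
move=> s; rewrite -[RHS](h s) -[RHS]nrmN; last by apply: L2B => //; apply: L2D => //; exact: L2_lowsum.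
have e : \sum_(i <- fr N | low N i) (-1 * c i s) *: E i = - \sum_(i <- fr N | low N i) c i s *: E i.
  by rewrite -sumrN; apply: eq_bigr => i _; rewrite mulN1r scaleNr.
by congr nrm; rewrite e scaleN1r -!opprD.
Qed.

Lemma gvB z z' : gv z -> gv z' -> gv (fun s => z s - z' s).
Proof. by move=> hz hz'; apply: gvD => //; exact: gvN. Qed.

Lemma gv_dot z phi : gv z -> L2 L phi -> good (fun s => dot L (z s) phi).
Proof.
move=> [Lz [c [w [hc hw h]]]] Lp; have [Lw _] := hw.
rewrite (_ : (fun _ => _) = fun s => \sum_(i <- fr N | low N i) c i s * dot L (E i) phi + dot L (w s) phi).
  apply: goodD; last exact/good_cont/ncont_dot.
  by apply: good_sum => i; apply: goodM => //; exact: good_cst.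
apply/funext => s; have LS := L2_lowsum (c ^~ s).
rewrite (dot_nrm0 (Lz s) (L2D LS (Lw s)) Lp (h s)) dotDl// dot_suml// => i _.
exact: L2_E.
Qed.

(** The purpose of [gv]: bilinear expansion leaves finite sums of scalar coefficients in [good]
    times continuous functions, so measurability in [s] needs no theory of measurable fields. *)
Lemma gv_Bform z z' phi : gv z -> gv z' -> VV L phi -> good (fun s => Bform L (z s) (z' s) phi).
Proof.
move=> [Lz [c [w [hc hw h]]]] [Lz' [c' [w' [hc' hw' h']]]] Vp.
have [Lw _] := hw; have [Lw' _] := hw'.
rewrite (_ : (fun _ => _) = fun s =>
  \sum_(i <- fr N | low N i) c i s * (\sum_(j <- fr N | low N j) c' j s * Bform L (E i) (E j) phi +
     Bform L (E i) (w' s) phi) +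
  (\sum_(j <- fr N | low N j) c' j s * Bform L (w s) (E j) phi + Bform L (w s) (w' s) phi)).
  have hE i := @ncont_cst R^o (E i) (L2_E L0 i).
  apply: goodD; first apply: good_sum => i.
    apply: goodM => //; apply: goodD; last by apply: good_cont; exact: ncont_Bform.
    by apply: good_sum => j; apply: goodM => //; exact: good_cst.
  apply: goodD; last by apply: good_cont; exact: ncont_Bform.
  by apply: good_sum => j; apply: goodM => //; apply: good_cont; exact: ncont_Bform.
apply/funext => s; have LS := L2_lowsum (c ^~ s); have LS' := L2_lowsum (c' ^~ s).
have LSw := L2D LS (Lw s); have LSw' := L2D LS' (Lw' s).
rewrite (Bform_nrm0 Vp (Lz s) LSw (Lz' s) LSw' (h s) (h' s)) BformDl//.
rewrite Bform_suml//; last by move=> i; exact: L2_E.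
congr (_ + _).
  apply: eq_bigr => i _; congr (_ * _); have LE := L2_E L0 i.
  by rewrite BformDr// Bform_sumr// => j; exact: L2_E.
by rewrite BformDr// Bform_sumr// => j; exact: L2_E.
Qed.

(** Tensor products of a weight in [s] with a fixed field are the elements of L^1(R, H) through
    which the weak star hypotheses are exploited. *)
Lemma L1H_scale (g : R -> R) phi : H L phi -> lm.-integrable setT (EFin \o g) ->
  L1H L (fun s => g s *: phi).
Proof.
move=> Hp Ig; have Lp := H_L2 Hp.
have mg : measurable_fun setT (g : T1 -> R) by have /integrableP[/measurable_EFinP] := Ig.
split; first split.
- by move=> s; exact: HZ.
- move=> u Hu; rewrite (_ : (fun _ => _) = fun s => g s * dot L phi u).
    by apply: measurable_funM => //; exact: measurable_cst.
  by apply/funext => s; rewrite dotZl//; exact: H_L2.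
have := integrableZr measurableT (nrm L phi) (integrable_norm Ig).
by apply: eq_integrable => // s _; rewrite /= nrmZ// EFinM.
Qed.

Lemma pairing_scale (p : R -> vfield R) (g : R -> R) phi : (forall s, H L (p s)) -> H L phi ->
  pairing L p (fun s => g s *: phi) = \int[lm]_(s in setT) (g s * dot L (p s) phi).
Proof.
by move=> hp Hp; apply: eq_Rintegral => s _; rewrite dotZr//; exact: H_L2.
Qed.

Lemma LinfH_good (p : R -> vfield R) phi : LinfH L p -> H L phi -> good (fun s => dot L (p s) phi).
Proof.
move=> [[Hp mp] [M hM]] Hphi; split; first exact: mp.
move=> S; exists (M * nrm L phi); apply: aeS hM => s hs _.
apply: le_trans (dot_le_nrm (H_L2 (Hp s)) (H_L2 Hphi)) _.
by rewrite ler_wpM2r ?nrm_ge0.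
Qed.

End TimeDependentFields.

Lemma cvg0_sum {R : realType} (I : Type) (s : seq I) (P : pred I) (u : I -> nat -> R) :
  (forall i, u i j @[j --> \oo] --> (0 : R)) -> \sum_(i <- s | P i) u i j @[j --> \oo] --> (0 : R).
Proof.
move=> h; elim: s => [|i s ih].
  by rewrite (_ : (fun _ => _) = fun=> 0); [exact: cvg_cst|apply/funext => j; rewrite big_nil].
rewrite (_ : (fun _ => _) = fun j => (if P i then u i j else 0) + \sum_(i <- s | P i) u i j); last first.
  by apply/funext => j; rewrite big_cons; case: ifP => //; rewrite add0r.
by rewrite -[X in _ --> X]addr0; apply: cvgD => //; case: (P i) => //; exact: cvg_cst.
Qed.

Lemma derive1_out {R : realType} (psi : R -> R) (M s : R) : Cc1 psi ->
  (forall s, M < `|s| -> psi s = 0) -> M < `|s| -> derive1 psi s = 0.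
Proof.
move=> [dp _ _] hM Ms; rewrite derive1E.
have near0 : \forall x \near s, psi x = cst 0 x.
  have : \forall x \near s, M < `|x| by exact: (cvgr_gt _ (@norm_continuous R R^o s) _ Ms).
  by apply: filterS => x; exact: hM.
by rewrite (near_eq_derive _ near0) derive_cst.
Qed.

Lemma Cc1_derive_Cc {R : realType} (psi : R -> R) : Cc1 psi -> Cc (derive1 psi).
Proof.
move=> hp; have [_ cp [M hM]] := hp; split => //.
by exists M => s; exact: derive1_out.
Qed.

(** * Passage to the limit: quadratic term and time derivative *)

Section Limit.
Context {R : realType} (L : R) (N : nat).
Hypothesis L0 : 0 < L.
Local Notation lm := (leb R).
Local Notation E := (E L).
Implicit Types (psi : R -> R) (phi : vfield R).

Lemma Bform_lowl u z phi : PH L N u -> L2 L z -> VV L phi ->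
  Bform L u z phi = \sum_(i <- fr N | low N i) Bform L (E i) z phi * dot L u (E i).
Proof.
move=> hu Lz Vp; have Lu := H_L2 (PH_H hu); have LP := L2_VV (VV_Pi L0 N u).
rewrite (Bform_nrm0 Vp Lu LP Lz Lz (PH_Pi L0 hu)) ?subrr ?nrm0//.
rewrite /Pi Bform_suml//; last by move=> i; exact: L2_E.
by apply: eq_bigr => i _; rewrite mulrC.
Qed.

Lemma Bform_lowr u z phi : PH L N u -> L2 L z -> VV L phi ->
  Bform L z u phi = \sum_(i <- fr N | low N i) Bform L z (E i) phi * dot L u (E i).
Proof.
move=> hu Lz Vp; have Lu := H_L2 (PH_H hu); have LP := L2_VV (VV_Pi L0 N u).
have P0 := PH_Pi L0 hu; have z0 : nrm L (z - z) = 0 by rewrite subrr nrm0.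
rewrite (Bform_nrm0 Vp Lz Lz Lu LP z0 P0).
rewrite /Pi Bform_sumr//; last by move=> i; exact: L2_E.
by apply: eq_bigr => i _; rewrite mulrC.
Qed.

Lemma PH_sub u u' : PH L N u -> PH L N u' -> PH L N (u - u').
Proof.
move=> hu hu'; have Hu := PH_H hu; have Hu' := PH_H hu'.
apply: PH_intro => //; first exact: HB.
move=> i li; rewrite dotBl ?(PH_coef L0 hu) ?(PH_coef L0 hu')// ?subrr//; try exact: H_L2.
exact: L2_E.
Qed.

(* The defect of weak continuity of the quadratic term comes only from the oscillation [v j - vt] of the low modes. *)
Lemma limit_Bform psi phi (v w : nat -> R -> vfield R) (vt wb : R -> vfield R) (Mv : R) :
  Cc psi -> VV L phi ->
  (forall j, ncont L (v j)) -> (forall j s, PH L N (v j s)) -> (forall j s, nrm L (v j s) <= Mv) ->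
  gv L N vt -> (forall s, PH L N (vt s)) ->
  (forall j, ncont L (w j)) -> ncont L wb ->
  (forall S e : R, 0 < e -> \forall j \near \oo, forall s, `|s| <= S -> nrm L (w j s - wb s) <= e) ->
  (forall i F, good F -> wint psi (fun s => F s * dot L (v j s - vt s) (E i)) @[j --> \oo] --> (0 : R)) ->
  wint psi (fun s => Bform L (v j s + w j s) (v j s + w j s) phi)
    - wint psi (fun s => Bform L (vt s + wb s) (vt s + wb s) phi)
    - wint psi (fun s => Bform L (v j s - vt s) (v j s - vt s) phi) @[j --> \oo] --> (0 : R).
Proof.
move=> hp Vp cv Pv bv gvt Pvt cw cwb hw hv.
have gvv j : gv L N (v j) by exact: gv_ncont.
have gww j : gv L N (w j) by exact: gv_ncont.
have gwb : gv L N wb by exact: gv_ncont.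
(* [y] is the limit, [a] the weakly null oscillation, [d] the strongly null error, and [x = y + a],
   so that the field is [y + a + d]. Expanding leaves [B(y)], the defect [B(a)], the cross terms
   [T1] and [T2] of [y] with [a], and in [F3] everything containing [d]. *)
pose y s := vt s + wb s; pose a j s := v j s - vt s.
pose d j s := w j s - wb s; pose x j s := v j s + wb s.
have gy : gv L N y by exact: gvD.
have ga j : gv L N (a j) by exact: gvB.
have gd j : gv L N (d j) by exact: gvB.
have gx j : gv L N (x j) by exact: gvD.
have [Ly _] := gy; have La j s : L2 L (a j s) by case: (ga j).
have Ld j s : L2 L (d j s) by case: (gd j).
have Lx j s : L2 L (x j s) by case: (gx j).
have Pa j s : PH L N (a j s) by exact: PH_sub.
pose T1 j := wint psi (fun s => Bform L (y s) (a j s) phi).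
pose T2 j := wint psi (fun s => Bform L (a j s) (y s) phi).
pose F3 j s := Bform L (x j s) (d j s) phi + (Bform L (d j s) (x j s) phi + Bform L (d j s) (d j s) phi).
have gF3 j : good (F3 j).
  have g1 := gv_Bform L0 (gx j) (gd j) Vp; have g2 := gv_Bform L0 (gd j) (gx j) Vp.
  have g3 := gv_Bform L0 (gd j) (gd j) Vp.
  exact: goodD g1 (goodD g2 g3).
have dec : (fun j => wint psi (fun s => Bform L (v j s + w j s) (v j s + w j s) phi)
    - wint psi (fun s => Bform L (y s) (y s) phi)
    - wint psi (fun s => Bform L (a j s) (a j s) phi)) = fun j => T1 j + T2 j + wint psi (F3 j).
  apply/funext => j.
  have -> : (fun s => Bform L (v j s + w j s) (v j s + w j s) phi) = fun s =>
      Bform L (y s) (y s) phi + (Bform L (a j s) (a j s) phi +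
        (Bform L (y s) (a j s) phi + (Bform L (a j s) (y s) phi + F3 j s))).
    apply/funext => s.
    have e1 : v j s + w j s = x j s + d j s by rewrite /x /d [RHS]addrACA subrr addr0.
    have e2 : x j s = y s + a j s by rewrite /x /y /a [RHS]addrC addrA subrK.
    have Lxd := L2D (Lx j s) (Ld j s); have Lya := L2D (Ly s) (La j s).
    rewrite e1 (BformDl Vp (Lx j s) (Ld j s) Lxd) (BformDr Vp (Lx j s) (Lx j s) (Ld j s)) (BformDr Vp (Ld j s) (Lx j s) (Ld j s)).
    have -> : Bform L (x j s) (x j s) phi = Bform L (y s + a j s) (y s + a j s) phi by rewrite -e2.
    rewrite (BformDl Vp (Ly s) (La j s) Lya) (BformDr Vp (Ly s) (Ly s) (La j s)) (BformDr Vp (La j s) (Ly s) (La j s)).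
    by rewrite /F3; ring.
  have g1 := gv_Bform L0 gy gy Vp; have g2 := gv_Bform L0 (ga j) (ga j) Vp.
  have g3 := gv_Bform L0 gy (ga j) Vp; have g4 := gv_Bform L0 (ga j) gy Vp.
  have g43 := goodD g4 (gF3 j); have g343 := goodD g3 g43; have g2343 := goodD g2 g343.
  rewrite (wintD hp g1 g2343) (wintD hp g2 g343) (wintD hp g3 g43) (wintD hp g4 (gF3 j)) -/(T1 j) -/(T2 j).
  by move: (wint _ _) (wint _ _) (wint _ _) (T1 j) (T2 j) => *; ring.
rewrite dec; rewrite [X in _ --> X](_ : _ = 0 + 0 + 0); last by rewrite !addr0.
apply: cvgD; first apply: cvgD.
(* Since [a j] takes values in P_N H, the cross term is a finite sum of scalar coefficients of
   [a j], each with a weight independent of [j]; [hv] applies to each. *)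
- rewrite (_ : T1 = fun j => \sum_(i <- fr N | low N i)
      wint psi (fun s => Bform L (y s) (E i) phi * dot L (v j s - vt s) (E i))).
    apply: cvg0_sum => i; apply: hv; apply: (gv_Bform L0 gy _ Vp).
    by apply: gv_ncont => //; apply: ncont_cst; exact: L2_E.
  apply/funext => j; rewrite -wint_sum//.
    by congr wint; apply/funext => s; exact: Bform_lowr.
  move=> i; apply: goodM (gv_dot L0 (ga j) (L2_E L0 i)).
  apply: (gv_Bform L0 gy _ Vp).
  by apply: gv_ncont => //; apply: ncont_cst; exact: L2_E.
- rewrite (_ : T2 = fun j => \sum_(i <- fr N | low N i)
      wint psi (fun s => Bform L (E i) (y s) phi * dot L (v j s - vt s) (E i))).
    apply: cvg0_sum => i; apply: hv; apply: (gv_Bform L0 _ gy Vp).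
    by apply: gv_ncont => //; apply: ncont_cst; exact: L2_E.
  apply/funext => j; rewrite -wint_sum//.
    by congr wint; apply/funext => s; exact: Bform_lowl.
  move=> i; apply: goodM (gv_dot L0 (ga j) (L2_E L0 i)).
  apply: (gv_Bform L0 _ gy Vp).
  by apply: gv_ncont => //; apply: ncont_cst; exact: L2_E.
have [C C0 hC] := Bform_bound Vp.
have [_ [M hM]] := hp.
have [Mw hMw] := cont_bounded (ncont_nrm cwb) M.
pose X := Mv + `|Mw|.
have Mv0 : 0 <= Mv by exact: le_trans (nrm_ge0 _ _) (bv 0%N 0).
have X0 : 0 <= X by rewrite addr_ge0.
pose I := \int[lm]_(s in setT) `|psi s|.
have I0 : 0 <= I by exact: Rintegral_ge0.
(* Two terms pair [x], of norm at most [X], with [d], and one pairs [d] with itself. Taking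
   [dl <= 1] below makes the latter at most [C * dl] as well. *)
pose K := C * (2 * X + 1).
have K0 : 0 <= K by rewrite mulr_ge0// addr_ge0// mulr_ge0.
apply/cvgrPdist_le => e e0.
have KI : 0 < K * I + 1 by rewrite ltr_wpDl// mulr_ge0.
pose dl := Num.min 1 (e / (K * I + 1)).
have dl0 : 0 < dl by rewrite lt_min ltr01 divr_gt0.
have := hw M _ dl0; apply: filterS => j hj.
rewrite sub0r normrN.
have F3le s : `|s| <= M -> `|F3 j s| <= K * dl.
  move=> sM; have hd := hj s sM; rewrite -/(d j s) in hd.
  have hd1 : nrm L (d j s) <= 1 by apply: le_trans hd _; rewrite ge_min lexx.
  have hx : nrm L (x j s) <= X.
    have [Lv _] := cv j; have [Lwb _] := cwb.
    apply: le_trans (nrmD (Lv s) (Lwb s)) _; rewrite lerD//.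
    by apply: le_trans (ler_norm _) _; apply: le_trans (hMw s sM) (ler_norm _).
  have dn := nrm_ge0 L (d j s); have xn := nrm_ge0 L (x j s).
  have b1 := hC _ _ (Lx j s) (Ld j s); have b2 := hC _ _ (Ld j s) (Lx j s).
  have b3 := hC _ _ (Ld j s) (Ld j s).
  have xd : nrm L (x j s) * nrm L (d j s) <= X * dl by exact: ler_pM.
  have dd : nrm L (d j s) * nrm L (d j s) <= 1 * dl by exact: ler_pM.
  apply: le_trans (ler_normD _ _) _.
  have := ler_normD (Bform L (d j s) (x j s) phi) (Bform L (d j s) (d j s) phi).
  have := ler_wpM2l C0 xd; have := ler_wpM2l C0 dd.
  rewrite /K; move: b1 b2 b3; rewrite -!mulrA [nrm L (d j s) * nrm L (x j s)]mulrC; lra.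
apply: le_trans (wint_le hp (gF3 j) hM _ F3le) _; first by rewrite mulr_ge0// ltW.
rewrite -/I mulrAC.
have : dl <= e / (K * I + 1) by rewrite ge_min lexx orbT.
rewrite ler_pdivlMr//; apply: le_trans.
by rewrite mulrC ler_wpM2l ?ltW// ltrDl.
Qed.

(** Only the derivative of [a] in its first argument is available, so [s] is first translated by
    [r]: the integrand becomes [psi (s + r) * a r s], and the motion of the slice falls on [psi].
    This is where the term with [derive1 psi] comes from. *)
Lemma slice_derivative psi (a b : R -> R -> R) (Ka : R) (r0 : R) : Cc1 psi ->
  (forall r, continuous (a r)) -> (forall r, continuous (b r)) ->
  (forall r s, is_derive r (1 : R) (a ^~ s) (b r s)) ->
  (forall r s, `|a r s| <= Ka) ->
  (forall S, exists Kb : R, forall r s, `|r| <= S -> `|s| <= S -> `|b r s| <= Kb) ->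
  is_derive r0 (1 : R) (fun r => wint psi (fun s => a r (s - r)))
    (wint (derive1 psi) (fun s => a r0 (s - r0)) + wint psi (fun s => b r0 (s - r0))).
Proof.
move=> hp ca cb hd ba bb; have [dp cdp [M hM]] := hp; have hpc := Cc1_Cc hp.
have [cp _] := hpc; have dpc := Cc1_derive_Cc hp.
pose f r s := psi (s + r) * a r s.
have cshift (g : R -> R) r : continuous g -> continuous (fun s => g (s + r)).
  by move=> cg x; apply: (@continuous_comp _ _ _ (fun s => s + r) g); [apply: cvgD; [exact: cvg_id|exact: cvg_cst]|exact: cg].
have cf r : continuous (f r) by apply: contM => //; exact: cshift.
have E1 : (fun r => wint psi (fun s => a r (s - r))) = fun r => \int[lm]_(s in setT) f r s.
  apply/funext => r; rewrite /wint (Rintegral_shift r); last by apply: contM => //; exact: cshift.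
  by apply: eq_Rintegral => s _; rewrite addrK.
pose f' r s := derive1 psi (s + r) * a r s + psi (s + r) * b r s.
have df r s : is_derive r (1 : R) (f ^~ s) (f' r s).
  have hs : is_derive r (1 : R) (fun r => s + r) 1.
    by apply: (is_derive_eq (is_deriveD (is_derive_cst s r 1) (is_derive_id r 1))); rewrite add0r.
  have h1 : is_derive r (1 : R) (fun r => psi (s + r)) (derive1 psi (s + r)).
    have h0 : is_derive (s + r) (1 : R) psi (derive1 psi (s + r)).
      by rewrite derive1E; apply: derivableP; exact: dp.
    by apply: (is_derive_eq (is_derive1_comp h0 hs)); rewrite mulr1.
  apply: (is_derive_eq (is_deriveM h1 (hd r s))).
  by rewrite /f' /GRing.scale /= addrC mulrC.
have dE r s : derive1 (f ^~ s) r = f' r s by rewrite derive1E; case: (df r s).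
(* For [r] within distance one of [r0], the translate of [psi] by [r] is supported in [[- S, S]],
   which gives a dominating function independent of [r]. *)
pose S := `|M| + (`|r0| + 1).
have S0 : 0 <= S by rewrite addr_ge0// addr_ge0.
have rS r : r \in `]r0 - 1, r0 + 1[ -> `|r| <= `|r0| + 1.
  rewrite in_itv /= => /andP[h1 h2]; rewrite ler_norml.
  have := ler_norm r0; have := ler_norm (- r0); rewrite normrN => *; apply/andP; split; lra.
have out r s : r \in `]r0 - 1, r0 + 1[ -> S < `|s| -> M < `|s + r|.
  move=> /rS hr hs; apply: le_lt_trans (ler_norm M) _.
  have : `|s| <= `|s + r| + `|r| by rewrite -[X in `|X| <= _](addrK r); exact: ler_normB.
  by rewrite /S in hs; lra.
have [K1 K10 hK1] := Cc_bounded hpc; have [K2 K20 hK2] := Cc_bounded dpc.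
have [Kb hKb] := bb S.
have Ka0 : 0 <= Ka by exact: le_trans (normr_ge0 _) (ba 0 0).
pose K := K2 * Ka + K1 * `|Kb|.
have K0 : 0 <= K by rewrite addr_ge0// mulr_ge0.
pose G s := K * \1_(`[- S, S]%classic : set R) s.
have itvE s : (s \in (`[- S, S]%classic : set R)) = (`|s| <= S).
  have [h|h] := boolP (`|s| <= S).
    by rewrite mem_set//= in_itv /= -ler_norml.
  by rewrite memNset//= in_itv /= -ler_norml; exact/negP.
have dout r s : r \in `]r0 - 1, r0 + 1[ -> S < `|s| -> f' r s = 0.
  move=> hr hs; have ho := out r s hr hs; have [_ [M' hM']] := dpc.
  by rewrite /f' hM// mul0r addr0 (derive1_out hp hM ho) mul0r.
have G_ub r s : r \in `]r0 - 1, r0 + 1[ -> `|derive1 (f ^~ s) r| <= G s.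
  move=> hr; rewrite dE /G indicE itvE; have [hs|hs] := leP `|s| S; last first.
    by rewrite dout// normr0 mulr0.
  rewrite mulr1 /f'; apply: le_trans (ler_normD _ _) _; rewrite lerD// normrM ler_pM//.
  apply: le_trans (ler_norm Kb); apply: hKb => //.
  by apply: le_trans (rS r hr) _; rewrite lerDr.
have IG : lm.-integrable setT (EFin \o G).
  apply: (@bounded_support_integrable _ _ S K).
  - apply: measurable_funM; first exact: measurable_cst.
    by apply: measurable_indic; exact: measurable_itv.
  - by move=> s hs; rewrite /G indicE itvE leNgt hs mulr0.
  - apply: aeW => s; rewrite /G indicE normrM (ger0_norm K0).
    by rewrite ler_piMr//; case: (_ \in _); rewrite ?normr1 ?normr0.
have If r : r \in `]r0 - 1, r0 + 1[ -> lm.-integrable setT (EFin \o f r).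
  move=> hr; apply: (@bounded_support_integrable _ _ S (K1 * Ka)).
  - exact: continuous_measurable_fun.
  - by move=> s hs; rewrite /f hM ?mul0r//; exact: out hr hs.
  - by apply: aeW => s; rewrite /f normrM ler_pM.
have r0I : r0 \in `]r0 - 1, r0 + 1[ by rewrite in_itv /= ltrDl gtrDl ltrN10 ltr01.
have G0 s : 0 <= G s by rewrite /G indicE mulr_ge0//; case: (_ \in _).
have dfI r s : `]r0 - 1, r0 + 1[%classic r -> setT s -> derivable (f ^~ s) r 1.
  by move=> _ _; case: (df r s).
have If' r : `]r0 - 1, r0 + 1[%classic r -> lm.-integrable setT (EFin \o f r) by exact: If.
have GI r s : `]r0 - 1, r0 + 1[%classic r -> setT s -> `|derive1 (f ^~ s) r| <= G s.
  by move=> hr _; exact: G_ub.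
have der := derivable_under_integral measurableT r0I If' dfI G0 IG GI.
have val := differentiation_under_integral measurableT r0I If' dfI G0 IG GI.
rewrite E1; split=> //; rewrite -derive1E val.
have cadp : continuous (fun s => derive1 psi s * a r0 (s - r0)) by apply: contM => //; exact: cshift.
have cpb : continuous (fun s => psi s * b r0 (s - r0)) by apply: contM => //; exact: cshift.
rewrite /wint (Rintegral_shift r0 cadp) (Rintegral_shift r0 cpb).
have gI (g h : R -> R) : Cc g -> continuous h -> lm.-integrable setT (EFin \o (fun s => g (s + r0) * h (s + r0 - r0))).
  move=> [cg [M' hM']] ch; apply: (Cc_good_integrable (psi := fun s => g (s + r0)) (F := fun s => h (s + r0 - r0))).
    split; first exact: cshift.
    exists (M' + `|r0|) => s hs; apply: hM'.
    have : `|s| <= `|s + r0| + `|r0| by rewrite -[X in `|X| <= _](addrK r0); exact: ler_normB.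
    lra.
  by apply: good_cont => s; under eq_fun do rewrite addrK; exact: ch.
rewrite -RintegralD//; [|exact: gI|exact: gI].
by apply: eq_Rintegral => s _; rewrite /partial1of2 dE /f' !addrK.
Qed.

(** Over a short interval the increment of [Phi j] tends to [c - c = 0], and it equals the length
    times [Phi' j] at some [tau j]. There [Phi' j] is close to [J], and [J (tau j)] is close to
    [J t] by continuity. *)
Lemma limit_derivative_zero (Phi Phi' : nat -> R -> R) (J : R -> R) (c : R) :
  (forall j t, is_derive t (1 : R) (Phi j) (Phi' j t)) -> continuous J ->
  (forall t, Phi j t @[j --> \oo] --> c) ->
  (forall (tau : nat -> R) (T : R), (forall j, `|tau j| <= T) ->
     Phi' j (tau j) - J (tau j) @[j --> \oo] --> (0 : R)) ->
  forall t, J t = 0.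
Proof.
move=> hd cJ hc hJ t; apply: contrapT => /eqP Jt.
(* Three errors below a quarter of [|J t|] cannot add up to [|J t|]. *)
have e0 : 0 < `|J t| / 4 by rewrite divr_gt0// normr_gt0.
have /cvgrPdist_lt /(_ _ e0) /nbhs_ballP[dl /= dl0 hdl] := cJ t.
pose h := dl / 2; have h0 : 0 < h by rewrite divr_gt0.
have mvt j : exists c0, (c0 \in `]t, t + h[) /\ Phi j (t + h) - Phi j t = Phi' j c0 * h.
  have th : t < t + h by rewrite ltrDl.
  have cP : {within `[t, t + h], continuous (Phi j)}.
    apply: continuous_subspaceT => x.
    by apply: differentiable_continuous; apply/derivable1_diffP; case: (hd j x).
  have [c0 hc0 e] := MVT th (fun x _ => hd j x) cP.
  by exists c0; split => //; rewrite e addrC addKr.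
have [tau htau] := choice mvt.
have tauT j : `|tau j| <= `|t| + h.
  have [] := htau j; rewrite in_itv /= => /andP[h1 h2] _; rewrite ler_norml.
  have := ler_norm t; have := ler_norm (- t); rewrite normrN => *; apply/andP; split; lra.
have JE j : `|J t - J (tau j)| < `|J t| / 4.
  apply: hdl; rewrite /ball /=; have [] := htau j; rewrite in_itv /= => /andP[h1 h2] _.
  by rewrite ltr_norml; apply/andP; split; rewrite /h in h2; lra.
have c1 : h^-1 * (Phi j (t + h) - Phi j t) @[j --> \oo] --> h^-1 * (c - c).
  by apply: cvgM; [exact: cvg_cst|apply: cvgB; exact: hc].
rewrite subrr mulr0 in c1.
have /cvgrPdist_lt /(_ _ e0) [n1 _ hn1] := c1.
have /cvgrPdist_lt /(_ _ e0) [n2 _ hn2] := hJ tau _ tauT.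
pose j := maxn n1 n2.
have := hn1 j (leq_maxl _ _); have := hn2 j (leq_maxr _ _); have := JE j.
have [_ ->] := htau j; rewrite [h^-1 * _]mulrC mulfK ?gt_eqF// !sub0r !normrN => g1 g2 g3.
have : `|J t| <= `|J t - J (tau j)| + (`|Phi' j (tau j) - J (tau j)| + `|Phi' j (tau j)|).
  have -> : J t = (J t - J (tau j)) + (- (Phi' j (tau j) - J (tau j)) + Phi' j (tau j)) by ring.
  apply: le_trans (ler_normD _ _) _; rewrite lerD//.
    by rewrite (_ : _ - J (tau j) = J t - J (tau j))//; ring.
  by apply: le_trans (ler_normD _ _) _; rewrite normrN.
have := normr_gt0 (J t); rewrite Jt; lra.
Qed.

End Limit.

Lemma cont_pair {R : realType} (T : topologicalType) (f g : T -> R) :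
  continuous f -> continuous g -> continuous (fun x => (f x, g x)).
Proof. by move=> cf cg x; exact: (cvg_pair (cf x) (cg x)). Qed.

Lemma cont_bounded2 {R : realType} (F : R * R -> R) : continuous F ->
  forall S : R, exists C : R, forall r s, `|r| <= S -> `|s| <= S -> `|F (r, s)| <= C.
Proof.
move=> cF S; pose K := (`[- S, S] `*` `[- S, S])%classic : set (R * R).
have cK : compact K by apply: compact_setX; exact: segment_compact.
have := compact_bounded (continuous_compact (continuous_subspaceT cF) cK).
move=> [C [_ hC]]; exists (C + 1) => r s hr hs; apply: (hC (C + 1)); first by rewrite ltrDl.
by exists (r, s) => //; split; rewrite /= in_itv /= -ler_norml.
Qed.

(** * The norm of V, stability under the Laplacian, and weak forms *)

Section ReducedFunctionals.
Context {R : realType} (L : R) (N : nat).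
Hypothesis L0 : 0 < L.
Local Notation lm := (leb R).
Local Notation k0 := (kappa0 L).
Local Notation E := (E L).

(** [Apow] is a choice, so [nrmV] gets its subadditivity and its bound under scaling only through
    this uniqueness up to null norm. *)
Lemma isApow_unique a u g g' : isApow L a u g -> isApow L a u g' -> nrm L (g - g') = 0.
Proof.
move=> h h'; have [Hu Hg _] := h; have [_ Hg' _] := h'.
apply: (H_ext L0); first exact: HB.
move=> i; have [i0|i0] := eqVneq i.1 0.
  by case: i i0 => k b /= ->; rewrite E0 dotC dot0l//; apply: H_L2; exact: HB.
rewrite (dotBl (H_L2 Hg) (H_L2 Hg') (L2_E L0 i)).
by rewrite (isApow_coef L0 h i0) (isApow_coef L0 h' i0) subrr.
Qed.

Lemma isApow_lin a c u v g g' : isApow L a u g -> isApow L a v g' ->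
  isApow L a (c *: u + v) (c *: g + g').
Proof.
move=> [Hu Hg h] [Hv Hg' h']; split; [exact: H_lin|exact: H_lin|] => l om eo.
have [/H_L2 Lo _ _] := eo.
have Lu := H_L2 Hu; have Lv := H_L2 Hv; have Lg := H_L2 Hg; have Lg' := H_L2 Hg'.
rewrite (dotDl (L2Z c Lg) Lg' Lo) (dotDl (L2Z c Lu) Lv Lo) !dotZl// (h l om eo) (h' l om eo); ring.
Qed.

Lemma nrm_triangle0 u v : L2 L u -> L2 L v -> nrm L (u - v) = 0 -> nrm L u <= nrm L v.
Proof.
move=> Lu Lv e; rewrite -[u](subrK v); apply: le_trans (nrmD (L2B Lu Lv) Lv) _.
by rewrite e add0r.
Qed.

Lemma V_addr u v : V L u -> V L v -> V L (u + v) /\ nrmV L (u + v) <= nrmV L u + nrmV L v.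
Proof.
move=> Vu Vv; have hu := Apow_spec Vu; have hv := Apow_spec Vv.
have := isApow_lin 1 hu hv; rewrite !scale1r => huv.
have Vuv : V L (u + v) by eexists; exact: huv.
split=> //; have [_ Hg _] := huv; have [_ Hg' _] := Apow_spec Vuv.
have [_ /H_L2 Lu _] := hu; have [_ /H_L2 Lv _] := hv.
apply: le_trans (nrm_triangle0 (H_L2 Hg') (H_L2 Hg) _) (nrmD Lu Lv).
exact: isApow_unique (Apow_spec Vuv) huv.
Qed.

Lemma V_scale c u : V L u -> V L (c *: u) /\ nrmV L (c *: u) <= `|c| * nrmV L u.
Proof.
move=> Vu; have hu := Apow_spec Vu; have h0 : isApow L (1 / 2) 0 0.
  split; [exact: H0|exact: H0|] => l om [/H_L2 Lo _ _].
  by rewrite dot0l// mulr0.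
have := isApow_lin c hu h0; rewrite !addr0 => hcu.
have Vcu : V L (c *: u) by eexists; exact: hcu.
split=> //; have [_ Hg _] := hcu; have [_ Hg' _] := Apow_spec Vcu.
have [_ /H_L2 Lu _] := hu; rewrite /nrmV -nrmZ//.
apply: nrm_triangle0 (H_L2 Hg') (H_L2 Hg) _.
exact: isApow_unique (Apow_spec Vcu) hcu.
Qed.

Lemma nrmV_dist u v : V L u -> V L v -> `|nrmV L u - nrmV L v| <= nrmV L (u - v).
Proof.
move=> Vu Vv; have Vd := V_sub Vu Vv.
have [_ h1] := V_addr Vd Vv; have [Vd' h2] := V_scale (-1) Vd.
have [_ h3] := V_addr Vd' Vu; rewrite subrK in h1.
rewrite normrN normr1 mul1r in h2; rewrite scaleN1r opprB subrK in h3.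
rewrite scaleN1r opprB in h2.
rewrite ler_norml; move: h1 h2 h3.
by move: (nrmV L u) (nrmV L v) (nrmV L (u - v)) (nrmV L (v - u)) => a b c d *; apply/andP; split; lra.
Qed.

Lemma PH_V u : PH L N u -> V L u. Proof. exact: domA_PH. Qed.

Lemma nrm_ncont_V (T : topologicalType) (z : T -> vfield R) : (forall x, V L (z x)) ->
  (forall x, nrmV L (z y - z x) @[y --> x] --> (0 : R)) -> ncont L z.
Proof.
move=> Vz cz; split=> [x|x]; first exact/H_L2/V_H.
apply/cvgrPdist_le => e e0.
have k00 := kappa0_gt0 L0.
have /cvgrPdist_le /(_ (k0 * e)) := cz x; rewrite mulr_gt0// => /(_ isT).
apply: filterS => y; rewrite !sub0r !normrN => hy.
rewrite ger0_norm ?nrm_ge0//; apply: le_trans (nrm_le_nrmV L0 (V_sub (Vz y) (Vz x))) _.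
by rewrite ler_pdivrMl//; apply: le_trans hy; exact: ler_norm.
Qed.

Lemma ncont_comp (T T' : topologicalType) (z : T' -> vfield R) (g : T -> T') :
  ncont L z -> continuous g -> ncont L (z \o g).
Proof.
move=> [Lz cz] cg; split=> [x|x]; first exact: Lz.
exact: (@cvg_comp _ _ _ g (fun y => nrm L (z y - z (g x)))) (cg x) (cz (g x)).
Qed.

Lemma dot_E_nlapl phi i : VV L phi -> dot L (E i) (- lapl phi) = lam L i * dot L (E i) phi.
Proof.
move=> Vp; have [i0|i0] := eqVneq i.1 0.
  case: i i0 => k b /= ->.
  by rewrite E0 (dot0l (L2_VV Vp)) (dot0l (L2_VV (VV_nlapl L0 Vp))) mulr0.
have [_ _ [_ _ ->]] := eigen_E L0 i0 => //.
by rewrite dotZl//; [exact: L2_E|exact: L2_VV].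
Qed.

Lemma PH_nlapl phi : VV L phi -> PH L N phi -> PH L N (- lapl phi).
Proof.
move=> Vp Pp; apply: (PH_intro L0); first exact/H_VV/VV_nlapl.
by move=> i hi; rewrite dotC dot_E_nlapl// dotC (PH_coef L0 Pp hi) mulr0.
Qed.

Lemma E_PH i : low N i -> PH L N (E i).
Proof.
move=> hi; apply: (PH_intro L0); first exact: H_E.
move=> j hj; rewrite dot_EE_neq//; apply: contraNneq hj.
by rewrite !(lowE R) in hi * => <-.
Qed.

Lemma QH_nlapl phi : VV L phi -> QH L N phi -> QH L N (- lapl phi).
Proof.
move=> Vp [_ Qp]; split; first exact/H_VV/VV_nlapl.
move=> z Pz; apply: (dot_PH0 L0 _ Pz); first exact/L2_VV/VV_nlapl.
by move=> i hi; rewrite dotC dot_E_nlapl// dotC Qp ?mulr0//; exact: E_PH.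
Qed.

Lemma B_H u v : H L (B L u v).
Proof. by rewrite /B; case: xgetP => [g _ []//|_]; exact: H0. Qed.

Lemma countable_ae (T : countType) (P : T -> R -> Prop) :
  (forall i, {ae lm, forall s : R, P i s}) -> {ae lm, forall s : R, forall i, P i s}.
Proof.
move=> h; pose Q n s := if choice.unpickle n is Some i then P i s else True.
have hQ n : {ae lm, forall s : R, Q n s}.
  by rewrite /Q; case: (choice.unpickle n) => [i|]; [exact: h|exact: aeW].
have := ae_foralln hQ; apply: aeS => s hs i.
by have := hs (choice.pickle i); rewrite /Q choice.pickleK.
Qed.

Lemma ereal_sup0_le (I : Type) (K : set I) (F : nat -> I -> R) :
  (ereal_sup [set (F n x)%:E | x in K] @[n --> \oo] --> 0%E) ->
  forall e, 0 < e -> \forall n \near \oo, forall x, K x -> F n x <= e.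
Proof.
move=> h e e0; have e0' : (0 < e%:E)%E by rewrite lte_fin.
have := h _ (nbhs_open_ereal_lt e0'); rewrite nbhs_filterE /=.
apply: filterS => n hn x Kx; rewrite -lee_fin; apply: le_trans (ltW hn).
by apply: ereal_sup_ubound; exists x.
Qed.

(** Evaluation along a moving sequence, the form in which uniformity in [t] meets the intermediate
    points of the mean value theorem. *)
Lemma cvg0_unif_seq (T : R) (F : nat -> R -> R) (tau : nat -> R) : cvg0_unif T F ->
  (forall j, `|tau j| <= T) -> F j (tau j) @[j --> \oo] --> (0 : R).
Proof.
move=> h ht; apply/cvgrPdist_le => e e0.
have := ereal_sup0_le h e0; apply: filterS => j hj.
by rewrite sub0r normrN; apply: hj; rewrite /= in_itv /= -ler_norml.
Qed.

Lemma weak_split (nu : R) psi F G K : Cc1 psi -> good F -> good G -> good K ->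
  \int[lm]_(s in setT) (- (derive1 psi s * F s) + psi s * (nu * G s + K s)) =
  - wint (derive1 psi) F + nu * wint psi G + wint psi K.
Proof.
move=> hp gF gG gK; have hc := Cc1_Cc hp; have hd := Cc1_derive_Cc hp.
have gGK := goodD (goodZ nu gG) gK.
rewrite -addrA -(wintZ nu hc gG) -(wintD hc (goodZ nu gG) gK).
have -> : - wint (derive1 psi) F = wint (derive1 psi) (fun s => -1 * F s).
  by rewrite wintZ// mulN1r.
rewrite /wint -RintegralD//; [|exact: Cc_good_integrable hd (goodZ (-1) gF)|exact: Cc_good_integrable].
by apply: eq_Rintegral => s _; congr (_ + _); rewrite mulN1r mulrN.
Qed.

End ReducedFunctionals.

Lemma cvg_cst_eq {R : realType} (a b : R) : (fun _ : nat => a) @ \oo --> b -> b = a.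
Proof. by move=> h; apply: (cvg_unique _ h (cvg_cst a)); exact: norm_hausdorff. Qed.

Lemma cvg_eqf {R : realType} (F G : nat -> R) (l : R) : F =1 G ->
  F j @[j --> \oo] --> l -> G j @[j --> \oo] --> l.
Proof. by move=> /funext ->. Qed.

Lemma cvg_sum2 {R : realType} (x1 x2 : nat -> R) (l1 l2 : R) :
  x1 j @[j --> \oo] --> l1 -> x2 j @[j --> \oo] --> l2 -> x1 j + x2 j @[j --> \oo] --> l1 + l2.
Proof. by move=> h1 h2; apply: cvgD. Qed.

Lemma cvg_opp {R : realType} (x : nat -> R) (l : R) :
  x j @[j --> \oo] --> l -> - x j @[j --> \oo] --> - l.
Proof. exact: cvgN. Qed.

Lemma cvg_combination {R : realType} (c : R) (x1 x2 x3 : nat -> R) (l1 l2 l3 : R) :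
  x1 j @[j --> \oo] --> l1 -> x2 j @[j --> \oo] --> l2 -> x3 j @[j --> \oo] --> l3 ->
  - x1 j + c * x2 j + x3 j @[j --> \oo] --> - l1 + c * l2 + l3.
Proof.
move=> h1 h2 h3; apply: cvgD h3; apply: cvgD; first exact: cvgN.
by apply: cvgM h2; exact: cvg_cst.
Qed.

Lemma is_derive_shift {R : realType} (g : R -> R) (a s d : R) :
  is_derive (s + a) (1 : R) g d -> is_derive s (1 : R) (fun s => g (s + a)) d.
Proof.
move=> h0; have hs : is_derive s (1 : R) (fun s => s + a) 1.
  by apply: (is_derive_eq (is_deriveD (is_derive_id s 1) (is_derive_cst a s 1))); rewrite addr0.
by have := @is_derive1_comp _ g (fun s => s + a) s _ _ h0 hs; rewrite mulr1.
Qed.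

Lemma Cc1_shift {R : realType} (psi : R -> R) (a : R) : Cc1 psi ->
  Cc1 (fun s => psi (s + a)) /\
  derive1 (fun s => psi (s + a)) = fun s => derive1 psi (s + a).
Proof.
move=> [dp cdp [M hM]].
have ds s : is_derive s (1 : R) (fun s => psi (s + a)) (derive1 psi (s + a)).
  by apply: is_derive_shift; rewrite derive1E; apply: derivableP; exact: dp.
have dE : derive1 (fun s => psi (s + a)) = fun s => derive1 psi (s + a).
  by apply/funext => s; rewrite derive1E; case: (ds s).
split; last exact: dE.
split; [by move=> s; case: (ds s)| |].
  rewrite dE => x; apply: (@continuous_comp _ _ _ (fun s => s + a) (derive1 psi)); last exact: cdp.
  by apply: cvgD; [exact: cvg_id|exact: cvg_cst].
exists (M + `|a|) => s hs; apply: hM.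
have : `|s| <= `|s + a| + `|a| by rewrite -[X in `|X| <= _](addrK a); exact: ler_normB.
lra.
Qed.

Lemma is_derive_cvg {R : realType} (g : R -> R) (x d : R) :
  h^-1 * (g (x + h) - g x) @[h --> (0 : R)^'] --> d -> is_derive x (1 : R) g d.
Proof.
move=> hg; have c : h^-1 *: ((g \o shift x) (h *: 1) - g x) @[h --> 0^'] --> d.
  apply: cvg_trans hg; apply: near_eq_cvg; apply: nearW => h.
  by rewrite /= /GRing.scale /= mulr1 [h + x]addrC.
by split; [apply/cvg_ex; exists d|exact: cvg_lim].
Qed.

(** * The limit equation *)

Section LimitEquation.
Context {R : realType} (nu L : R) (f : vfield R) (N : nat).
Variables (W : (R -> vfield R) -> (R -> vfield R)) (v : R -> R -> vfield R).
Variables (tj : nat -> R) (vbar Rbar wbar : R -> R -> vfield R).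
Local Notation lm := (leb R).
Local Notation k0 := (kappa0 L).
Local Notation E := (E L).

(* [shifted v j] and [shifted w j] are the paper's v_n and w_n for n = n_j. *)
Definition shifted (z : R -> R -> vfield R) (j : nat) (t s : R) : vfield R :=
  z (t + tj j) (s - (t + tj j)).

Local Notation w := (fun r s => W (v r) s).
Local Notation vj := (shifted v).
Local Notation wj := (shifted w).

Hypotheses (nu0 : 0 < nu) (L0 : 0 < L) (Hf : H L f).
Hypothesis hW : solution_map nu L f N W.
Hypothesis hv : determining_form_sol nu L f N W v.
Hypothesis bv : forall t s, nrmV L (v t s) <= 2 * nu * k0 * G nu L f.
Hypotheses (hvb : C_Linf_weakstar L vbar) (hRb : C_Linf_weakstar L Rbar).
Hypothesis hwb : C_V_on L setT wbar.
Hypothesis cvg_v : forall T xi, 0 < T -> L1H L xi ->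
  cvg0_unif T (fun j t => pairing L (vj j t - vbar t) xi).
Hypothesis cvg_B : forall T xi, 0 < T -> L1H L xi ->
  cvg0_unif T (fun j t => pairing L (fun s =>
    B L (vj j t s - vbar t s) (vj j t s - vbar t s) + Rbar t s) xi).
Hypothesis cvg_w : forall T S, 0 < T -> 0 < S ->
  cvg_C_V L (`[- T, T] `*` `[- S, S]) wj wbar.
Hypothesis vb_t : forall t t', eqH L (vbar t) (vbar t').
Hypothesis wb_t : forall t t' s, nrm L (wbar t s - wbar t' s) = 0.

(** * Regularity of the solution and of its shifted copies *)

Lemma v_in_X r : X L N (v r). Proof. by have [] := hv r. Qed.

Lemma PH_v r s : PH L N (v r s). Proof. by have [h _ _] := v_in_X r; exact: h. Qed.

Definition vmax := k0^-1 * (2 * nu * k0 * G nu L f).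

Lemma v_le r s : nrm L (v r s) <= vmax.
Proof.
apply: le_trans (nrm_le_nrmV L0 (PH_V L0 (PH_v r s))) _.
by rewrite ler_wpM2l// invr_ge0 ltW// (kappa0_gt0 L0).
Qed.

Lemma ncont_v r : ncont L (v r).
Proof. by apply: nrm_ncont_V => // [s|]; [exact: PH_V (PH_v r s)|have [] := v_in_X r]. Qed.

Lemma w_sol r : bounded_weak_sol nu L f N (v r) (W (v r)).
Proof. by have [] := hW (v_in_X r). Qed.

Lemma QH_w r s : QH L N (W (v r) s). Proof. by have [[h _ _] _ _ _] := w_sol r; exact: h. Qed.

Lemma V_w r s : V L (W (v r) s). Proof. by have [_ h _ _] := w_sol r; exact: h. Qed.

(** Joint continuity is read off from the convergence hypothesis, since membership of each [w_n] in
    the space of continuous V-valued functions on a rectangle is part of [cvg_C_V]; a single index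
    is enough. *)
Lemma ncont_w : ncont L (fun p : R * R => W (v p.1) p.2).
Proof.
(* The inverse of the change of variables that defines [shifted] for the index [0]. *)
pose g (p : R * R) : R * R := (p.1 - tj 0%N, p.1 + p.2).
have cg : continuous g.
  apply: cont_pair => p; [apply: cvgB; [exact: cvg_fst|exact: cvg_cst]|].
  by apply: cvgD; [exact: cvg_fst|exact: cvg_snd].
have wE p : wj 0%N (g p).1 (g p).2 = W (v p.1) p.2.
  by rewrite /shifted /= subrK addrC addKr.
rewrite (_ : (fun p : R * R => W (v p.1) p.2) = (fun p : R * R => wj 0%N p.1 p.2) \o g); last first.
  by apply/funext => p; rewrite /= -wE.
apply: ncont_comp cg; apply: nrm_ncont_V => // [p|p]; first exact: V_w.
pose T := `|p.1| + 1; pose S := `|p.2| + 1.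
have T0 : 0 < T by rewrite ltr_pwDr.
have S0 : 0 < S by rewrite ltr_pwDr.
have [/(_ 0%N) [_ h] _] := cvg_w T0 S0.
have inP : (`[- T, T] `*` `[- S, S])%classic p by split; rewrite /= in_itv /= -ler_norml lerDl.
have := h p inP; rewrite within_interior//.
exists (`]- T, T[%classic, `]- S, S[%classic) => /=.
  split; (apply: open_nbhs_nbhs; split; [exact: interval_open|]);
    by rewrite /= in_itv /= -ltr_norml ltrDl.
by move=> q [/= q1 q2]; split; apply: subset_itv_oo_cc; [exact: q1|exact: q2].
Qed.

Lemma ncont_wslice r : ncont L (W (v r)).
Proof.
have cg : continuous (fun s : R => (r, s)) by apply: cont_pair => s; [exact: cvg_cst|exact: cvg_id].
exact: ncont_comp ncont_w cg.
Qed.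

Lemma csub (a : R) : continuous (fun s : R => s - a).
Proof. by move=> s; apply: cvgB; [exact: cvg_id|exact: cvg_cst]. Qed.

Lemma ncont_vj j t : ncont L (vj j t).
Proof. exact: ncont_comp (ncont_v _) (csub (a := t + tj j)). Qed.

Lemma ncont_wj j t : ncont L (wj j t).
Proof. exact: ncont_comp (ncont_wslice _) (csub (a := t + tj j)). Qed.

(* [vlim] and [wlim] represent vbar and wbar, chosen independent of t and, for [vlim], in P_N H for every s. *)
Definition vlim s := Pi L N (vbar 0 s).
Definition wlim := wbar 0.

Lemma H_vbar t s : H L (vbar t s). Proof. by have [/(_ t) [[h _] _] _] := hvb; exact: h. Qed.

Lemma H_Rbar t s : H L (Rbar t s). Proof. by have [/(_ t) [[h _] _] _] := hRb; exact: h. Qed.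

Lemma V_wbar t s : V L (wbar t s). Proof. by have [h _] := hwb; exact: (h (t, s)). Qed.

Lemma PH_vlim s : PH L N (vlim s). Proof. exact: Pi_PH. Qed.

Lemma gv_vlim : gv L N vlim.
Proof. by apply: gv_Pi => // i; apply: LinfH_good (H_E L0 i); have [] := hvb. Qed.

Lemma nrmV_wbar_cont t s0 : nrmV L (wbar t s - wbar t s0) @[s --> s0] --> (0 : R).
Proof.
have [_ /(_ (t, s0) I)] := hwb; rewrite withinET => h.
have cg : continuous (fun s : R => (t, s)) by apply: cont_pair => s; [exact: cvg_cst|exact: cvg_id].
exact: (cvg_comp _ _ (cg s0) h).
Qed.

Lemma ncont_wbar t : ncont L (wbar t).
Proof. by apply: nrm_ncont_V => // s; [exact: V_wbar|exact: nrmV_wbar_cont]. Qed.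

Lemma gv_wlim : gv L N wlim. Proof. exact/gv_ncont/ncont_wbar. Qed.

Definition ulim s := vlim s + wlim s.

Lemma gv_ulim : gv L N ulim. Proof. exact: gvD gv_vlim gv_wlim. Qed.

(** The limit [wbar t] may be replaced by [wbar 0] because their difference has null norm; the bound
    stays uniform in [t], so [t] can later follow a sequence. *)
Lemma wj_cvg T S e : 0 < e -> \forall j \near \oo, forall t s, `|t| <= T -> `|s| <= S ->
  nrm L (wj j t s - wlim s) <= e.
Proof.
move=> e0; pose T' := `|T| + 1; pose S' := `|S| + 1.
have T0 : 0 < T' by rewrite ltr_pwDr.
have S0 : 0 < S' by rewrite ltr_pwDr.
have [_ h] := cvg_w T0 S0.
have ke : 0 < k0 * e by exact: mulr_gt0 (kappa0_gt0 L0) e0.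
have := ereal_sup0_le h ke; apply: filterS => j hj t s ht hs.
have Lw : L2 L (wj j t s) by have [] := ncont_wj j t.
have [Lwt _] := ncont_wbar t; have [Lw0 _] := ncont_wbar 0.
have := hj (t, s); rewrite /= => /(_ _) h1.
have {}h1 : nrmV L (wj j t s - wbar t s) <= k0 * e.
  apply: h1; split; rewrite /= in_itv /= -ler_norml.
    by apply: le_trans ht _; rewrite (le_trans (ler_norm _))// lerDl.
  by apply: le_trans hs _; rewrite (le_trans (ler_norm _))// lerDl.
have -> : wj j t s - wlim s = (wj j t s - wbar t s) + (wbar t s - wlim s) by rewrite addrA subrK.
apply: le_trans (nrmD (L2B Lw (Lwt s)) (L2B (Lwt s) (Lw0 s))) _.
rewrite wb_t addr0; apply: le_trans (nrm_le_nrmV L0 (V_sub (V_w _ _) (V_wbar _ _))) _.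
by rewrite ler_pdivrMl ?(kappa0_gt0 L0).
Qed.

(** Orthogonality to P_N H is closed under norm limits, and each [wj j 0 s] has it. *)
Lemma QH_wlim s : QH L N (wlim s).
Proof.
split; first exact: V_H (V_wbar 0 s).
move=> z Pz; have Lz := H_L2 (PH_H Pz).
have [Lw0 _] := ncont_wbar 0.
apply/eqP; rewrite -normr_le0; apply/ler_addgt0Pl => e e0; rewrite addr0.
pose d := e / (nrm L z + 1).
have z1 : 0 < nrm L z + 1 by rewrite ltr_wpDl ?nrm_ge0.
have d0 : 0 < d by rewrite divr_gt0.
have [j _ /(_ j (leqnn j)) hj] := wj_cvg 0 `|s| d0.
have {}hj := hj 0 s; rewrite normr0 in hj; have {}hj := hj (lexx _) (lexx _).
have Lw : L2 L (wj j 0 s) by have [] := ncont_wj j 0.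
have -> : dot L (wlim s) z = - dot L (wj j 0 s - wlim s) z.
  rewrite (dotBl Lw (Lw0 s) Lz); have [_ ->//] : QH L N (wj j 0 s) by exact: QH_w.
  by rewrite sub0r opprK.
rewrite normrN; apply: le_trans (dot_le_nrm (L2B Lw (Lw0 s)) Lz) _.
apply: le_trans (ler_wpM2r (nrm_ge0 L z) hj) _.
by rewrite /d mulrAC ler_pdivrMr//; apply: ler_wpM2l; [exact: ltW|rewrite lerDl].
Qed.

(** * Weak limits of the low modes and of the convection term *)

Lemma vj_cvg_vbar psi F phi tau (T : R) : Cc psi -> good F -> H L phi ->
  (forall j, `|tau j| <= T) ->
  wint psi (fun s => F s * dot L (vj j (tau j) s - vbar (tau j) s) phi) @[j --> \oo] --> (0 : R).
Proof.
move=> hp gF Hphi hT; have T0 : 0 < `|T| + 1 by rewrite ltr_pwDr.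
have h := cvg_v T0 (L1H_scale L0 Hphi (Cc_good_integrable hp gF)).
have hT' j : `|tau j| <= `|T| + 1.
  by apply: le_trans (hT j) _; apply: le_trans (ler_norm _) _; rewrite lerDl.
rewrite (_ : (fun _ => _) = fun j => pairing L (vj j (tau j) - vbar (tau j)) (fun s => (psi s * F s) *: phi)).
  exact: cvg0_unif_seq h hT'.
apply/funext => j; rewrite pairing_scale//; last first.
  by move=> s; apply: HB (H_vbar _ _) => //; exact: PH_H (PH_v _ _).
by apply: eq_Rintegral => s _; rewrite mulrA.
Qed.

Lemma PH_vj j t s : PH L N (vj j t s). Proof. exact: PH_v. Qed.

Lemma L2_vj j t s : L2 L (vj j t s). Proof. exact/H_L2/PH_H/PH_v. Qed.

Lemma L2_vbar t s : L2 L (vbar t s). Proof. exact/H_L2/H_vbar. Qed.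

(** The high coefficients of [vj] vanish identically, so those of the weak limit vanish against
    every test function; [good_weak0] makes this pointwise. *)
Lemma vbar_high i : ~~ low N i -> {ae lm, forall s : R, dot L (vbar 0 s) (E i) = 0}.
Proof.
move=> hi; have gi : good (fun s => dot L (vbar 0 s) (E i)).
  by apply: LinfH_good (H_E L0 i); have [] := hvb.
apply: (good_weak0 gi) => psi hp; have hc := Cc1_Cc hp.
(* The convergence along moving times is used with the constant sequence at time [0]. *)
have z0 (j : nat) : `|(fun=> 0 : R) j| <= 0 by rewrite normr0.
have := vj_cvg_vbar hc (good_cst 1) (H_E L0 i) z0.
rewrite (_ : (fun _ => _) = fun=> wint psi (fun s => -1 * dot L (vbar 0 s) (E i))).
  move=> /cvg_cst_eq.
  by rewrite (wintZ (-1) hc gi) mulN1r => /eqP; rewrite eq_sym oppr_eq0 => /eqP.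
apply/funext => j; apply: eq_Rintegral => s _; congr (_ * _).
by rewrite (dotBl (L2_vj j 0 s) (L2_vbar 0 s) (L2_E L0 i)) (PH_coef L0 (PH_vj j 0 s) hi) sub0r mul1r mulN1r.
Qed.

(** The frame is countable, so one null set of [s] serves all high coefficients; independence of [t]
    brings [vbar t] back to [vbar 0]. *)
Lemma vbar_vlim t : {ae lm, forall s : R, nrm L (vbar t s - vlim s) = 0}.
Proof.
have h0 : {ae lm, forall s : R, forall i, ~~ low N i -> dot L (vbar 0 s) (E i) = 0}.
  apply: countable_ae => i; have [hi|hi] := boolP (low N i); first exact: aeW.
  by have := vbar_high hi; apply: aeS => s.
apply: ae2 (vb_t t 0) h0 => s e1 /(PHP L0 (H_vbar 0 s)) e2.
apply/eqP; rewrite eq_le nrm_ge0 andbT.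
have Lv := H_L2 (PH_H (PH_vlim s)).
have -> : vbar t s - vlim s = (vbar t s - vbar 0 s) + (vbar 0 s - vlim s) by rewrite addrA subrK.
have L1 := L2B (L2_vbar t s) (L2_vbar 0 s); have L2 := L2B (L2_vbar 0 s) Lv.
by apply: le_trans (nrmD L1 L2) _; rewrite e1 e2 addr0.
Qed.

Lemma vj_cvg psi F phi tau (T : R) : Cc psi -> good F -> H L phi ->
  (forall j, `|tau j| <= T) ->
  wint psi (fun s => F s * dot L (vj j (tau j) s - vlim s) phi) @[j --> \oo] --> (0 : R).
Proof.
move=> hp gF Hphi hT.
rewrite (_ : (fun _ => _) = fun j => wint psi (fun s => F s * dot L (vj j (tau j) s - vbar (tau j) s) phi)).
  exact: vj_cvg_vbar hp gF Hphi hT.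
apply/funext => j; apply: ae_Rintegral; apply: aeS (vbar_vlim (tau j)) => s e.
have Lv := L2_vj j (tau j) s; have Lb := L2_vbar (tau j) s; have Lt := H_L2 (PH_H (PH_vlim s)).
have Lp := H_L2 Hphi.
by rewrite (dotBl Lv Lt Lp) (dotBl Lv Lb Lp) (dot_nrm0 Lb Lt Lp e).
Qed.

(** For almost every [s] the difference [vj - vbar] lies in P_N H, so [B_PH] evaluates the choice
    [B] in the hypothesis as the form; [vlim] then replaces [vbar]. *)
Lemma Bvj_cvg psi phi tau (T : R) : Cc psi -> VV L phi -> (forall j, `|tau j| <= T) ->
  wint psi (fun s => Bform L (vj j (tau j) s - vlim s) (vj j (tau j) s - vlim s) phi)
    + wint psi (fun s => dot L (Rbar (tau j) s) phi) @[j --> \oo] --> (0 : R).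
Proof.
move=> hp Vp hT; have T0 : 0 < `|T| + 1 by rewrite ltr_pwDr.
have Hphi := H_VV Vp; have Lp := L2_VV Vp.
have h := cvg_B T0 (L1H_scale L0 Hphi (Cc_good_integrable hp (good_cst 1))).
have hT' j : `|tau j| <= `|T| + 1.
  by apply: le_trans (hT j) _; apply: le_trans (ler_norm _) _; rewrite lerDl.
rewrite (_ : (fun _ => _) = fun j => pairing L (fun s =>
    B L (vj j (tau j) s - vbar (tau j) s) (vj j (tau j) s - vbar (tau j) s) + Rbar (tau j) s)
    (fun s => (psi s * 1) *: phi)).
  exact: cvg0_unif_seq h hT'.
apply/funext => j; rewrite pairing_scale//; last first.
  by move=> s; apply: HD (H_Rbar _ _) => //; exact: B_H.
have ga : gv L N (fun s => vj j (tau j) s - vlim s) by exact: gvB (gv_ncont _ (ncont_vj j (tau j))) gv_vlim.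
have gR : good (fun s => dot L (Rbar (tau j) s) phi).
  by apply: LinfH_good Hphi; have [] := hRb.
rewrite -(wintD hp (gv_Bform L0 ga ga Vp) gR).
apply: ae_Rintegral; apply: aeS (vbar_vlim (tau j)) => s e; rewrite mulr1; congr (_ * _).
have Pt := PH_vlim s; have Lt := H_L2 (PH_H Pt); have Lb := L2_vbar (tau j) s.
have Lv := L2_vj j (tau j) s.
have ez : nrm L ((vj j (tau j) s - vlim s) - (vj j (tau j) s - vbar (tau j) s)) = 0.
  by rewrite opprB addrC addrA subrK.
have Lvt := L2B Lv Lt; have Lvb := L2B Lv Lb.
have Pvb : PH L N (vj j (tau j) s - vbar (tau j) s).
  apply: PH_intro => // [|i hi]; first exact: HB (PH_H (PH_v _ _)) (H_vbar _ _).
  rewrite -(dot_nrm0 Lvt Lvb (L2_E L0 i) ez) (dotBl Lv Lt (L2_E L0 i)).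
  by rewrite (PH_coef L0 (PH_v _ _) hi) (PH_coef L0 Pt hi) subrr.
have [HBv hB] := B_PH L0 Pvb.
rewrite (dotDl (H_L2 HBv) (H_L2 (H_Rbar _ _)) Lp) hB//.
by rewrite (Bform_nrm0 Vp Lvt Lvb Lvt Lvb ez ez).
Qed.

(** [limit_Bform] leaves the defect [B(vj - vlim)], and [Bvj_cvg] identifies its limit as [- Rbar];
    the two convergences are added. *)
Lemma zj_cvg psi phi tau (T : R) : Cc psi -> VV L phi -> (forall j, `|tau j| <= T) ->
  wint psi (fun s => Bform L (vj j (tau j) s + wj j (tau j) s) (vj j (tau j) s + wj j (tau j) s) phi)
    - (wint psi (fun s => Bform L (ulim s) (ulim s) phi)
       - wint psi (fun s => dot L (Rbar (tau j) s) phi)) @[j --> \oo] --> (0 : R).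
Proof.
move=> hp Vp hT.
have := @limit_Bform _ L N L0 psi phi (fun j => vj j (tau j)) (fun j => wj j (tau j)) vlim wlim vmax hp Vp.
move=> /(_ (fun j => ncont_vj j (tau j)) (fun j s => PH_v _ _) (fun j s => v_le _ _) gv_vlim PH_vlim).
move=> /(_ (fun j => ncont_wj j (tau j)) (ncont_wbar 0)) h.
have hw S e : 0 < e -> \forall j \near \oo, forall s, `|s| <= S -> nrm L (wj j (tau j) s - wlim s) <= e.
  move=> e0; have := wj_cvg T S e0; apply: filterS => j hj s hs; exact: hj.
have {h} h := h hw (fun i F gF => vj_cvg hp gF (H_E L0 i) hT).
have h' := cvg_sum2 h (Bvj_cvg hp Vp hT).
rewrite addr0 in h'; refine (cvg_eqf _ h') => j; rewrite /ulim.
by move: (wint _ _) (wint _ _) (wint _ _) (wint _ _) => *; ring.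
Qed.

Lemma wj_weak_cvg psi phi tau (T : R) : Cc psi -> H L phi -> (forall j, `|tau j| <= T) ->
  wint psi (fun s => dot L (wj j (tau j) s) phi) @[j --> \oo] --> wint psi (fun s => dot L (wlim s) phi).
Proof.
move=> hp Hphi hT; have Lp := H_L2 Hphi.
apply/cvgrPdist_le => e e0.
have [_ [M hM]] := hp.
pose I := \int[lm]_(s in setT) `|psi s|.
have I0 : 0 <= I by exact: Rintegral_ge0.
have KI : 0 < nrm L phi * I + 1 by rewrite ltr_wpDl// mulr_ge0// nrm_ge0.
pose d := e / (nrm L phi * I + 1); have d0 : 0 < d by rewrite divr_gt0.
have := wj_cvg T M d0; apply: filterS => j hj.
have g1 : good (fun s => dot L (wlim s) phi) by exact: gv_dot gv_wlim Lp.
have g2 : good (fun s => dot L (wj j (tau j) s) phi).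
  by apply/good_cont/ncont_dot => //; exact: ncont_wj.
rewrite -(wintB hp g1 g2).
have b s : `|s| <= M -> `|dot L (wlim s) phi - dot L (wj j (tau j) s) phi| <= d * nrm L phi.
  move=> hs; have [Lw _] := ncont_wj j (tau j); have [Lb _] := ncont_wbar 0.
  rewrite distrC -(dotBl (Lw s) (Lb s) Lp); apply: le_trans (dot_le_nrm (L2B (Lw s) (Lb s)) Lp) _.
  by apply: ler_wpM2r; [exact: nrm_ge0|exact: hj].
apply: le_trans (wint_le hp (goodB g1 g2) hM _ b) _; first by rewrite mulr_ge0 ?nrm_ge0// ltW.
by rewrite -mulrA /d mulrAC ler_pdivrMr//; apply: ler_wpM2l; [exact: ltW|rewrite lerDl].
Qed.

(** Left side minus right side of the limit equation, tested. Since [ulim] is free of [t], the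
    parameter enters through [Rbar t] alone, which is why vanishing for every [t] forces [Rbar] to
    be constant in [t]. *)
Definition weak_defect t psi phi : R :=
  - wint (derive1 psi) (fun s => dot L (ulim s) phi)
  + nu * wint psi (fun s => dot L (ulim s) (- lapl phi))
  + wint psi (fun s => Bform L (ulim s) (ulim s) phi)
  - wint psi (fun s => dot L f phi + dot L (Rbar t s) phi).

Lemma good_Rbar t phi : H L phi -> good (fun s => dot L (Rbar t s) phi).
Proof. by move=> Hphi; apply: LinfH_good Hphi; have [] := hRb. Qed.

Lemma cutv_v r s : cutv nu L f (v r) s = v r s.
Proof.
rewrite /cutv /cutoff ifT ?scale1r// normrM ger0_norm ?nrm_ge0//.
have nk : 0 < nu * k0 by rewrite mulr_gt0 ?(kappa0_gt0 L0).
rewrite gtr0_norm ?invr_gt0// ler_pdivrMr//; apply: le_trans (bv r s) _.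
by rewrite le_eqVlt; apply/orP; left; apply/eqP; ring.
Qed.

Lemma dot_QN phi : VV L phi -> QH L N phi -> dot L (QN L N f) phi = dot L f phi.
Proof.
move=> Vp [_ Qp]; have [Pf _] := PN_spec L0 N (H_L2 Hf).
rewrite /QN (dotBl (H_L2 Hf) (H_L2 (PH_H Pf)) (L2_VV Vp)).
by rewrite [dot L (PN L N f) _]dotC Qp ?subr0.
Qed.

(** The equation for [W (v r)] is autonomous in [s], so translating the test function by
    [r = t + tj j] gives it for the shifted fields. The cutoff is inactive by the bound on [v]. *)
Lemma wj_weak j t psi phi : Cc1 psi -> VV L phi -> QH L N phi ->
  - wint (derive1 psi) (fun s => dot L (wj j t s) phi)
  + nu * wint psi (fun s => dot L (wj j t s) (- lapl phi))
  + wint psi (fun s => Bform L (vj j t s + wj j t s) (vj j t s + wj j t s) phi)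
  = wint psi (fun=> dot L f phi).
Proof.
move=> hp Vp Qp; have Vn := VV_nlapl L0 Vp; set r := t + tj j.
have hc := Cc1_Cc hp; have [dp cdp [M hM]] := hp; have [cp _] := hc.
have cw1 : continuous (fun s => dot L (W (v r) s) phi) by exact: ncont_dot (ncont_wslice r) (L2_VV Vp).
have cw2 : continuous (fun s => dot L (W (v r) s) (- lapl phi)) by exact: ncont_dot (ncont_wslice r) (L2_VV Vn).
have cz := ncontD (ncont_v r) (ncont_wslice r).
have cB : continuous (fun s => Bform L (v r s + W (v r) s) (v r s + W (v r) s) phi).
  exact: (ncont_Bform cz cz Vp).
have cS (g : R -> R) a : continuous g -> continuous (fun s => g (s + a)).
  by move=> cg x; apply: (@continuous_comp _ _ _ (fun s => s + a) g); [apply: cvgD; [exact: cvg_id|exact: cvg_cst]|exact: cg].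
have gS (g : R -> R) : continuous g -> good (fun s => g (s - r)) by move=> cg; exact/good_cont/cS.
rewrite -(weak_split nu hp (gS _ cw1) (gS _ cw2) (gS _ cB)).
rewrite /wint (Rintegral_shift r); last first.
  apply: contD.
    rewrite (_ : (fun _ => _) = fun s => -1 * (derive1 psi s * dot L (W (v r) (s - r)) phi)); last first.
      by apply/funext => s; rewrite mulN1r.
    by apply: contM; [exact: cont_cst|exact: (contM cdp (cS _ _ cw1))].
  apply: contM => //; apply: contD; last exact: (cS _ _ cB).
  by apply: contM; [exact: cont_cst|exact: (cS _ _ cw2)].
rewrite [RHS](Rintegral_shift r); last by apply: (contM cp); exact: cont_cst.
have [_ _ _ hweak] := w_sol r.
have [hp' dE] := Cc1_shift r hp.
have := hweak phi (fun s => psi (s + r)) Vp Qp hp'; rewrite dE.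
under [X in _ = X -> _]eq_Rintegral do rewrite (dot_QN Vp Qp).
move=> <-; apply: eq_Rintegral => s _; rewrite addrK.
have e : (cutv nu L f (v r) + W (v r)) s = v r s + W (v r) s by rewrite -[in RHS](cutv_v r s).
by rewrite e.
Qed.

Lemma weak_defect_QH t psi phi : Cc1 psi -> VV L phi -> QH L N phi -> weak_defect t psi phi = 0.
Proof.
move=> hp Vp Qp; have hc := Cc1_Cc hp; have hd := Cc1_derive_Cc hp.
have Vn := VV_nlapl L0 Vp; have Qn := QH_nlapl L0 Vp Qp.
have Hp := H_VV Vp; have Hn := H_VV Vn.
have yE z s : VV L z -> QH L N z -> dot L (ulim s) z = dot L (wlim s) z.
  move=> Vz [_ Qz]; have [Lwb _] := ncont_wbar 0.
  by rewrite (dotDl (H_L2 (PH_H (PH_vlim s))) (Lwb s) (L2_VV Vz)) [dot L (vlim s) _]dotC (Qz _ (PH_vlim s)) add0r.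
have ht (j : nat) : `|(fun=> t) j| <= `|t| by [].
have c1 := wj_weak_cvg hd Hp ht; have c2 := wj_weak_cvg hc Hn ht; have c3 := zj_cvg hc Vp ht.
have h := cvg_combination (c := nu) c1 c2 c3.
(* By [wj_weak] the combination has a value independent of [j], hence equal to its limit. The terms
   in [vlim] are absent because [phi] and its Laplacian are orthogonal to P_N H. *)
have {}h := cvg_eqf _ h; have e := cvg_cst_eq (h (fun=> wint psi (fun=> dot L f phi) -
  (wint psi (fun s => Bform L (ulim s) (ulim s) phi) - wint psi (fun s => dot L (Rbar t s) phi))) _).
have {}e := e (fun j => etrans (addrA _ _ _) (congr1 (fun x => x - _) (wj_weak j t hp Vp Qp))).
rewrite /weak_defect (wintD hc (good_cst _) (good_Rbar t Hp)).
have yw p z : VV L z -> QH L N z -> wint p (fun s => dot L (ulim s) z) = wint p (fun s => dot L (wlim s) z).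
  by move=> Vz Qz; apply: eq_Rintegral => s _; rewrite yE.
rewrite addr0 in e; rewrite (yw _ _ Vp Qp) (yw _ _ Vn Qn) e.
by move: (wint _ _) (wint _ _) (wint _ _) => *; ring.
Qed.

(** The time derivative prescribed by the determining form, tested against a [phi] in P_N H: such a
    [phi] absorbs the projector in front of B and of [f]. *)
Definition slice_rhs phi r s : R :=
  - (nu * dot L (v r s) (- lapl phi)) - Bform L (v r s + W (v r) s) (v r s + W (v r) s) phi + dot L f phi.

(** The difference quotient converges in X, that is, uniformly in [s] for the norm of V; the
    Poincare inequality passes to the scalar component at each [s]. *)
Lemma v_derive r s phi : VV L phi -> PH L N phi ->
  is_derive r (1 : R) (fun r => dot L (v r s) phi) (slice_rhs phi r s).
Proof.
move=> Vp Pp; have [_ [D [XD hD eqD]]] := hv r.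
have [PD _ _] := XD; have Lp := L2_VV Vp.
have Lv r' : L2 L (v r' s) by exact/H_L2/PH_H/PH_v.
have LD := H_L2 (PH_H (PD s)).
have -> : slice_rhs phi r s = dot L (D s) phi.
  have [p [Pp' hp] e0] := eqD s; rewrite !cutv_v in hp.
  have [PNf hN] := PN_spec L0 N (H_L2 Hf).
  have dA := domA_PH L0 1 (PH_v r s); have [_ HA _] := Apow_spec dA.
  have LA := L2Z nu (H_L2 HA); have Lpp := H_L2 (PH_H Pp'); have LN := H_L2 (PH_H PNf).
  have LDA := L2D LD LA; have LDAp := L2D LDA Lpp.
  have := nrm0P (L2B LDAp LN) Lp e0.
  rewrite (dotBl LDAp LN Lp) (dotDl LDA Lpp Lp) (dotDl LD LA Lp) (dotZl _ (H_L2 HA) Lp).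
  rewrite (Apow1_lapl L0 dA Vp) hp//.
  have := hN _ Pp; rewrite (dotBl (H_L2 Hf) LN Lp) /slice_rhs => e1 e2.
  by move: e1 e2; move: (dot _ _ _) (dot _ _ _) (dot _ _ _) (dot _ _ _) (Bform _ _ _ _) => *; lra.
apply: is_derive_cvg; apply/cvgrPdist_le => e e0.
pose e' := k0 * (e / (nrm L phi + 1)).
have n1 : 0 < nrm L phi + 1 by rewrite ltr_wpDl ?nrm_ge0.
have e'0 : 0 < e' by rewrite mulr_gt0 ?(kappa0_gt0 L0)// divr_gt0.
have := hD _ (@nbhs_open_ereal_lt R 0 (fun=> e') e'0); rewrite nbhs_filterE /=; apply: filterS => h hh.
have Lh := L2Z h^-1 (L2B (Lv (r + h)) (Lv r)).
have -> : dot L (D s) phi - h^-1 * (dot L (v (r + h) s) phi - dot L (v r s) phi) =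
    - dot L (h^-1 *: (v (r + h) s - v r s) - D s) phi.
  rewrite (dotBl Lh LD Lp) (dotZl _ (L2B (Lv (r + h)) (Lv r)) Lp) (dotBl (Lv (r + h)) (Lv r) Lp).
  by rewrite opprB.
rewrite normrN; apply: le_trans (dot_le_nrm (L2B Lh LD) Lp) _.
have Vv r' : V L (v r' s) by exact: PH_V (PH_v r' s).
have [Vh _] := V_scale L0 h^-1 (V_sub (Vv (r + h)) (Vv r)).
have Vu := V_sub Vh (PH_V L0 (PD s)).
have bu : nrmV L (h^-1 *: (v (r + h) s - v r s) - D s) <= e'.
  rewrite -lee_fin; apply: le_trans (ltW hh); apply: ereal_sup_ubound; exists s => //.
have bu' : nrm L (h^-1 *: (v (r + h) s - v r s) - D s) <= e / (nrm L phi + 1).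
  by apply: le_trans (nrm_le_nrmV L0 Vu) _; rewrite ler_pdivrMl ?(kappa0_gt0 L0).
apply: le_trans (ler_wpM2r (nrm_ge0 L phi) bu') _.
by rewrite mulrAC ler_pdivrMr//; apply: ler_wpM2l; [exact: ltW|rewrite lerDl].
Qed.

(** Supplies the domination for [slice_derivative]. The field [v] is bounded globally, but [W (v r)]
    is bounded jointly in [r] and [s] only on compact sets, by [ncont_w]. *)
Lemma slice_rhs_bound phi : VV L phi -> forall S, exists Kb : R, forall r s,
  `|r| <= S -> `|s| <= S -> `|slice_rhs phi r s| <= Kb.
Proof.
move=> Vp S; have [C C0 hC] := Bform_bound Vp.
have [Mw hMw] := cont_bounded2 (ncont_nrm ncont_w) S.
have Ln := L2_VV (VV_nlapl L0 Vp).
exists (nu * (vmax * nrm L (- lapl phi)) + C * (vmax + Mw) * (vmax + Mw) + `|dot L f phi|).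
move=> r s hr hs; have Lv := H_L2 (PH_H (PH_v r s)); have Lw := H_L2 (V_H (V_w r s)).
have hw : nrm L (W (v r) s) <= Mw by apply: le_trans (ler_norm _) (hMw r s hr hs).
have hz : nrm L (v r s + W (v r) s) <= vmax + Mw.
  by apply: le_trans (nrmD Lv Lw) _; apply: lerD; [exact: v_le|].
rewrite /slice_rhs; apply: le_trans (ler_normD _ _) _; apply: lerD => //.
apply: le_trans (ler_normB _ _) _; apply: lerD.
  rewrite normrN normrM gtr0_norm// ler_pM2l//; apply: le_trans (dot_le_nrm Lv Ln) _.
  by apply: ler_wpM2r; [exact: nrm_ge0|exact: v_le].
have zn := nrm_ge0 L (v r s + W (v r) s).
apply: le_trans (hC _ _ (L2D Lv Lw) (L2D Lv Lw)) _.
apply: ler_pM => //; first exact: mulr_ge0.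
exact: ler_wpM2l.
Qed.

(** The term with [derive1 psi] comes from the moving slice; in the limit it becomes the weak [s]
    derivative of [vbar]. *)
Lemma vj_derive psi phi j t : Cc1 psi -> VV L phi -> PH L N phi ->
  is_derive t (1 : R) (fun t => wint psi (fun s => dot L (vj j t s) phi))
    (wint (derive1 psi) (fun s => dot L (vj j t s) phi) +
     (- (nu * wint psi (fun s => dot L (vj j t s) (- lapl phi)))
      - wint psi (fun s => Bform L (vj j t s + wj j t s) (vj j t s + wj j t s) phi)
      + wint psi (fun=> dot L f phi))).
Proof.
move=> hp Vp Pp; have hc := Cc1_Cc hp; have Lp := L2_VV Vp; have Ln := L2_VV (VV_nlapl L0 Vp).
have ca r : continuous (fun s => dot L (v r s) phi) by exact: ncont_dot (ncont_v r) Lp.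
have cz := fun r => ncontD (ncont_v r) (ncont_wslice r).
have cB r : continuous (fun s => Bform L (v r s + W (v r) s) (v r s + W (v r) s) phi).
  exact: (ncont_Bform (cz r) (cz r) Vp).
have cn r : continuous (fun s => dot L (v r s) (- lapl phi)) by exact: ncont_dot (ncont_v r) Ln.
have cb r : continuous (slice_rhs phi r).
  rewrite (_ : slice_rhs phi r = fun s => (- nu * dot L (v r s) (- lapl phi) +
    (-1 * Bform L (v r s + W (v r) s) (v r s + W (v r) s) phi)) + dot L f phi).
    apply: contD; last exact: cont_cst.
    apply: contD; (apply: contM; first exact: cont_cst) => //.
  by apply/funext => s; rewrite /slice_rhs mulN1r mulNr.
have ba r s : `|dot L (v r s) phi| <= vmax * nrm L phi.
  apply: le_trans (dot_le_nrm (H_L2 (PH_H (PH_v r s))) Lp) _.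
  by apply: ler_wpM2r; [exact: nrm_ge0|exact: v_le].
have h := slice_derivative (t + tj j) hp ca cb (fun r s => v_derive r s Vp Pp) ba (slice_rhs_bound Vp).
have -> : - (nu * wint psi (fun s => dot L (vj j t s) (- lapl phi)))
      - wint psi (fun s => Bform L (vj j t s + wj j t s) (vj j t s + wj j t s) phi)
      + wint psi (fun=> dot L f phi) =
    wint psi (fun s => slice_rhs phi (t + tj j) (s - (t + tj j))).
  have g1 : good (fun s => dot L (vj j t s) (- lapl phi)).
    exact: (good_cont (ncont_dot (ncont_vj j t) Ln)).
  have gj : gv L N (vj j t) by exact: gv_ncont _ (ncont_vj j t).
  have gj' : gv L N (wj j t) by exact: gv_ncont _ (ncont_wj j t).
  have gz := gvD L0 gj gj'.
  have g2 := gv_Bform L0 gz gz Vp.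
  have g12 := goodB (goodZ (- nu) g1) g2.
  rewrite -mulNr -(wintZ (- nu) hc g1) -(wintB hc (goodZ (- nu) g1) g2) -(wintD hc g12 (good_cst _)).
  by apply: eq_Rintegral => s _; rewrite /slice_rhs mulNr.
exact: is_derive_shift h.
Qed.

Lemma weak_defect_PH t psi phi : Cc1 psi -> VV L phi -> PH L N phi -> weak_defect t psi phi = 0.
Proof.
move=> hp Vp Pp; have hc := Cc1_Cc hp; have hd := Cc1_derive_Cc hp.
have Vn := VV_nlapl L0 Vp; have Pn := PH_nlapl L0 Vp Pp.
have Hp := H_VV Vp; have Hn := H_VV Vn; have Lp := L2_VV Vp; have Ln := L2_VV Vn.
have yw p z : VV L z -> PH L N z -> wint p (fun s => dot L (ulim s) z) = wint p (fun s => dot L (vlim s) z).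
  move=> Vz Pz; apply: eq_Rintegral => s _; have [Lwb _] := ncont_wbar 0.
  rewrite (dotDl (H_L2 (PH_H (PH_vlim s))) (Lwb s) (L2_VV Vz)).
  by have [_ ->//] := QH_wlim s; rewrite addr0.
(* Weak star continuity of [Rbar], tested against [psi] times [phi]; it is the only source of [t]
   dependence in [J]. *)
have cR : continuous (fun t => wint psi (fun s => dot L f phi + dot L (Rbar t s) phi)).
  rewrite (_ : (fun _ => _) = fun t => wint psi (fun=> dot L f phi) + pairing L (Rbar t) (fun s => (psi s * 1) *: phi)).
    apply: contD; first exact: cont_cst.
    have [_ h] := hRb; apply: h.
    exact: (L1H_scale L0 Hp (Cc_good_integrable hc (good_cst 1))).
  apply/funext => t'; rewrite (wintD hc (good_cst _) (good_Rbar t' Hp)) (pairing_scale _ (H_Rbar t') Hp).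
  by congr (_ + _); apply: eq_Rintegral => s _; rewrite mulr1.
have cJ : continuous (fun t => - weak_defect t psi phi).
  rewrite (_ : (fun _ => _) = fun t => - (- wint (derive1 psi) (fun s => dot L (ulim s) phi)
    + nu * wint psi (fun s => dot L (ulim s) (- lapl phi)) + wint psi (fun s => Bform L (ulim s) (ulim s) phi))
    + wint psi (fun s => dot L f phi + dot L (Rbar t s) phi)).
    by apply: contD; [exact: cont_cst|exact: cR].
  by apply/funext => t'; rewrite /weak_defect opprB addrC.
have gvt p : L2 L p -> good (fun s => dot L (vlim s) p) by exact: gv_dot gv_vlim.
have gvj p j t' : L2 L p -> good (fun s => dot L (vj j t' s) p).
  by move=> L2p; exact: (good_cont (ncont_dot (ncont_vj j t') L2p)).
have c1 p tau (T : R) ps : Cc ps -> VV L p -> (forall j, `|tau j| <= T) ->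
    wint ps (fun s => dot L (vj j (tau j) s) p) - wint ps (fun s => dot L (vlim s) p) @[j --> \oo] --> (0 : R).
  move=> hps Vp' hT; have Lp' := L2_VV Vp'.
  apply: (cvg_eqf _ (vj_cvg hps (good_cst 1) (H_VV Vp') hT)) => j.
  rewrite -(wintB hps (gvj _ j (tau j) Lp') (gvt _ Lp')); apply: eq_Rintegral => s _.
  by rewrite mul1r (dotBl (L2_vj j (tau j) s) (H_L2 (PH_H (PH_vlim s))) Lp').
(* Here [J] is [- weak_defect], since [vj_derive] carries the equation with all terms on the right;
   the constant [c] is free of [t] because [vlim] is. *)
have hJ := @limit_derivative_zero _ _ _ (fun t => - weak_defect t psi phi)
  (wint psi (fun s => dot L (vlim s) phi)) (fun j t => vj_derive j t hp Vp Pp) cJ.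
apply/eqP; rewrite -oppr_eq0; apply/eqP; apply: hJ.
  move=> t'; have ht (j : nat) : `|(fun=> t') j| <= `|t'| by [].
  have c0 : (fun=> wint psi (fun s => dot L (vlim s) phi)) @ \oo --> wint psi (fun s => dot L (vlim s) phi).
    exact: cvg_cst.
  have h1 := cvg_sum2 (c1 _ _ _ _ hc Vp ht) c0.
  by rewrite add0r in h1; apply: (cvg_eqf _ h1) => j; rewrite subrK.
move=> tau T hT.
have h := cvg_combination (c := nu) (c1 _ _ _ _ hd Vp hT) (c1 _ _ _ _ hc Vn hT) (zj_cvg hc Vp hT).
have h' := cvg_opp h; rewrite oppr0 mulr0 !addr0 oppr0 in h'.
apply: (cvg_eqf _ h') => j /=.
rewrite /weak_defect (yw _ _ Vp Pp) (yw _ _ Vn Pn) (wintD hc (good_cst _) (good_Rbar _ Hp)).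
by move: (wint _ _) (wint _ _) (wint _ _) (wint _ _) (wint _ _) (wint _ _) (wint _ _) (wint _ _) => *; ring.
Qed.

Lemma weak_defectD t psi phi phi' : Cc1 psi -> VV L phi -> VV L phi' ->
  weak_defect t psi (phi + phi') = weak_defect t psi phi + weak_defect t psi phi'.
Proof.
move=> hp Vp Vp'; have hc := Cc1_Cc hp; have hd := Cc1_derive_Cc hp.
have Vn := VV_nlapl L0 Vp; have Vn' := VV_nlapl L0 Vp'.
have Lp := L2_VV Vp; have Lp' := L2_VV Vp'; have Ln := L2_VV Vn; have Ln' := L2_VV Vn'.
have [Ly _] := gv_ulim.
have gy z : L2 L z -> good (fun s => dot L (ulim s) z) by exact: gv_dot gv_ulim.
have dw p a b : Cc p -> L2 L a -> L2 L b -> wint p (fun s => dot L (ulim s) (a + b)) =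
    wint p (fun s => dot L (ulim s) a) + wint p (fun s => dot L (ulim s) b).
  move=> hp' La Lb; rewrite -(wintD hp' (gy _ La) (gy _ Lb)); apply: eq_Rintegral => s _.
  by rewrite (dotDr La Lb (Ly s)).
have lE : - lapl (phi + phi') = - lapl phi + - lapl phi'.
  by rewrite -[X in lapl (X + _)]scale1r (lapl_lin _ Vp Vp') scale1r opprD.
have BE : wint psi (fun s => Bform L (ulim s) (ulim s) (phi + phi')) =
    wint psi (fun s => Bform L (ulim s) (ulim s) phi) + wint psi (fun s => Bform L (ulim s) (ulim s) phi').
  rewrite -(wintD hc (gv_Bform L0 gv_ulim gv_ulim Vp) (gv_Bform L0 gv_ulim gv_ulim Vp')).
  apply: eq_Rintegral => s _; rewrite -[X in Bform _ _ _ (X + _)]scale1r.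
  by rewrite (Bform_linphi 1 Vp Vp' (Ly s) (Ly s)) mul1r.
have gR z : VV L z -> good (fun s => dot L f z + dot L (Rbar t s) z).
  by move=> Vz; exact: goodD (good_cst _) (good_Rbar t (H_VV Vz)).
have RE : wint psi (fun s => dot L f (phi + phi') + dot L (Rbar t s) (phi + phi')) =
    wint psi (fun s => dot L f phi + dot L (Rbar t s) phi) +
    wint psi (fun s => dot L f phi' + dot L (Rbar t s) phi').
  rewrite -(wintD hc (gR _ Vp) (gR _ Vp')); apply: eq_Rintegral => s _.
  by rewrite (dotDr Lp Lp' (H_L2 Hf)) (dotDr Lp Lp' (H_L2 (H_Rbar t s))) addrACA.
have e1 := dw _ _ _ hd Lp Lp'; have e2 := dw _ _ _ hc Ln Ln'; rewrite -lE in e2.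
have combine (a a1 a2 b b1 b2 c c1 c2 d d1 d2 : R) :
    a = a1 + a2 -> b = b1 + b2 -> c = c1 + c2 -> d = d1 + d2 ->
    - a + nu * b + c - d = (- a1 + nu * b1 + c1 - d1) + (- a2 + nu * b2 + c2 - d2).
  by move=> -> -> -> ->; ring.
exact: combine e1 e2 BE RE.
Qed.

Lemma weak_defect_eq0 t psi phi : Cc1 psi -> VV L phi -> weak_defect t psi phi = 0.
Proof.
move=> hp Vp; have V1 := VV_Pi L0 N phi.
have V2 : VV L (phi - Pi L N phi) by rewrite -scaleN1r addrC; exact: VV_lin.
rewrite -[phi](subrK (Pi L N phi)) weak_defectD//.
rewrite (weak_defect_QH t hp V2 (QH_Pi L0 N (H_VV Vp))) (weak_defect_PH t hp V1 (Pi_PH L0 N phi)).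
exact: addr0.
Qed.

Lemma Rbar_time_independent t t' : eqH L (Rbar t) (Rbar t').
Proof.
have h i : {ae lm, forall s : R, dot L (Rbar t s) (E i) - dot L (Rbar t' s) (E i) = 0}.
  have g1 := good_Rbar t (H_E L0 i); have g2 := good_Rbar t' (H_E L0 i).
  apply: (good_weak0 (goodB g1 g2)) => psi hp; have hc := Cc1_Cc hp.
  have e1 := weak_defect_eq0 t hp (VV_E L0 i); have e2 := weak_defect_eq0 t' hp (VV_E L0 i).
  rewrite (wintB hc g1 g2); move: e1 e2; rewrite /weak_defect.
  rewrite (wintD hc (good_cst _) g1) (wintD hc (good_cst _) g2).
  by move: (wint _ _) (wint _ _) (wint _ _) (wint _ _) (wint _ _) => *; lra.
apply: aeS (countable_ae h) => s hs; apply: H_ext => //; first exact: HB (H_Rbar t s) (H_Rbar t' s).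
by move=> i; rewrite (dotBl (H_L2 (H_Rbar t s)) (H_L2 (H_Rbar t' s)) (L2_E L0 i)) hs.
Qed.

Lemma limit_weak_eq t : weak_eq nu L setT (vbar t + wbar t) (vbar t + wbar t) (fun s => f + Rbar t s).
Proof.
move=> phi psi Vp _ hp; have hc := Cc1_Cc hp; have hd := Cc1_derive_Cc hp.
have Lp := L2_VV Vp; have Ln := L2_VV (VV_nlapl L0 Vp); have [Ly _] := gv_ulim.
have gF : good (fun s => dot L (ulim s) phi) by exact: gv_dot gv_ulim Lp.
have gG : good (fun s => dot L (ulim s) (- lapl phi)) by exact: gv_dot gv_ulim Ln.
have gK := gv_Bform L0 gv_ulim gv_ulim Vp.
transitivity (\int[lm]_(s in setT) (- (derive1 psi s * dot L (ulim s) phi) +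
    psi s * (nu * dot L (ulim s) (- lapl phi) + Bform L (ulim s) (ulim s) phi))).
  apply: ae_Rintegral; apply: aeS (vbar_vlim t) => s e.
  have [Lw _] := ncont_wbar t; have [Lw0 _] := ncont_wbar 0.
  have Lt := H_L2 (PH_H (PH_vlim s)); have Lb := L2_vbar t s.
  have Lu : L2 L (vbar t s + wbar t s) by exact: L2D (Lw s).
  have ey : nrm L ((vbar t s + wbar t s) - ulim s) = 0.
    apply/eqP; rewrite eq_le nrm_ge0 andbT.
    have -> : (vbar t s + wbar t s) - ulim s = (vbar t s - vlim s) + (wbar t s - wbar 0 s).
      by rewrite /ulim opprD addrACA.
    by apply: le_trans (nrmD (L2B Lb Lt) (L2B (Lw s) (Lw0 s))) _; rewrite e wb_t addr0.
  rewrite [(vbar t + wbar t) s](_ : _ = vbar t s + wbar t s)//.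
  by rewrite (dot_nrm0 Lu (Ly s) Lp ey) (dot_nrm0 Lu (Ly s) Ln ey) (Bform_nrm0 Vp Lu (Ly s) Lu (Ly s) ey ey).
rewrite (weak_split nu hp gF gG gK).
have := weak_defect_eq0 t hp Vp; rewrite /weak_defect => /eqP; rewrite subr_eq0 => /eqP ->.
by apply: eq_Rintegral => s _; rewrite (dotDl (H_L2 Hf) (H_L2 (H_Rbar t s)) Lp).
Qed.

(** [vbar t] is bounded only in H, but its values lie in P_N H almost everywhere, so the inverse
    inequality bounds it in V; [wbar t] is continuous into V, hence locally bounded. *)
Lemma limit_V t (M : R) : exists C : R, {ae lm, forall s : R, `|s| <= M ->
  V L ((vbar t + wbar t) s) /\ nrmV L ((vbar t + wbar t) s) <= C}.
Proof.
have [hL _] := hvb; have [_ [Mb hMb]] := hL t.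
have cw : continuous (fun s => nrmV L (wbar t s)).
  move=> s0; apply: cvg_of_bound (@nrmV_wbar_cont t s0) _ => s; exact: nrmV_dist (V_wbar t s) (V_wbar t s0).
have [Mw hMw] := cont_bounded cw M.
exists (k0 * N%:R * Mb + Mw); apply: ae2 hMb (vbar_vlim t) => s hb e hs.
have Lt := H_L2 (PH_H (PH_vlim s)); have Lb := L2_vbar t s.
have Pb : PH L N (vbar t s).
  apply: PH_intro => // [|i hi]; first exact: H_vbar.
  rewrite (dot_nrm0 Lb Lt (L2_E L0 i) e).
  exact: (PH_coef L0 (PH_vlim s) hi).
have [Vs le] := V_addr L0 (PH_V L0 Pb) (V_wbar t s); split => //.
apply: le_trans le _; apply: lerD.
  apply: le_trans (nrmV_PH_le L0 Pb) _; apply: ler_wpM2l => //.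
  by rewrite mulr_ge0// ltW// (kappa0_gt0 L0).
exact: le_trans (ler_norm _) (hMw s hs).
Qed.

Lemma limit_NSE t : NSE_weak_sol nu L (vbar t + wbar t) (fun s => f + Rbar t s).
Proof.
split; [|exact: limit_V|exact: limit_weak_eq].
split=> [s|u Hu]; first exact: HD (H_vbar t s) (V_H (V_wbar t s)).
have [hL _] := hvb; have [[_ mb] _] := hL t; have [Lw _] := ncont_wbar t.
rewrite (_ : (fun _ => _) = fun s => dot L (vbar t s) u + dot L (wbar t s) u).
  apply: measurable_funD; first exact: mb.
  exact: continuous_measurable_fun (ncont_dot (ncont_wbar t) (H_L2 Hu)).
by apply/funext => s; exact: dotDl (L2_vbar t s) (Lw s) (H_L2 Hu).
Qed.

End LimitEquation.

Theorem proposition9p2 (R : realType) (nu L : R) (f : vfield R)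
    (N : nat) (cA cB cL cT : R)
    (W : (R -> vfield R) -> (R -> vfield R))
    (v : R -> R -> vfield R) (tn : nat -> R) (nj : nat -> nat)
    (vbar Rbar wbar : R -> R -> vfield R) :
  let w := fun t s => W (v t) s in
  let vn := fun n t s => v (t + tn n) (s - (t + tn n)) in
  let wn := fun n t s => w (t + tn n) (s - (t + tn n)) in
  0 < nu -> 0 < L -> (0 < N)%N ->
  H L f -> 0 < nrm L f ->
  domA L (1 / 2) (QN L N f) ->
  constants L cA cB cL cT ->
  3 * cL * G nu L f < N%:R ->
  solution_map nu L f N W ->
  G nu L f * (9 + beta nu L f N cL cT) * (cA + cL) < N%:R ->
  determining_form_sol nu L f N W v ->
  (forall t s, nrmV L (v t s) <= 2 * nu * kappa0 L * G nu L f) ->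
  tn n @[n --> \oo] --> +oo ->
  {homo nj : i j / (i < j)%N} ->
  C_Linf_weakstar L vbar -> C_Linf_weakstar L Rbar ->
  C_V_on L setT wbar ->
  (forall T S xi, 0 < T -> 0 < S -> L1H L xi ->
    [/\ cvg0_unif T (fun j t =>
          pairing L (vn (nj j) t - vbar t) xi),
        cvg0_unif T (fun j t =>
          pairing L (fun s => B L (vn (nj j) t s - vbar t s)
                                  (vn (nj j) t s - vbar t s) + Rbar t s) xi) &
        cvg_C_V L (`[- T, T] `*` `[- S, S]) (fun j => wn (nj j)) wbar]) ->
  (forall t t', eqH L (vbar t) (vbar t')) ->
  (forall t t' s, nrm L (wbar t s - wbar t' s) = 0) ->
  (forall t t', eqH L (Rbar t) (Rbar t')) /\
  (forall t, NSE_weak_sol nu L (vbar t + wbar t) (fun s => f + Rbar t s)).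
Proof.
move=> w vn wn nu0 L0 _ Hf _ _ _ _ hW _ hv bv _ _ hvb hRb hwb hcvg hvt hwt.
pose tj := tn \o nj.
have cvg_v T xi : 0 < T -> L1H L xi ->
    cvg0_unif T (fun j t => pairing L (shifted tj v j t - vbar t) xi).
  by move=> T0 hxi; have [h _ _] := hcvg T 1 xi T0 ltr01 hxi.
have cvg_B T xi : 0 < T -> L1H L xi -> cvg0_unif T (fun j t => pairing L (fun s =>
    B L (shifted tj v j t s - vbar t s) (shifted tj v j t s - vbar t s) + Rbar t s) xi).
  by move=> T0 hxi; have [_ h _] := hcvg T 1 xi T0 ltr01 hxi.
have cvg_w T S : 0 < T -> 0 < S ->
    cvg_C_V L (`[- T, T] `*` `[- S, S]) (shifted tj (fun r s => W (v r) s)) wbar.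
  (* The three convergences are bundled under one [xi], so an element of L^1(R, H) must be supplied;
     the zero function is taken. *)
  move=> T0 S0; have L10 : L1H L (fun s => (0 * 0 : R) *: (0 : vfield R)).
    apply: L1H_scale; [exact: L0|exact: H0|].
    apply: (Cc_good_integrable (psi := fun=> 0)) (good_cst 0).
    by split; [exact: cont_cst|exists 0].
  by have [_ _ h] := hcvg T S _ T0 S0 L10.
split=> [t t'|t].
  exact: (@Rbar_time_independent _ nu L f N W v tj vbar Rbar wbar).
exact: (@limit_NSE _ nu L f N W v tj vbar Rbar wbar).
Qed.
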